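(* Let $G$ be a locally compact second countable Hausdorff étale groupoid and let $c\colon G\to\mathbb{R}$ be a continuous $\mathbb{R}$-valued $1$-cocycle. Let $\sigma^c$ be the associated dynamics on $C^*(G)$, let $Z\subset G^{(0)}$ be the boundary set of $c$, and let $G_Z$ be the boundary groupoid. If $Z\neq\emptyset$ and $G_Z$ is étale, then there is an affine isomorphism of the state space of $C^*(G_Z)$ onto the $\sigma^c$-ground state space of $C^*(G)$ that maps a state $\psi$ of $C^*(G_Z)$ to the unique state $\varphi_\psi$ of $C^*(G)$ defined by $$\varphi_\psi(f)=\psi(f|_{G_Z})\quad\text{for } f\in C_c(G).$$ If $Z=\emptyset$, then there are no $\sigma^c$-ground states on $C^*(G)$.
   Context: For a groupoid $G$, $G^{(0)}$ is the unit space, $r,s\colon G\to G^{(0)}$ are the range and source maps, $G^x=r^{-1}(x)$, $G_x=s^{-1}(x)$. $G$ is étale if $r$ and $s$ are local homeomorphisms. For an étale groupoid $G$, $C_c(G)$ is a $*$-algebra with product $(f_1*f_2)(g)=\sum_{h\in G^{r(g)}}f_1(h)f_2(h^{-1}g)$ and involution $f^*(g)=\overline{f(g^{-1})}$, and $C^*(G)$ is its enveloping $C^*$-algebra (full groupoid $C^*$-algebra). A continuous $\mathbb{R}$-valued $1$-cocycle is a continuous groupoid homomorphism $c\colon G\to(\mathbb{R},+)$. The associated dynamics $\sigma^c=\{\sigma^c_t\}_{t\in\mathbb{R}}$ is the unique continuous one-parameter group of automorphisms of $C^*(G)$ with $\sigma^c_t(f)(g)=e^{itc(g)}f(g)$ for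 $f\in C_c(G)$, $g\in G$. The boundary set of $c$ is $Z=\{x\in G^{(0)} : c\le 0 \text{ on } G^x\}=\{x\in G^{(0)} : c\ge 0\text{ on } G_x\}$. The boundary groupoid of $c$ is the reduction $G_Z=\{g\in G : r(g)\in Z,\ s(g)\in Z\}$ (which in general may fail to be étale). Given a continuous one-parameter group $\sigma$ of automorphisms of a $C^*$-algebra $A$, a state $\varphi$ of $A$ is a $\sigma$-ground state iff for every smooth compactly supported function $F$ on $\mathbb{R}$ with support in $(-\infty,0)$ one has $\varphi(\sigma_{\check F}(a)^*\sigma_{\check F}(a))=0$ for all $a\in A$, where $\check F(x)=\frac1{2\pi}\int_{\mathbb{R}}F(y)e^{-ixy}\,dy$ and $\sigma_{\check F}(a)=\int_{\mathbb{R}}\check F(t)\sigma_t(a)\,dt$. *)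

(* Defs.v *)
From HB Require Import structures.
From mathcomp Require Import all_boot all_order all_algebra.
From mathcomp Require Import complex.
From mathcomp Require Import all_classical all_reals all_analysis.
Import numFieldNormedType.Exports.
Import Order.TTheory GRing.Theory Num.Theory.

Set Implicit Arguments.
Unset Strict Implicit.
Unset Printing Implicit Defensive.

Local Open Scope classical_set_scope.
Local Open Scope ring_scope.

(* Complex-valued functions take values in [R[i]^o], the copy of [R[i]] that
   carries the norm topology and the structure of a module over [R[i]]. *)
Notation Cplx R := ((complex (R : realType))^o).

(* The objects are identified with the identity arrows, so [T] is the set of
   arrows and the unit space is a subset of [T].  The product [gmul g h] is
   meaningful only when [gsrc g = grng h]. *)
Record groupoid (T : Type) := Groupoid {
  grng : T -> T;
  gsrc : T -> T;
  gmul : T -> T -> T;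
  ginv : T -> T;
  grng_rng : forall g, grng (grng g) = grng g;
  gsrc_rng : forall g, gsrc (grng g) = grng g;
  grng_src : forall g, grng (gsrc g) = gsrc g;
  gsrc_src : forall g, gsrc (gsrc g) = gsrc g;
  grng_mul : forall g h, gsrc g = grng h -> grng (gmul g h) = grng g;
  gsrc_mul : forall g h, gsrc g = grng h -> gsrc (gmul g h) = gsrc h;
  gmulA : forall g h k, gsrc g = grng h -> gsrc h = grng k ->
    gmul g (gmul h k) = gmul (gmul g h) k;
  gmul1g : forall g, gmul (grng g) g = g;
  gmulg1 : forall g, gmul g (gsrc g) = g;
  grng_inv : forall g, grng (ginv g) = gsrc g;
  gsrc_inv : forall g, gsrc (ginv g) = grng g;
  gmulgV : forall g, gmul g (ginv g) = grng g;
  gmulVg : forall g, gmul (ginv g) g = gsrc g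
}.

Section GroupoidBasics.
Context {T : Type} (G : groupoid T).

Definition gunits : set T := [set x | grng G x = x].
Definition range_fiber (x : T) : set T := [set g | grng G g = x].
Definition composable : set (T * T) := [set p | gsrc G p.1 = grng G p.2].

Definition rng_unit (g : T) : gunits :=
  exist _ (grng G g) (mem_set (grng_rng G g)).
Definition src_unit (g : T) : gunits :=
  exist _ (gsrc G g) (mem_set (grng_src G g)).

Definition cocycle (R : realType) (c : T -> R) :=
  forall g h, gsrc G g = grng G h -> c (gmul G g h) = c g + c h.

Definition boundary_set (R : realType) (c : T -> R) : set T :=
  [set x | gunits x /\ forall g, range_fiber x g -> c g <= 0].

End GroupoidBasics.

Definition reduction_set (T : Type) (G : groupoid T) (Z : set T) : set T :=
  [set g | Z (grng G g) /\ Z (gsrc G g)].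

Section Reduction.
Context {T : choiceType} (G : groupoid T) (Z : set T).
Local Notation GZ := (set_type (reduction_set G Z)).

Definition red_rng (g : GZ) : GZ := insubd g (grng G (val g)).
Definition red_src (g : GZ) : GZ := insubd g (gsrc G (val g)).
Definition red_mul (g h : GZ) : GZ := insubd g (gmul G (val g) (val h)).
Definition red_inv (g : GZ) : GZ := insubd g (ginv G (val g)).

Lemma redP (g : GZ) : Z (grng G (val g)) /\ Z (gsrc G (val g)).
Proof. by have := valP g; rewrite inE. Qed.

Lemma val_red_rng g : val (red_rng g) = grng G (val g).
Proof.
apply: insubdK; rewrite -topredE /=; apply/mem_set.
by have [? ?] := redP g; split; rewrite ?grng_rng ?gsrc_rng.
Qed.

Lemma val_red_src g : val (red_src g) = gsrc G (val g).
Proof.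
apply: insubdK; rewrite -topredE /=; apply/mem_set.
by have [? ?] := redP g; split; rewrite ?grng_src ?gsrc_src.
Qed.

Lemma val_red_inv g : val (red_inv g) = ginv G (val g).
Proof.
apply: insubdK; rewrite -topredE /=; apply/mem_set.
by have [? ?] := redP g; split; rewrite ?grng_inv ?gsrc_inv.
Qed.

Lemma red_composable (g h : GZ) :
  red_src g = red_rng h -> gsrc G (val g) = grng G (val h).
Proof. by move=> /(congr1 val); rewrite val_red_src val_red_rng. Qed.

Lemma val_red_mul (g h : GZ) : red_src g = red_rng h ->
  val (red_mul g h) = gmul G (val g) (val h).
Proof.
move=> /red_composable gh; apply: insubdK; rewrite -topredE /=; apply/mem_set.
have [? ?] := redP g; have [? ?] := redP h.
by split; rewrite ?grng_mul ?gsrc_mul.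
Qed.

Definition red_val := (val_red_rng, val_red_src, val_red_inv).

Fact red_rng_rng g : red_rng (red_rng g) = red_rng g.
Proof. by apply: val_inj; rewrite !red_val grng_rng. Qed.

Fact red_src_rng g : red_src (red_rng g) = red_rng g.
Proof. by apply: val_inj; rewrite !red_val gsrc_rng. Qed.

Fact red_rng_src g : red_rng (red_src g) = red_src g.
Proof. by apply: val_inj; rewrite !red_val grng_src. Qed.

Fact red_src_src g : red_src (red_src g) = red_src g.
Proof. by apply: val_inj; rewrite !red_val gsrc_src. Qed.

Fact red_rng_inv g : red_rng (red_inv g) = red_src g.
Proof. by apply: val_inj; rewrite !red_val grng_inv. Qed.

Fact red_src_inv g : red_src (red_inv g) = red_rng g.
Proof. by apply: val_inj; rewrite !red_val gsrc_inv. Qed.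

Fact red_rng_mul g h : red_src g = red_rng h ->
  red_rng (red_mul g h) = red_rng g.
Proof.
move=> gh; apply: val_inj; rewrite !red_val val_red_mul // grng_mul //.
exact: red_composable.
Qed.

Fact red_src_mul g h : red_src g = red_rng h ->
  red_src (red_mul g h) = red_src h.
Proof.
move=> gh; apply: val_inj; rewrite !red_val val_red_mul // gsrc_mul //.
exact: red_composable.
Qed.

Fact red_mulA g h k : red_src g = red_rng h -> red_src h = red_rng k ->
  red_mul g (red_mul h k) = red_mul (red_mul g h) k.
Proof.
move=> gh hk; apply: val_inj.
have gh' := red_composable gh; have hk' := red_composable hk.
by rewrite !val_red_mul ?red_rng_mul ?red_src_mul // gmulA.
Qed.

Fact red_mul1g g : red_mul (red_rng g) g = g.
Proof.
by apply: val_inj; rewrite val_red_mul ?red_src_rng // red_val gmul1g.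
Qed.

Fact red_mulg1 g : red_mul g (red_src g) = g.
Proof.
by apply: val_inj; rewrite val_red_mul ?red_rng_src // red_val gmulg1.
Qed.

Fact red_mulgV g : red_mul g (red_inv g) = red_rng g.
Proof.
by apply: val_inj; rewrite val_red_mul ?red_rng_inv // !red_val gmulgV.
Qed.

Fact red_mulVg g : red_mul (red_inv g) g = red_src g.
Proof.
by apply: val_inj; rewrite val_red_mul ?red_src_inv // !red_val gmulVg.
Qed.

Definition reduction : groupoid GZ :=
  Groupoid red_rng_rng red_src_rng red_rng_src red_src_src red_rng_mul
    red_src_mul red_mulA red_mul1g red_mulg1 red_rng_inv red_src_inv
    red_mulgV red_mulVg.

End Reduction.

Definition local_homeomorphism (X Y : topologicalType) (f : X -> Y) :=
  forall x, exists U : set X, [/\ open_nbhs x U,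
    {within U, continuous f}, {in U &, injective f} &
    forall V, open V -> V `<=` U -> open (f @` V)].

Section EtaleGroupoid.
Context {T : topologicalType} (G : groupoid T).

Definition topological_groupoid :=
  continuous (ginv G) /\
  {within composable G, continuous (fun p : T * T => gmul G p.1 p.2)}.

Definition etale :=
  local_homeomorphism (rng_unit G) /\ local_homeomorphism (src_unit G).

End EtaleGroupoid.

Section ConvolutionAlgebra.
Context {R : realType} {T : topologicalType} (G : groupoid T).
Implicit Types f : T -> Cplx R.

Definition Cc : set (T -> Cplx R) :=
  [set f | continuous f /\ compact (closure [set g | f g != 0])].

(* [\sum_(h \in A) F h] is a finitely supported sum; for [G] étale and
   [f1], [f2] in [Cc] only finitely many terms are nonzero. *)
Definition convolution f1 f2 : T -> Cplx R :=
  fun g => \sum_(h \in range_fiber G (grng G g)) (f1 h * f2 (gmul G (ginv G h) g)).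

Definition involution f : T -> Cplx R := fun g => (f (ginv G g) : R[i])^*.

End ConvolutionAlgebra.

(* As with every normed module over [R[i]], the norm takes values in [R[i]];
   [0 <= z] in [R[i]] means that [z] is real and nonnegative. *)
Record cstarAlgebra (R : realType) := CstarAlgebra {
  cstar_sort :> completeNormedModType R[i];
  cmul : cstar_sort -> cstar_sort -> cstar_sort;
  cstar : cstar_sort -> cstar_sort;
  cmulA : associative cmul;
  cmulDl : left_distributive cmul +%R;
  cmulDr : right_distributive cmul +%R;
  cmulZl : forall (k : R[i]) x y, cmul (k *: x) y = k *: cmul x y;
  cmulZr : forall (k : R[i]) x y, cmul x (k *: y) = k *: cmul x y;
  cstarK : involutive cstar;
  cstarD : {morph cstar : x y / x + y};
  cstarZ : forall (k : R[i]) x, cstar (k *: x) = k^* *: cstar x;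
  cstarM : forall x y, cstar (cmul x y) = cmul (cstar y) (cstar x);
  cnormM : forall x y, `|cmul x y| <= `|x| * `|y|;
  cnorm_star : forall x, `|cmul (cstar x) x| = `|x| ^+ 2
}.

Section EnvelopingAlgebra.
Context {R : realType} {T : topologicalType} (G : groupoid T).
Local Notation Cc := (@Cc R T).

Definition cstar_seminorm (p : (T -> Cplx R) -> R[i]) :=
  [/\ forall f, Cc f -> 0 <= p f,
      forall f1 f2, Cc f1 -> Cc f2 -> p (f1 \+ f2) <= p f1 + p f2,
      forall (k : R[i]) f, Cc f -> p (fun g => k *: f g) = `|k| * p f,
      forall f1 f2, Cc f1 -> Cc f2 -> p (convolution G f1 f2) <= p f1 * p f2 &
      forall f, Cc f -> p (convolution G (involution G f) f) = p f ^+ 2].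

(* [(A, iota)] is the completion of [C_c(G)] in its largest C*-seminorm.  The
   values of [iota] outside [Cc] are irrelevant.  Since [f |-> `|iota f|] is
   itself a C*-seminorm, the last clause makes it the largest one. *)
Definition is_groupoid_cstar (A : cstarAlgebra R) (iota : (T -> Cplx R) -> A) :=
  [/\ forall (k : R[i]) f1 f2, Cc f1 -> Cc f2 ->
        iota (fun g => k *: f1 g + f2 g) = k *: iota f1 + iota f2,
      forall f1 f2, Cc f1 -> Cc f2 ->
        iota (convolution G f1 f2) = cmul (iota f1) (iota f2),
      forall f, Cc f -> iota (involution G f) = cstar (iota f),
      dense (iota @` Cc) &
      forall p, cstar_seminorm p -> forall f, Cc f -> p f <= `|iota f|].

End EnvelopingAlgebra.

Section States.
Context {R : realType} (A : cstarAlgebra R).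

Definition state : set (A -> Cplx R) :=
  [set phi | [/\ linear phi,
      forall a, (0 : R[i]) <= phi (cmul (cstar a) a),
      forall a, `|phi a| <= `|a| :> R[i] &
      forall e : R, 0 < e ->
        exists a, `|a| <= 1 /\ (1 - e)%:C%C < `|phi a| :> R[i]]].

Definition cstar_automorphism (alpha : A -> A) :=
  [/\ linear alpha, {morph alpha : a b / cmul a b},
      {morph alpha : a / cstar a} & bijective alpha].

Definition one_parameter_group (sigma : R -> A -> A) :=
  [/\ forall t, cstar_automorphism (sigma t),
      forall a, sigma 0 a = a,
      forall t u a, sigma (t + u) a = sigma t (sigma u a) &
      forall a, continuous (sigma ^~ a)].

End States.

Section GroundStates.
Context {R : realType}.

Definition expi (t : R) : R[i] := (cos t +i* sin t)%C.

Definition cintegrable (f : R -> R[i]) :=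
  (@lebesgue_measure R).-integrable setT (fun t => (complex.Re (f t))%:E) /\
  (@lebesgue_measure R).-integrable setT (fun t => (complex.Im (f t))%:E).

Definition cintegral (f : R -> R[i]) : R[i] :=
  ((\int[@lebesgue_measure R]_t complex.Re (f t)) +i*
   (\int[@lebesgue_measure R]_t complex.Im (f t)))%C.

Definition smooth (f : R -> R) := forall n x, derivable (derive1n n f) x 1.

Definition test_function (F : R -> R[i]) :=
  [/\ smooth (fun y => complex.Re (F y)), smooth (fun y => complex.Im (F y)) &
      compact (closure [set y | F y != 0])].

Definition inv_fourier (F : R -> R[i]) (x : R) : R[i] :=
  ((2 * pi)^-1)%:C%C * cintegral (fun y => F y * expi (- (x * y))).

Context (A : cstarAlgebra R).

(* The Pettis integral over the real line; [b] is unique by Hahn-Banach. *)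
Definition is_vintegral (f : R -> A) (b : A) :=
  forall l : A -> Cplx R, linear l -> continuous l ->
    cintegrable (fun t => l (f t)) /\ l b = cintegral (fun t => l (f t)).

Definition vintegral (f : R -> A) : A := xget 0 [set b | is_vintegral f b].

Definition smear (sigma : R -> A -> A) (h : R -> R[i]) (a : A) : A :=
  vintegral (fun t => h t *: sigma t a).

Definition ground_state (sigma : R -> A -> A) : set (A -> Cplx R) :=
  [set phi | state phi /\
    forall F : R -> R[i], test_function F ->
      closure [set y | F y != 0] `<=` [set y | y < 0] ->
      forall a, let b := smear sigma (inv_fourier F) a in
        phi (cmul (cstar b) b) = 0].

End GroundStates.

Definition is_cocycle_dynamics (R : realType) (T : topologicalType)
    (c : T -> R) (A : cstarAlgebra R) (iota : (T -> Cplx R) -> A)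
    (sigma : R -> A -> A) :=
  one_parameter_group sigma /\
  forall t f, Cc f -> sigma t (iota f) = iota (fun g => expi (t * c g) *: f g).

Definition affine_on (R : realType) (A B : cstarAlgebra R)
    (S : set (B -> Cplx R)) (Phi : (B -> Cplx R) -> (A -> Cplx R)) :=
  forall (t : R) psi1 psi2, 0 <= t <= 1 -> S psi1 -> S psi2 ->
    Phi (fun b => t%:C%C *: psi1 b + (1 - t)%:C%C *: psi2 b) =
    (fun a => t%:C%C *: Phi psi1 a + (1 - t)%:C%C *: Phi psi2 a).

(* Main.v *)
(** A state on [A] or [B] restricts to a positive functional on compactly
    supported functions, and the GNS construction shows conversely that every
    positive functional on these functions, bounded by one on unit bumps, is
    dominated by the largest C*-seminorm and extends to the algebra.

    For a test function [F] the smeared element of [f] in C_c(G) is [(W o c) f],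
    where [W] is the Fourier inversion of [F]: zero off the support of [F], and
    nonzero at a prescribed point for a suitable [F].  If [phi] is a ground state
    and [x] is a unit outside [Z], some arrow [g] starting at [x] has [c g < 0];
    functions supported near [g] lie in the left kernel of [phi], and so do all
    functions whose arrows start near [x].  Taking adjoints and cutting with a
    soft threshold, [phi] vanishes on every function that vanishes on [G_Z].
    Conversely such a [phi] is a ground state, since [c >= 0] on arrows starting
    in [Z]; the passage from C_c(G) to [A] uses that *-automorphisms are
    bounded.

    So the ground states are the states that factor through restriction to
    [G_Z].  That [psi] composed with restriction is positive although
    restriction is not multiplicative is where [G_Z] étale is used: on [G_Z],
    [f^* f] is a finite sum of [h^* h] with [h] in C_c(G_Z). *)

Require Import Defs.
From HB Require Import structures.
From mathcomp Require Import all_boot all_order all_algebra.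
From mathcomp Require Import complex.
From mathcomp Require Import all_classical all_reals all_analysis.
From mathcomp Require Import ring lra measurable_realfun.
Import numFieldNormedType.Exports.
Import Order.TTheory GRing.Theory Num.Theory.

Set Implicit Arguments.
Unset Strict Implicit.
Unset Printing Implicit Defensive.

Local Open Scope classical_set_scope.
Local Open Scope ring_scope.

(** Most estimates rest on one computation: if [f] is supported in a bisection, [f^* f] is a
    function on the unit space, where norms are compared with suprema; partitions of unity reduce
    the general case to this one. As C_c(G) has in general no unit, bumps on the unit space take its
    place, also in keeping track of the norm of a state. Restriction to G_Z fails to be
    multiplicative because products over [G] pass through arrows with exactly one end in [Z].
    Étaleness of G_Z gives an open set around G_Z that contains no such arrow; extending functions
    into this set, or multiplying them by bumps on small bisections, avoids the defect. The identity
    W = F is not established: the two facts about [W] are read off from Fejér means, one from the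
    decay of the kernel away from 0, the other from its mass near 0. The vector integral that
    defines the smeared element is computed only on elements [iota f]. For other elements it is
    compared with those under one fixed functional; the comparison has to be uniform in [t], hence
    the bound on automorphisms. *)

(** * Bumps and extensions on locally compact Hausdorff spaces *)

Section LocallyCompact.
Context {T : topologicalType}.
Hypotheses (hT : hausdorff_space T) (lcT : locally_compact [set: T]).
Local Notation opc := (one_point_compactification T).

Lemma opc_normal : normal_space opc.
Proof.
apply: compact_normal; last exact: one_point_compactification_compact.
exact: one_point_compactification_hausdorff.
Qed.

Lemma compact_opc_closed (K : set T) :
  compact K -> closed ((Some : T -> opc) @` K).
Proof.
move=> cK; apply: compact_closed.
  exact: one_point_compactification_hausdorff.
apply: continuous_compact => //; apply: continuous_subspaceT.
exact: one_point_compactification_some_continuous.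
Qed.

Lemma open_preimage_some (V : set opc) :
  open V -> open ((Some : T -> opc) @^-1` V).
Proof.
exact: (continuousP _).1 one_point_compactification_some_continuous V.
Qed.

(** In the one-point compactification [K] and the complement of [U] are disjoint closed sets.
    Separating them puts an open set around the point at infinity that misses [V], which forces the
    closure of [V] to be compact. *)
Lemma compact_nbhs_between (R : realType) (K U : set T) :
  compact K -> open U -> K `<=` U ->
  exists V, [/\ open V, K `<=` V, closure V `<=` U & compact (closure V)].
Proof.
move=> cK oU KU.
have [|||V [W [oV oW KV UW VW0]]] :=
  (@normal_openP R opc).1 opc_normal (Some @` K) (~` (Some @` U)).
- exact: compact_opc_closed.
- exact/open_closedC/one_point_compactification_open_some.
- rewrite -subset0 => x [[y Ky <-]]; apply; exists y => //; exact: KU.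
have WN : W None by apply: UW; case=> ? _.
have := open_nbhs_nbhs (conj oW WN); rewrite /nbhs/= => -[C [cC clC] CW].
have VC : Some @^-1` V `<=` C.
  move=> x Vx; apply: contrapT => nCx.
  have : (V `&` W) (Some x) by split => //; apply: CW; left; exists x.
  by rewrite VW0.
have cV : closure (Some @^-1` V) `<=` C.
  by rewrite (closure_id C).1//; exact: closureS.
exists (Some @^-1` V); split.
- exact: open_preimage_some.
- by move=> x Kx; apply: KV; exists x.
- have h : closure (Some @^-1` V) `<=` closure (~` (Some @^-1` W)).
    apply: closureS => x Vx Wx; have : (V `&` W) (Some x) by [].
    by rewrite VW0.
  move: h; rewrite -((closure_id _).1 (open_closedC (open_preimage_some oW))).
  move=> h x /h nW; apply: contrapT => nUx; apply: nW; apply: UW.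
  by move=> [y Uy [yx]]; apply: nUx; rewrite -yx.
- by apply: subclosed_compact cC cV; exact: closed_closure.
Qed.

(** Urysohn's lemma is applied between two nested neighbourhoods of [K] instead of to [K] and [U]:
    so [e] equals 1 on an open set around [K], and its closed support is compact and inside [U]. *)
Lemma bump_exists (R : realType) (K U : set T) :
  compact K -> open U -> K `<=` U ->
  exists e : T -> R, [/\ continuous e, forall x, 0 <= e x <= 1,
    exists V, [/\ open V, K `<=` V & forall x, V x -> e x = 1],
    closure [set x | e x != 0] `<=` U & compact (closure [set x | e x != 0])].
Proof.
move=> cK oU KU.
have [V [oV KV VU cV]] := compact_nbhs_between R cK oU KU.
have [W [oW VW WU cW]] := compact_nbhs_between R cV oU VU.
have [||||e [ce e0 e1 e01]] := @urysohn_ext_itv opc R opc_normal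
  (~` (Some @` W)) (Some @` closure V) 0 1.
- exact/open_closedC/one_point_compactification_open_some.
- exact: compact_opc_closed.
- by rewrite -subset0 => x [nW [y Vy yx]]; apply: nW; exists y => //; exact: VW.
- exact: ltr01.
have eW : closure [set x | (e \o Some) x != 0] `<=` closure W.
  apply: closureS => x /= ex; apply: contrapT => nW; move/eqP: ex; apply.
  by apply: e0; exists (Some x) => // -[y Wy [yx]]; apply: nW; rewrite -yx.
exists (e \o Some); split.
- move=> x; apply: continuous_comp; last exact: ce.
  exact: one_point_compactification_some_continuous.
- move=> x; have : (e \o Some) x \in `[0, 1] by apply: e01; exists (Some x).
  by rewrite in_itv.
- exists V; split => // x Vx; apply: e1; exists (Some x) => //; exists x => //.
  exact: subset_closure.
- exact: (subset_trans eW).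
- by apply: subclosed_compact cW eW; exact: closed_closure.
Qed.

(** Since [f] vanishes on [A] off the compact set [K], it extends continuously by 0 to the point at
    infinity; the bounded Tietze theorem then applies on the compactification. *)
Lemma tietze_compact_support (R : realType) (A K : set T) (f : T -> R) :
  closed A -> compact K -> {within A, continuous f} ->
  (forall x, A x -> ~ K x -> f x = 0) ->
  exists g : T -> R, continuous g /\ forall x, A x -> g x = f x.
Proof.
move=> clA cK cf f0.
pose F (x : opc) : R := if x is Some y then f y else 0.
pose A' : set opc := (Some @` A) `|` [set None].
have clA' : closed A'.
  rewrite -[A']setCK; apply: open_closedC.
  rewrite (_ : ~` A' = Some @` (~` A)).
    exact/one_point_compactification_open_some/closed_openC.
  apply/seteqP; split => [[x|]|_ [x nAx <-]].
  - by move=> nA'; exists x => // Ax; apply: nA'; left; exists x.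
  - by case; right.
  - by case=> // -[y Ay [yx]]; apply: nAx; rewrite -yx.
have cF : {within A', continuous F}.
  apply/subspace_continuousP => -[x|] A'x U.
    move=> /= Ux; have Ax : A x by case: A'x => // -[y Ay [<-]].
    have := (subspace_continuousP _ _).1 cf x Ax U Ux.
    rewrite /within /nbhs/= => h; rewrite /nbhs/=.
    apply: filterS h => y h /= [[z Az [zy]]|//]; apply: h; by rewrite -zy.
  move=> /nbhs_singleton U0; rewrite /within /nbhs/=.
  exists K; first by split => //; exact: compact_closed.
  move=> z [[y nKy <-] [[x Ax [xy]]|//]|-> _]; last exact: U0.
  have fy0 : F (Some y) = 0 by rewrite /F/= -xy f0 // xy.
  by rewrite -[U _]/(U (F (Some y))) fy0.
have [M [M0 FM]] : exists M, 0 < M /\ forall x, A' x -> `|F x| <= M.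
  have cKA : compact (K `&` A) by exact: compact_closedI.
  have : compact (f @` (K `&` A)).
    apply: continuous_compact => //; apply: continuous_subspaceW cf.
    exact: subIsetr.
  move=> /compact_bounded[M [_ MP]]; exists (`|M| + 1); split.
    by rewrite ltr_wpDl.
  have M1 : M < `|M| + 1 by rewrite (le_lt_trans (ler_norm M)) // ltrDl.
  move=> _ [[x Ax <-]|->] /=; last by rewrite normr0 addr_ge0.
  have [Kx|nKx] := pselect (K x); first by apply: (MP _ M1); exists x.
  by rewrite f0 // normr0 addr_ge0.
have [g [gF cg _]] := continuous_bounded_extension opc_normal clA' M0 cF FM.
exists (g \o Some); split => [x|x Ax].
  apply: continuous_comp; last exact: cg.
  exact: one_point_compactification_some_continuous.
by rewrite /= -gF// inE; left; exists x.
Qed.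

End LocallyCompact.

(** The index type carries no structure, so that covers may be indexed by subtypes such as that of
    all bisections. The filter [F], generated by comparing lists through the unions they cover,
    takes the place of finite subsets of [J]. *)
Lemma compact_finite_cover (X : topologicalType) (J : Type) (U : J -> set X)
    (K : set X) : compact K -> (forall x, K x -> exists j, nbhs x (U j)) ->
  exists s : seq J, K `<=` \big[setU/set0]_(j <- s) U j.
Proof.
move=> /compact_near_coveringP cK KU.
pose V (s : seq J) := \big[setU/set0]_(j <- s) U j.
pose F := [set S : set (seq J) | exists s0, forall s, V s0 `<=` V s -> S s].
have FF : Filter F.
  split; first by exists [::].
    move=> P Q [s sP] [t tQ]; exists (s ++ t) => r; rewrite /V big_cat /= => h.
    by split; [apply: sP | apply: tQ] => x hx; apply: h; [left | right].
  by move=> P Q PQ [s sP]; exists s => t /sP /PQ.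
have := cK (seq J) F (fun s x => V s x) FF.
case=> [x /KU[j Uj]|s /(_ s)]; last by move=> h; exists s; exact: h.
exists (U j, [set s | U j `<=` V s]) => /=; last by case=> y s /= [Uy]; exact.
split => //; exists [:: j] => s; rewrite /V big_seq1; exact.
Qed.

(** * Real-valued norms over the complex numbers *)

Section ComplexNorm.
Context {R : realType}.
Implicit Types V : normedModType R[i].

(** The norm of a module over [R[i]] lies in [R[i]]; its real part moves estimates to the ordered
    field [R], where [lra] and [nra] apply. *)
Definition nrm {V} (a : V) : R := complex.Re `|a|.

Lemma normE V (a : V) : `|a| = (nrm a)%:C%C.
Proof. by rewrite /nrm RRe_real// ger0_real. Qed.

Lemma nrm_ge0 V (a : V) : 0 <= nrm a.
Proof. by rewrite -lecR -normE normr_ge0. Qed.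

Lemma nrm0 V : nrm (0 : V) = 0.
Proof. by rewrite /nrm normr0. Qed.

Lemma nrm_eq0 V (a : V) : nrm a = 0 -> a = 0.
Proof. by move=> a0; apply/eqP; rewrite -normr_eq0 normE a0. Qed.

Lemma nrmN V (a : V) : nrm (- a) = nrm a.
Proof. by rewrite /nrm normrN. Qed.

Lemma nrmB V (a b : V) : nrm (a - b) = nrm (b - a).
Proof. by rewrite -nrmN opprB. Qed.

Lemma nrmD V (a b : V) : nrm (a + b) <= nrm a + nrm b.
Proof. by rewrite -lecR rmorphD/= -!normE ler_normD. Qed.

Lemma nrmZ V (k : R[i]) (a : V) : nrm (k *: a) = nrm (k : Cplx R) * nrm a.
Proof. by apply: complexI; rewrite rmorphM/= -!normE normrZ. Qed.

Lemma nrmM (z w : Cplx R) : nrm (z * w) = nrm z * nrm w.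
Proof. exact: nrmZ. Qed.

Lemma nrm_real (r : R) : nrm (r%:C%C : Cplx R) = `|r|.
Proof. by rewrite /nrm normc_def/= expr0n addr0 sqrtr_sqr. Qed.

Lemma nrm_conj (z : R[i]) : nrm (z^*%C : Cplx R) = nrm (z : Cplx R).
Proof. by rewrite /nrm normcJ. Qed.

(** [z^*] is the conjugation of the numerical field structure, [z^*%C] that of [complex], which
    computes on real and imaginary parts. *)
Lemma conjE (z : R[i]) : z^* = z^*%C.
Proof.
case: z => a b; rewrite [X in X^*]complexE/= rmorphD rmorphM/=.
rewrite complexiE conjCi !conj_Creal//; last 2 first.
  by apply/complex_realP; exists b.
  by apply/complex_realP; exists a.
by rewrite -complexiE; apply/eqP; rewrite eq_complex/=; apply/andP; split; apply/eqP; ring.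
Qed.

Lemma Re_nrm (z : Cplx R) : `|complex.Re z| <= nrm z.
Proof. by rewrite -lecR -normE; exact: normc_ge_Re. Qed.

Lemma Im_nrm (z : Cplx R) : `|complex.Im z| <= nrm z.
Proof.
rewrite /nrm normc_def/= -[X in X <= _]sqrtr_sqr ler_wsqrtr//.
by rewrite lerDr sqr_ge0.
Qed.

Lemma nrm_ReIm (z : Cplx R) : nrm z <= `|complex.Re z| + `|complex.Im z|.
Proof.
have {1}-> : z = (complex.Re z)%:C%C + 'i%C * (complex.Im z)%:C%C.
  exact: complexE.
apply: le_trans (nrmD _ _) _; rewrite nrmM !nrm_real; apply: lerD => //.
by rewrite /nrm normc_def/= expr0n expr1n/= add0r sqrtr1 mul1r.
Qed.

Lemma nrm_sqr (z : Cplx R) : nrm z ^+ 2 = complex.Re z ^+ 2 + complex.Im z ^+ 2.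
Proof. by rewrite /nrm normc_def/= sqr_sqrtr// addr_ge0// sqr_ge0. Qed.

Lemma conj_mul_nrm (z : R[i]) : z^*%C * z = ((nrm (z : Cplx R))^+2)%:C%C.
Proof.
case: z => a b; rewrite nrm_sqr/=; apply/eqP; rewrite eq_complex/=.
by apply/andP; split; apply/eqP; ring.
Qed.

Lemma Re_ge0 (z : R[i]) : 0 <= z -> 0 <= complex.Re z.
Proof. by rewrite lecE => /andP[]. Qed.

Lemma Re_geE (z : R[i]) : 0 <= z -> z = (complex.Re z)%:C%C.
Proof.
case: z => a b; rewrite lecE/= => /andP[/eqP b0 _].
by apply/eqP; rewrite eq_complex/= b0 !eqxx.
Qed.

Lemma cvg_nrm (I : Type) (F : set_system I) (FF : Filter F) V (f : I -> V) (l : V) :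
  f @ F --> l <-> forall e : R, 0 < e -> \forall x \near F, nrm (l - f x) < e.
Proof.
split => [/cvgrPdist_lt h e e0|h].
  have e0' : 0 < e%:C%C by rewrite ltcR.
  by have := h _ e0'; apply: filterS => x; rewrite normE ltcR.
apply/cvgrPdist_lt => e e0; have eE : e = (complex.Re e)%:C%C by exact/Re_geE/ltW.
have e0' : 0 < complex.Re e by rewrite -ltcR -eE.
by have := h _ e0'; apply: filterS => x; rewrite normE eE ltcR.
Qed.

Lemma continuous_nrmP (X : topologicalType) V (f : X -> V) (x : X) :
  {for x, continuous f} <->
  forall e : R, 0 < e -> \forall y \near x, nrm (f x - f y) < e.
Proof. exact: cvg_nrm. Qed.

Lemma continuous_ReIm_at (X : topologicalType) (f : X -> Cplx R) (x : X) :
  {for x, continuous f} <-> {for x, continuous (fun y => complex.Re (f y))} /\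
    {for x, continuous (fun y => complex.Im (f y))}.
Proof.
split=> [/continuous_nrmP h|[/cvgrPdist_lt h1 /cvgrPdist_lt h2]].
  split; apply/cvgrPdist_lt => e e0; have := h _ e0; apply: filterS => y.
    by apply: le_lt_trans; have := Re_nrm (f x - f y); rewrite raddfB.
  by apply: le_lt_trans; have := Im_nrm (f x - f y); rewrite raddfB.
apply/continuous_nrmP => e e0; have e20 : 0 < e / 2 by rewrite divr_gt0.
have := h1 _ e20; have := h2 _ e20; apply: filterS2 => y /= i2 i1.
apply: le_lt_trans (nrm_ReIm _) _; rewrite !raddfB/= [e]splitr.
exact: ltrD.
Qed.

Lemma continuous_ReIm (X : topologicalType) (f : X -> Cplx R) :
  continuous f <-> continuous (fun y => complex.Re (f y)) /\ continuous (fun y => complex.Im (f y)).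
Proof.
split=> [h|[h1 h2] x].
  by split=> x; have [? ?] := (continuous_ReIm_at f x).1 (h x).
by apply/continuous_ReIm_at; split; [exact: h1 | exact: h2].
Qed.

Lemma continuous_conj (X : topologicalType) (f : X -> Cplx R) (x : X) :
  {for x, continuous f} -> {for x, continuous (fun x => (f x : R[i])^*%C : Cplx R)}.
Proof.
move=> /continuous_nrmP h; apply/continuous_nrmP => e /h; apply: filterS => y.
by rewrite -nrm_conj rmorphB.
Qed.

Lemma continuous_nrm (X : topologicalType) V (f : X -> V) (x : X) :
  {for x, continuous f} -> {for x, continuous (nrm \o f)}.
Proof.
move=> /continuous_nrmP h; apply/cvgrPdist_lt => e /h; apply: filterS => y.
apply: le_lt_trans => /=; rewrite ler_norml lerBrDl lerBlDl addrC addrC.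
have := nrmD (f x - f y) (f y); have := nrmD (f y - f x) (f x).
by rewrite !subrK nrmB; lra.
Qed.

Lemma continuous_real_complex (X : topologicalType) (f : X -> R) (x : X) :
  {for x, continuous f} -> {for x, continuous (fun x => (f x)%:C%C : Cplx R)}.
Proof.
move=> /cvgrPdist_lt h; apply/continuous_nrmP => e /h; apply: filterS => y.
by rewrite -raddfB nrm_real.
Qed.

Lemma continuous_mulc (X : topologicalType) (f g : X -> Cplx R) (x : X) :
  {for x, continuous f} -> {for x, continuous g} ->
  {for x, continuous (fun x => f x * g x : Cplx R)}.
Proof. exact: cvgM. Qed.

End ComplexNorm.

(** * Groupoid identities *)

Section GroupoidAlgebra.
Context {T : Type} (G : groupoid T).
Local Notation r := (grng G).
Local Notation s := (gsrc G).
Local Notation "g ∘ h" := (gmul G g h) (at level 40, left associativity).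
Local Notation inv := (ginv G).

Lemma gmulVK h g : s h = r g -> inv h ∘ (h ∘ g) = g.
Proof. by move=> hg; rewrite gmulA ?gsrc_inv// gmulVg hg gmul1g. Qed.

Lemma gmulKV h g : r h = r g -> h ∘ (inv h ∘ g) = g.
Proof.
by move=> hg; rewrite gmulA ?grng_inv ?gsrc_inv// gmulgV hg gmul1g.
Qed.

Lemma ginvK g : inv (inv g) = g.
Proof.
have := @gmulVK (inv g) g; rewrite gsrc_inv => /(_ erefl).
rewrite gmulVg => E; rewrite -[RHS]E; have := gmulg1 G (inv (inv g)).
by rewrite gsrc_inv grng_inv => ->.
Qed.

Lemma ginv_inj g h : inv g = inv h -> g = h.
Proof. by move=> gh; rewrite -(ginvK g) gh ginvK. Qed.

Lemma gmul_rcancel g h k : s g = s h -> s g = r k -> g ∘ k = h ∘ k -> g = h.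
Proof.
move=> gh gk /(congr1 (fun x => x ∘ inv k)).
have hk : s h = r k by rewrite -gh.
by rewrite -!gmulA ?grng_inv// gmulgV -{1}gk gmulg1 -hk gmulg1.
Qed.

Lemma ginvM g h : s g = r h -> inv (g ∘ h) = inv h ∘ inv g.
Proof.
move=> gh; apply: (@gmul_rcancel _ _ (g ∘ h)).
- by rewrite !gsrc_inv gsrc_mul ?gsrc_inv ?grng_inv// grng_mul ?gsrc_inv.
- by rewrite gsrc_inv.
rewrite gmulVg gsrc_mul// -gmulA ?gsrc_inv ?grng_inv ?grng_mul//.
by rewrite gmulVK// gmulVg.
Qed.

Lemma unit_src x : gunits G x -> s x = x.
Proof. by move=> /= x1; rewrite -{1}x1 gsrc_rng. Qed.

Lemma unit_inv x : gunits G x -> inv x = x.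
Proof.
by move=> /= x1; rewrite -[LHS](gmulg1 G) gsrc_inv x1 gmulVg unit_src.
Qed.

Lemma units_rng g : gunits G (r g). Proof. exact: grng_rng. Qed.
Lemma units_src g : gunits G (s g). Proof. exact: grng_src. Qed.

End GroupoidAlgebra.

(** Bundled so that the same lemmas serve [G] and, through [reduction_lch_etale], its reduction. *)
Record lch_etale (T : topologicalType) (G : groupoid T) : Prop := LchEtale {
  lch_hausdorff : hausdorff_space T;
  lch_locally_compact : locally_compact [set: T];
  lch_topological : topological_groupoid G;
  lch_is_etale : etale G }.

(** * Topology of étale groupoids *)

Section EtaleTopology.
Context {T : topologicalType} (G : groupoid T) (HG : lch_etale G).
Local Notation r := (grng G).
Local Notation s := (gsrc G).
Local Notation "g ∘ h" := (gmul G g h) (at level 40, left associativity).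
Local Notation inv := (ginv G).

Definition bisection (U : set T) :=
  [/\ open U, forall g h, U g -> U h -> r g = r h -> g = h &
      forall g h, U g -> U h -> s g = s h -> g = h].

Lemma local_homeomorphism_continuous (X Y : topologicalType) (f : X -> Y) :
  local_homeomorphism f -> continuous f.
Proof.
move=> lf x; have [U [[oU Ux] cf _ _]] := lf x.
by move/subspace_continuousP: cf => /(_ x Ux); rewrite within_interior // (interior_id _).1.
Qed.

Lemma continuous_grng : continuous r.
Proof.
have [/local_homeomorphism_continuous h _] := lch_is_etale HG.
move=> x; apply: (@continuous_comp _ _ _ (rng_unit G) val); first exact: h.
exact: initial_continuous.
Qed.

Lemma continuous_gsrc : continuous s.
Proof.
have [_ /local_homeomorphism_continuous h] := lch_is_etale HG.
move=> x; apply: (@continuous_comp _ _ _ (src_unit G) val); first exact: h.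
exact: initial_continuous.
Qed.

Lemma continuous_ginv : continuous inv.
Proof. by have [] := lch_topological HG. Qed.

(** Near a unit both [y] and [r y] lie in a set on which [r] is injective, and they have the same
    range; so [r y = y]. *)
Lemma open_gunits : open (gunits G).
Proof.
rewrite openE => x /= x1; have [lr _] := lch_is_etale HG.
have [U [[oU Ux] _ iU _]] := lr x.
have nU : nbhs (r x) U by rewrite x1; exact: open_nbhs_nbhs.
have := continuous_grng nU; have := open_nbhs_nbhs (conj oU Ux).
rewrite /interior; apply: filterS2 => y Uy Ury.
suff : r y = y by [].
apply: iU; rewrite ?inE//; apply: val_inj => /=.
by rewrite grng_rng.
Qed.

Lemma closed_gunits : closed (gunits G).
Proof.
have cp : continuous (fun x => (r x, x)).
  by move=> x; apply: cvg_pair; [exact: continuous_grng | exact: cvg_id].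
apply: ((continuous_closedP _).1 cp [set p | p.1 = p.2]).
have hT := lch_hausdorff HG; rewrite -[X in closed X]setCK.
apply: open_closedC; rewrite openE => -[a b] /= ab.
move: hT; rewrite open_hausdorff => /(_ a b) [|[A B] /= [Aa Bb] [oA oB AB]].
  exact/eqP.
exists (A, B) => /=; first by split; apply: open_nbhs_nbhs; split=> //; exact: set_mem.
move=> [c d] /= [Ac Bd] cd; have : (A `&` B) c by split=> //; rewrite cd.
by rewrite (eqP AB).
Qed.

(** A local homeomorphism into the unit space is open, and the unit space is open in [T]; hence [r]
    and [s] are open as maps from [T] to [T]. *)
Lemma open_image_units (f : T -> gunits G) (V : set T) :
  local_homeomorphism f -> open V -> open ((val \o f) @` V).
Proof.
move=> lf oV; rewrite openE => _ [x Vx <-].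
have [U [[oU Ux] _ _ fo]] := lf x.
have [W oW Wf] : open (f @` (V `&` U)).
  by apply: fo; [exact: openI | exact: subIsetr].
have : nbhs (val (f x)) (W `&` gunits G).
  apply: open_nbhs_nbhs; split; first exact: openI open_gunits.
  split; last exact/set_mem/valP.
  by suff : (val @^-1` W) (f x) by []; rewrite Wf; exists x.
apply: filterS => y [Wy uy].
have : (val @^-1` W) (exist _ y (mem_set uy) : gunits G) by [].
by rewrite Wf => -[z [Vz _] zy]; exists z => //=; rewrite zy.
Qed.

Lemma open_grng V : open V -> open (r @` V).
Proof. by have [+ _] := lch_is_etale HG => /open_image_units; exact. Qed.

Lemma open_gsrc V : open V -> open (s @` V).
Proof. by have [_ +] := lch_is_etale HG => /open_image_units; exact. Qed.

Lemma bisection_nbhs g N : nbhs g N -> exists U, [/\ bisection U, U g & U `<=` N].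
Proof.
move=> Ng; have [lr ls] := lch_is_etale HG.
have [U [[oU Ug] _ iU _]] := lr g; have [V [[oV Vg] _ iV _]] := ls g.
move: Ng; rewrite nbhsE => -[W [oW Wg] WN].
exists (U `&` V `&` W); split; last 2 first.
- by split.
- by move=> x [_ /WN].
split; first by apply: openI => //; exact: openI.
  move=> x y [[Ux _] _] [[Uy _] _] xy; apply: iU; rewrite ?inE//.
  exact: val_inj.
move=> x y [[_ Ux] _] [[_ Uy] _] xy; apply: iV; rewrite ?inE//.
exact: val_inj.
Qed.

(** The inverse of [r] on a bisection. The default [y] is chosen for [conv_bisection]: if [y = r g]
    is outside [r(U)], then [y] is not in [U], and functions supported in [U] vanish there. *)
Definition rsec (U : set T) (y : T) : T :=
  if pselect (exists u, U u /\ r u = y) is left h then projT1 (cid h) else y.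

Lemma rsecP U y : (r @` U) y -> U (rsec U y) /\ r (rsec U y) = y.
Proof.
move=> [u Uu uy]; rewrite /rsec; case: pselect; last by case; exists u.
by move=> h; case: cid.
Qed.

Lemma rsecE U u : bisection U -> U u -> rsec U (r u) = u.
Proof.
move=> [_ i _] Uu; have Vu : (r @` U) (r u) by exists u.
by have [? ?] := rsecP Vu; apply: i.
Qed.

Lemma continuous_rsec U y : bisection U -> (r @` U) y ->
  {for y, continuous (rsec U)}.
Proof.
move=> bU [u Uu <-] N; rewrite rsecE// nbhsE => -[W [oW Wu] WN].
have [oU _ _] := bU.
suff : nbhs (r u) (rsec U @^-1` N) by [].
rewrite nbhsE; exists (r @` (U `&` W)).
  by split; [exact/open_grng/openI | exists u].
by move=> _ [v [Uv Wv] <-] /=; rewrite rsecE//; exact: WN.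
Qed.

Lemma continuous_gmul (X : topologicalType) (a b : X -> T) (x : X) :
  {for x, continuous a} -> {for x, continuous b} -> s (a x) = r (b x) ->
  (\forall y \near x, s (a y) = r (b y)) ->
  {for x, continuous (fun y => a y ∘ b y)}.
Proof.
move=> ca cb abx ab N Nx; have [_ /subspace_continuousP cm] := lch_topological HG.
have := cm (a x, b x) abx N Nx.
rewrite /nbhs/= /within/= => -[[P Q] /= [Pa Qb] PQ].
have := ca _ Pa; have := cb _ Qb; near_simpl.
rewrite /nbhs/=; move: ab; apply: filterS3 => y aby Qy Py.
exact: (PQ (a y, b y)).
Qed.

End EtaleTopology.

(** * Compactly supported functions and partitions of unity *)

Section CompactSupport.
Context {R : realType} {T : topologicalType}.
Hypothesis hT : hausdorff_space T.
Hypothesis lcT : locally_compact [set: T].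
Implicit Types (f : T -> Cplx R) (a : T -> R).

Definition supp f : set T := closure [set g | f g != 0].

Definition rscale a f : T -> Cplx R := fun g => (a g)%:C%C * f g.

Lemma suppN f x : ~ supp f x -> f x = 0.
Proof.
by move=> nfx; apply/eqP/negPn/negP => fx; apply: nfx; exact: subset_closure.
Qed.

Lemma closed_supp f : closed (supp f). Proof. exact: closed_closure. Qed.

Lemma supp_closed f (K : set T) :
  closed K -> (forall x, ~ K x -> f x = 0) -> supp f `<=` K.
Proof.
move=> cK fK; rewrite (closure_id K).1//; apply: closureS => x /= fx.
by apply: contrapT => nK; move/eqP: fx; apply; exact: fK.
Qed.

Lemma Cc_compact f : Cc f -> compact (supp f). Proof. by case. Qed.

Lemma Cc_intro f (K : set T) : continuous f -> compact K ->
  (forall x, ~ K x -> f x = 0) -> Cc f.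
Proof.
move=> cf cK fK; split => //; apply: (subclosed_compact _ cK).
  exact: closed_closure.
by apply: supp_closed => //; exact: compact_closed.
Qed.

Lemma Cc0 : Cc (fun _ : T => 0 : Cplx R).
Proof. by apply: (@Cc_intro _ set0) => //; [exact: cst_continuous | exact: compact0]. Qed.

Lemma CcD f1 f2 : Cc f1 -> Cc f2 -> Cc (f1 \+ f2).
Proof.
move=> C1 C2; apply: (@Cc_intro _ (supp f1 `|` supp f2)).
- by move=> x; apply: cvgD; [have [+ _] := C1 | have [+ _] := C2]; exact.
- by apply: compactU; exact: Cc_compact.
- by move=> x /not_orP[n1 n2] /=; rewrite (suppN n1) (suppN n2) addr0.
Qed.

Lemma Cc_mul (u f : T -> Cplx R) : continuous u -> Cc f -> Cc (fun g => u g * f g).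
Proof.
move=> cu Cf; apply: (@Cc_intro _ (supp f)).
- move=> x; apply: continuous_mulc; first exact: cu.
  by have [+ _] := Cf; exact.
- exact: Cc_compact.
- by move=> x n; rewrite (suppN n) mulr0.
Qed.

Lemma CcZ (k : Cplx R) f : Cc f -> Cc (fun g => k * f g).
Proof. by apply: Cc_mul; exact: cst_continuous. Qed.

Lemma Cc_rscale a f : continuous a -> Cc f -> Cc (rscale a f).
Proof. by move=> ca; apply: Cc_mul => x; apply/continuous_real_complex/ca. Qed.

Lemma Cc_lin (k : R[i]) f1 f2 : Cc f1 -> Cc f2 -> Cc (fun g => k *: f1 g + f2 g).
Proof. by move=> C1; apply: CcD; exact: CcZ. Qed.

Lemma Cc_real a : continuous a -> compact (closure [set x | a x != 0]) ->
  Cc (fun x => (a x)%:C%C : Cplx R).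
Proof.
move=> ca cK; apply: (@Cc_intro _ _ _ cK).
  by move=> x; apply/continuous_real_complex/ca.
move=> x n; apply/eqP/negPn/negP => ax; apply: n; apply: subset_closure => /=.
by apply: contra ax => /eqP ->.
Qed.

Lemma Cc_bounded f : Cc f -> exists M, 0 < M /\ forall x, nrm (f x) <= M.
Proof.
move=> [cf cK]; have : compact ((fun x => nrm (f x)) @` supp f).
  by apply: continuous_compact => //; apply: continuous_subspaceT => x; apply/continuous_nrm/cf.
move=> /compact_bounded[M [_ MP]]; exists (`|M| + 1); split.
  by rewrite ltr_wpDl.
have M1 : M < `|M| + 1 by rewrite (le_lt_trans (ler_norm M)) // ltrDl.
move=> x; have [Kx|nKx] := pselect (supp f x).
  by rewrite -[leLHS]ger0_norm ?nrm_ge0//; apply: (MP _ M1); exists x.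
by rewrite (suppN nKx) nrm0 addr_ge0.
Qed.

(** A partition of unity for two sets: [a] is a bump supported in [U] that equals 1 near the part of
    the support of [f] outside [W], so [(1 - a) f] vanishes near that part. *)
Lemma Cc_split f (U W : set T) : Cc f -> open U -> open W ->
  supp f `<=` U `|` W ->
  exists a, [/\ continuous a, forall y, 0 <= a y <= 1,
    supp (rscale a f) `<=` U & supp (rscale (fun y => 1 - a y) f) `<=` W].
Proof.
move=> Cf oU oW fUW.
have [|x []|e [ce e01 [V [oV KV Ve]] eU _]] :=
  @bump_exists _ hT lcT R (supp f `&` ~` W) U _ oU.
- by apply: compact_closedI; [exact: Cc_compact | exact: open_closedC].
- by move=> /fUW[].
exists e; split => //.
  apply: subset_trans eU; apply: closureS => x /=; apply: contra_neq => ex.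
  by rewrite /rscale ex mul0r.
have -> : W = ~` (~` W) by rewrite setCK.
move=> x xs nWx.
have : ~ V x.
  move: x xs {nWx}; apply: supp_closed; first exact: open_closedC.
  by move=> x /contrapT Vx; rewrite /rscale Ve// subrr mul0r.
apply; apply: KV; split => //; move: x xs {nWx}.
apply: supp_closed; first exact: closed_supp.
by move=> x /suppN; rewrite /rscale => ->; rewrite mulr0.
Qed.

Lemma rscale_split a f : f = rscale a f \+ rscale (fun y => 1 - a y) f.
Proof.
by apply/funext => x; rewrite /rscale /= -mulrDl -raddfD/= addrC subrK mul1r.
Qed.

Lemma rscaleM a b f : rscale a (rscale b f) = rscale (fun y => a y * b y) f.
Proof. by apply/funext => x; rewrite /rscale rmorphM/= mulrA. Qed.

Lemma open_bigsetU (J : Type) (t : seq J) (U : J -> set T) :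
  (forall j, open (U j)) -> open (\big[setU/set0]_(j <- t) U j).
Proof.
move=> oU; elim: t => [|j t ih]; first by rewrite big_nil; exact: open0.
by rewrite big_cons; exact: openU.
Qed.

(* Cuts [f] by a partition of unity subordinate to the neighbourhoods [U]. *)
Lemma Cc_local_ind f (P : (T -> Cplx R) -> Prop) : Cc f -> P (fun=> 0) ->
  (forall f1 f2, Cc f1 -> Cc f2 -> P f1 -> P f2 -> P (f1 \+ f2)) ->
  (forall x, supp f x -> exists U, nbhs x U /\
    forall a, continuous a -> (forall y, 0 <= a y <= 1) ->
      supp (rscale a f) `<=` U -> P (rscale a f)) ->
  P f.
Proof.
move=> Cf P0 PD Ploc.
(* [P] is asked for every cut-off [a] and not for a single one, because the induction over the cover
   multiplies the cut-offs. *)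
pose good (U : set T) := open U /\ forall a, continuous a ->
  (forall y, 0 <= a y <= 1) -> supp (rscale a f) `<=` U -> P (rscale a f).
have [|t Ut] := @compact_finite_cover T {U | good U} sval (supp f) (Cc_compact Cf).
  move=> x /Ploc[U [Ux UP]]; have /= gU : good U°.
    split; [exact: open_interior|move=> a ca a01 aU; apply: UP => //].
    by apply: subset_trans aU _; exact: interior_subset.
  by exists (exist _ _ gU) => /=; exact: nbhs_interior.
suff h (a : T -> R) : continuous a -> (forall y, 0 <= a y <= 1) ->
    supp (rscale a f) `<=` \big[setU/set0]_(j <- t) sval j -> P (rscale a f).
  have f1 : f = rscale (fun=> 1) f by apply/funext => x; rewrite /rscale mul1r.
  rewrite f1; apply: h; [exact: cst_continuous | by move=> _; rewrite ler01 lexx|].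
  by rewrite -f1.
elim: t {Ut} a => [|[U [oU gU]] t ih] a ca a01.
  rewrite big_nil => a0; rewrite (_ : rscale a f = fun=> 0)//.
  by apply/funext => x; apply: suppN => /a0.
rewrite big_cons /= => aUt.
have oW : open (\big[setU/set0]_(j <- t) sval j).
  by apply: open_bigsetU => -[? []].
have Ca : Cc (rscale a f) by exact: Cc_rscale.
have [e [ce e01 eU eW]] := Cc_split Ca oU oW aUt.
rewrite (rscale_split e (rscale a f)).
have ce' : continuous (fun y => 1 - e y).
  by move=> x; apply: cvgB; [exact: cvg_cst | exact: ce].
apply: PD; [exact: Cc_rscale | exact: Cc_rscale |move: eU|move: eW]; rewrite rscaleM.
  apply: gU; first by move=> x; apply: cvgM; [exact: ce | exact: ca].
  by move=> y; have /andP[? ?] := a01 y; have /andP[? ?] := e01 y; apply/andP; split; nra.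
apply: ih; first by move=> x; apply: cvgM; [exact: ce' | exact: ca].
by move=> y; have /andP[? ?] := a01 y; have /andP[? ?] := e01 y; apply/andP; split; nra.
Qed.

End CompactSupport.

(** * The convolution algebra *)

Section Convolution.
Context {R : realType} {T : topologicalType} (G : groupoid T).
Hypothesis HG : lch_etale G.
Let hT := lch_hausdorff HG.
Let lcT := lch_locally_compact HG.
Implicit Types (f : T -> Cplx R) (a : T -> R) (g h : T).
Local Notation r := (grng G).
Local Notation s := (gsrc G).
Local Notation "g ∘ h" := (gmul G g h) (at level 40, left associativity).
Local Notation inv := (ginv G).
Local Notation fiber := (range_fiber G).
Local Notation conv := (convolution G).
Local Notation star := (involution G).

Lemma involutionE f g : star f g = (f (inv g) : R[i])^*%C.
Proof. exact: conjE. Qed.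

(** [K] is covered by finitely many bisections, and each of them meets a fibre of [r] in at most one
    arrow. *)
Lemma finite_fiber (K : set T) x : compact K -> finite_set (K `&` fiber x).
Proof.
move=> cK; have [|t tK] := @compact_finite_cover T {U | bisection G U} sval K cK.
  move=> y _; have [U [bU Uy _]] := bisection_nbhs HG (@filterT _ (nbhs y) _).
  by exists (exist _ U bU) => /=; apply: open_nbhs_nbhs; split=> //; case: bU.
suff h : finite_set ((\big[setU/set0]_(j <- t) sval j) `&` fiber x).
  by apply: sub_finite_set h => y [Ky yx]; split => //; exact: tK.
elim: t {tK} => [|[U bU] t ih]; first by rewrite big_nil set0I.
rewrite big_cons setIUl finite_setU; split => //=.
have [[u [Uu ux]]|n] := pselect ((U `&` fiber x) !=set0).
  apply: (@sub_finite_set _ _ [set u]) => [y [Uy yx]|]; last exact: finite_set1.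
  by case: bU => _ + _; apply => //; rewrite ux yx.
by rewrite (_ : _ `&` _ = set0)//; apply/seteqP; split => // y Uy; apply: n; exists y.
Qed.

(** Cuts the fibre down to an index set that is finite for compact [K], over which sums split
    without a condition on the supports of the summands. *)
Lemma conv_finite f1 f2 g (K : set T) : (forall x, ~ K x -> f1 x = 0) ->
  conv f1 f2 g = \sum_(h \in K `&` fiber (r g)) (f1 h * f2 (inv h ∘ g)).
Proof.
move=> fK; apply/esym/fsbig_widen; first exact: subIsetr.
by move=> h [_ /not_andP[nK|//]] /=; rewrite (fK _ nK) mul0r.
Qed.

Lemma convDl f1 f1' f2 : Cc f1 -> Cc f1' ->
  conv (f1 \+ f1') f2 = conv f1 f2 \+ conv f1' f2.
Proof.
move=> C1 C1'; apply/funext => g /=.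
have cK : compact (supp f1 `|` supp f1') by apply: compactU; exact: Cc_compact.
rewrite !(@conv_finite _ _ g (supp f1 `|` supp f1')).
- rewrite -fsbig_split/=; last exact: finite_fiber.
  by apply: eq_fsbigr => h _; rewrite mulrDl.
- by move=> x /not_orP[_ n]; exact: suppN.
- by move=> x /not_orP[n _]; exact: suppN.
- by move=> x /not_orP[n n'] /=; rewrite (suppN n) (suppN n') addr0.
Qed.

Lemma convDr f1 f2 f2' : Cc f1 ->
  conv f1 (f2 \+ f2') = conv f1 f2 \+ conv f1 f2'.
Proof.
move=> C1; apply/funext => g /=; rewrite !(@conv_finite _ _ g (supp f1)).
- rewrite -fsbig_split/=; last exact/finite_fiber/Cc_compact.
  by apply: eq_fsbigr => h _; rewrite mulrDr.
- by move=> x; exact: suppN.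
- by move=> x; exact: suppN.
- by move=> x; exact: suppN.
Qed.

Lemma convZl (k : Cplx R) f1 f2 :
  conv (fun g => k * f1 g) f2 = fun g => k * conv f1 f2 g.
Proof.
apply/funext => g; rewrite /convolution mulr_fsumr.
by apply: eq_fsbigr => h _; rewrite mulrA.
Qed.

Lemma convZr (k : Cplx R) f1 f2 :
  conv f1 (fun g => k * f2 g) = fun g => k * conv f1 f2 g.
Proof.
apply/funext => g; rewrite /convolution mulr_fsumr.
by apply: eq_fsbigr => h _; rewrite mulrCA.
Qed.

Lemma conv0l f : conv (fun=> 0) f = fun=> 0.
Proof. by apply/funext => g; apply: fsbig1 => h _; rewrite mul0r. Qed.

Lemma conv_single f1 f2 g h : r h = r g ->
  (forall k, r k = r g -> k <> h -> f1 k * f2 (inv k ∘ g) = 0) ->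
  conv f1 f2 g = f1 h * f2 (inv h ∘ g).
Proof.
move=> hg H; rewrite -(fsbig_set1 +%R h (fun h => f1 h * f2 (inv h ∘ g))).
apply/esym/fsbig_widen; first by move=> _ ->.
by move=> k [kg kh] /=; exact: H.
Qed.

(** The fibre over [r g] meets the bisection in at most one arrow, so one term is left. As [rsec] is
    continuous over [r(U)], this formula gives the continuity of products, and associativity as
    well. *)
Lemma conv_bisection U f1 f2 g : bisection G U -> (forall x, ~ U x -> f1 x = 0) ->
  conv f1 f2 g = f1 (rsec G U (r g)) * f2 (inv (rsec G U (r g)) ∘ g).
Proof.
move=> bU f10; have [Ug|nUg] := pselect ((r @` U) (r g)).
  have [Us rs] := rsecP Ug; apply: conv_single => // k kg ks.
  have [Uk|/f10 ->] := pselect (U k); last by rewrite mul0r.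
  by case: bU => _ i _; case: ks; apply: i; rewrite ?rs.
have E : rsec G U (r g) = r g.
  rewrite /rsec; case: pselect => // -[u [Uu ug]].
  by case: nUg; exists u.
rewrite E f10 ?mul0r; last by move=> Ug; apply: nUg; exists (r g); rewrite ?grng_rng.
rewrite /convolution fsbig1// => k kg.
by rewrite f10 ?mul0r// => Uk; apply: nUg; exists k.
Qed.

Lemma conv_local_ind (P : (T -> Cplx R) -> Prop) f : Cc f -> P (fun=> 0) ->
  (forall f1 f2, Cc f1 -> Cc f2 -> P f1 -> P f2 -> P (f1 \+ f2)) ->
  (forall f U, Cc f -> bisection G U -> supp f `<=` U -> P f) -> P f.
Proof.
move=> Cf P0 PD PU; apply: (Cc_local_ind hT lcT Cf) => // x _.
have [U [bU Ux _]] := bisection_nbhs HG (@filterT _ (nbhs x) _).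
exists U; split; first by apply: open_nbhs_nbhs; split=> //; case: bU.
by move=> a ca a01 aU; apply: PU aU => //; exact: Cc_rscale.
Qed.

(* [Q f C] stands for a bound on [f] by [C], such as [N f <= C] for a seminorm
   [N]. *)
Lemma bisection_bound (Q : (T -> Cplx R) -> R -> Prop) (B : R) (K : set T) :
  compact K -> 0 <= B -> Q (fun=> 0) 0 ->
  (forall f1 f2 C1 C2, Cc f1 -> Cc f2 -> Q f1 C1 -> Q f2 C2 ->
    Q (f1 \+ f2) (C1 + C2)) ->
  (forall f U M, Cc f -> bisection G U -> supp f `<=` U -> 0 <= M ->
    (forall x, nrm (f x) <= M) -> Q f (B * M)) ->
  exists2 C, 0 <= C & forall f M, Cc f -> supp f `<=` K -> 0 <= M ->
    (forall x, nrm (f x) <= M) -> Q f (C * M).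
Proof.
move=> cK B0 Q0 QD QU.
have [|t tK] := @compact_finite_cover T {U | bisection G U} sval K cK.
  move=> y _; have [U [bU Uy _]] := bisection_nbhs HG (@filterT _ (nbhs y) _).
  by exists (exist _ U bU) => /=; apply: open_nbhs_nbhs; split=> //; case: bU.
(* The constant counts the bisections in a cover of [K]; it does not depend on the function. *)
exists ((size t)%:R * B) => [|f M Cf /subset_trans/(_ tK) + M0]; first by rewrite mulr_ge0.
elim: t {tK} f Cf => [|[U bU] t ih] f Cf.
  rewrite big_nil => f0 _; rewrite !mul0r (_ : f = fun=> 0)//.
  by apply/funext => x; apply: suppN => /f0.
rewrite big_cons /= => ft fM.
have oW : open (\big[setU/set0]_(j <- t) sval j) by apply: open_bigsetU => -[? []].
have oU : open U by have [] := bU.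
have [e [ce e01 eU eW]] := Cc_split hT lcT Cf oU oW ft.
have ce' : continuous (fun y => 1 - e y).
  by move=> x; apply: cvgB; [exact: cvg_cst | exact: ce].
have eM a x : 0 <= a x <= 1 -> nrm (rscale a f x) <= M.
  move=> /andP[a0 a1]; rewrite nrmM nrm_real ger0_norm//.
  by have := fM x; have := nrm_ge0 (f x); nra.
have -> : (size (exist _ U bU :: t))%:R * B * M = B * M + (size t)%:R * B * M.
  by rewrite /= -addn1 natrD; ring.
rewrite (rscale_split e f); apply: QD; [exact: Cc_rscale | exact: Cc_rscale | |].
  by apply: QU bU eU M0 _ => [|x]; [exact: Cc_rscale | exact: eM].
apply: ih => // [|x]; first exact: Cc_rscale.
by apply: eM; have /andP[? ?] := e01 x; apply/andP; split; lra.
Qed.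

Lemma fiber_translate (F : T -> Cplx R) u :
  \sum_(h \in fiber (r u)) F h = \sum_(k \in fiber (s u)) F (u ∘ k).
Proof.
apply: reindex_fsbig; split.
- by move=> k uk /=; rewrite /range_fiber/= grng_mul.
- move=> k k'; rewrite !inE /range_fiber/= => ku ku' E.
  by rewrite -(@gmulVK _ G u k)// -(@gmulVK _ G u k')// E.
- move=> h hu; exists (inv u ∘ h); last by rewrite gmulKV.
  by rewrite /range_fiber/= grng_mul ?gsrc_inv ?grng_inv.
Qed.

Lemma closed_composable : closed (composable G).
Proof.
have cp : continuous (fun p : T * T => (s p.1, r p.2)).
  move=> p; apply: cvg_pair.
    by apply: continuous_comp; [exact: cvg_fst | exact: (continuous_gsrc HG)].
  by apply: continuous_comp; [exact: cvg_snd | exact: (continuous_grng HG)].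
apply: ((continuous_closedP _).1 cp [set p | p.1 = p.2]).
rewrite -[X in closed X]setCK.
apply: open_closedC; rewrite openE => -[a b] /= ab.
move: hT; rewrite open_hausdorff => /(_ a b) [|[A B] /= [Aa Bb] [oA oB AB]].
  exact/eqP.
exists (A, B) => /=; first by split; apply: open_nbhs_nbhs; split=> //; exact: set_mem.
move=> [c d] /= [Ac Bd] cd; have : (A `&` B) c by split=> //; rewrite cd.
by rewrite (eqP AB).
Qed.

Lemma compact_product (K L : set T) : compact K -> compact L ->
  compact [set g | exists h k, [/\ K h, L k, s h = r k & g = h ∘ k]].
Proof.
move=> cK cL; have cKL : compact ((K `*` L) `&` composable G).
  by apply: compact_closedI closed_composable; exact: compact_setX.
have -> : [set g | exists h k, [/\ K h, L k, s h = r k & g = h ∘ k]] =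
    (fun p : T * T => p.1 ∘ p.2) @` ((K `*` L) `&` composable G).
  apply/seteqP; split=> [g [h [k [Kh Lk hk ->]]]|_ [[h k] [[/= Kh Lk] hk] <-]].
    by exists (h, k).
  by exists h, k.
apply: continuous_compact => //; have [_ cm] := lch_topological HG.
by apply: continuous_subspaceW cm; exact: subIsetr.
Qed.

Lemma conv_supp f1 f2 (K L : set T) g : (forall x, ~ K x -> f1 x = 0) ->
  (forall x, ~ L x -> f2 x = 0) ->
  ~ (exists h k, [/\ K h, L k, s h = r k & g = h ∘ k]) -> conv f1 f2 g = 0.
Proof.
move=> fK fL n; apply: fsbig1 => h hg.
have [Kh|/fK ->] := pselect (K h); last by rewrite mul0r.
have [Lh|/fL ->] := pselect (L (inv h ∘ g)); last by rewrite mulr0.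
case: n; exists h, (inv h ∘ g); split => //; last by rewrite gmulKV.
by rewrite grng_mul ?gsrc_inv ?grng_inv.
Qed.

(** For [f] supported in a bisection [U], the one-term formula is continuous over the open set
    [r(U)]. At other points the product vanishes on a neighbourhood, because [r(supp f)] is compact,
    hence closed, and contained in [r(U)]. *)
Lemma Cc_conv f1 f2 : Cc f1 -> Cc f2 -> Cc (conv f1 f2).
Proof.
move=> C1 C2; apply: (conv_local_ind (P := fun f => Cc (conv f f2)) C1) => [|f f' Cf Cf' H H'|f U Cf bU fU].
- by rewrite conv0l; exact: Cc0.
- by rewrite convDl//; exact: CcD.
have f0 x : ~ U x -> f x = 0 by move=> nU; apply: suppN => /fU.
apply: (Cc_intro hT (K := [set g | exists h k, [/\ supp f h, supp f2 k, s h = r k & g = h ∘ k]])).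
- move=> g0; have [Ug|nUg] := pselect ((r @` U) (r g0)).
    rewrite (_ : conv f f2 = fun g => f (rsec G U (r g)) * f2 (inv (rsec G U (r g)) ∘ g)).
      have cs : {for g0, continuous (fun g => rsec G U (r g))}.
        apply: (@continuous_comp _ _ _ r (rsec G U)); first exact: (continuous_grng HG).
        exact: continuous_rsec.
      apply: continuous_mulc.
        apply: (@continuous_comp _ _ _ (fun g => rsec G U (r g)) f) => //.
        by have [+ _] := Cf; exact.
      apply: (@continuous_comp _ _ _ (fun g => inv (rsec G U (r g)) ∘ g) f2).
        apply: (continuous_gmul HG).
        + apply: (@continuous_comp _ _ _ (fun g => rsec G U (r g)) inv) => //.
          exact: (continuous_ginv HG).
        + exact: cvg_id.
        + by rewrite gsrc_inv; have [_ ->] := rsecP Ug.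
        + have oU : open (r @` U) by apply: open_grng => //; case: bU.
          have : nbhs g0 (r @^-1` (r @` U)).
            by apply: (continuous_grng HG); apply: open_nbhs_nbhs.
          by apply: filterS => g /rsecP[_ E]; rewrite gsrc_inv E.
      by have [+ _] := C2; exact.
    by apply/funext => g; rewrite (conv_bisection f2 g bU f0).
  have clK : closed (r @` supp f).
    apply: compact_closed => //; apply: continuous_compact; last exact: Cc_compact.
    by apply: continuous_subspaceT => x; exact: (continuous_grng HG).
  have nK : ~ (r @` supp f) (r g0) by move=> [u /fU Uu ug]; apply: nUg; exists u.
  have Z : forall g, ~ (r @` supp f) (r g) -> conv f f2 g = 0.
    move=> g nKg; apply: fsbig1 => h hg.
    by rewrite (@suppN _ _ f h) ?mul0r// => hf; apply: nKg; exists h.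
  apply/continuous_nrmP => e e0; have oK := closed_openC clK.
  have : nbhs g0 (r @^-1` (~` (r @` supp f))).
    by apply: (continuous_grng HG); apply: open_nbhs_nbhs.
  by apply: filterS => g nKg; rewrite Z// Z// subrr nrm0.
- by apply: compact_product; exact: Cc_compact.
- by move=> g n; apply: (@conv_supp _ _ (supp f) (supp f2)) => // x; exact: suppN.
Qed.

(** For [f] supported in a bisection, convolution with [f] on the left is a translation by the one
    arrow [u] with range [r g], multiplied by [f u]; left translation by [u] matches the two fibre
    sums. *)
Lemma convA f1 f2 f3 : Cc f1 -> Cc f2 -> Cc f3 ->
  conv f1 (conv f2 f3) = conv (conv f1 f2) f3.
Proof.
move=> C1 C2 C3; apply: (conv_local_ind (P := fun f => conv f (conv f2 f3) = conv (conv f f2) f3) C1) => [|f f' Cf Cf' H H'|f U Cf bU fU].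
- by rewrite !conv0l.
- by rewrite !convDl ?H ?H'//; exact: Cc_conv.
have f0 x : ~ U x -> f x = 0 by move=> nU; apply: suppN => /fU.
apply/funext => g; rewrite (conv_bisection _ g bU f0) [RHS]/convolution.
set u := rsec G U (r g).
have [Ug|nUg] := pselect ((r @` U) (r g)); last first.
  have fu0 : f u = 0.
    apply: f0 => Uu; apply: nUg; exists u => //.
    rewrite /u /rsec; case: pselect => [h|_]; last exact: grng_rng.
    by case: cid => /= ? [].
  rewrite fu0 mul0r fsbig1// => h hg.
  by rewrite (conv_bisection _ h bU f0) hg fu0 !mul0r.
have [Uu ru] := rsecP Ug; rewrite -/u in Uu ru.
rewrite -ru fiber_translate /convolution mulr_fsumr.
rewrite grng_mul ?gsrc_inv// grng_inv; apply: eq_fsbigr => k.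
rewrite inE /range_fiber/= => ku.
have rk : r (u ∘ k) = r g by rewrite grng_mul ?ru.
rewrite -[X in _ = X * _]/(conv f f2 (u ∘ k)) (conv_bisection _ _ bU f0) rk -/u.
rewrite gmulVK// ginvM// -gmulA ?gsrc_inv ?grng_inv// ?mulrA//.
Qed.

Lemma starK f : star (star f) = f.
Proof. by apply/funext => g; rewrite !involutionE ginvK conjcK. Qed.

Lemma star_lin (k : Cplx R) f1 f2 :
  star (fun g => k * f1 g + f2 g) = fun g => k^*%C * star f1 g + star f2 g.
Proof. by apply/funext => g; rewrite !involutionE rmorphD rmorphM. Qed.

Lemma Cc_star f : Cc f -> Cc (star f).
Proof.
move=> Cf; apply: (Cc_intro hT (K := inv @` supp f)).
- move=> x; rewrite (_ : star f = fun g => (f (inv g) : R[i])^*%C).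
    apply: continuous_conj; apply: (@continuous_comp _ _ _ inv f).
      exact: (continuous_ginv HG).
    by have [+ _] := Cf; exact.
  by apply/funext => g; exact: involutionE.
- apply: continuous_compact; last exact: Cc_compact.
  by apply: continuous_subspaceT => x; exact: (continuous_ginv HG).
- move=> x n; rewrite involutionE (@suppN _ _ f) ?conjc0// => fx; apply: n.
  by exists (inv x) => //; rewrite ginvK.
Qed.

Lemma fsum_conj (I : choiceType) (P : set I) (F : I -> Cplx R) :
  (\sum_(i \in P) F i : R[i])^*%C = \sum_(i \in P) ((F i : R[i])^*%C : Cplx R).
Proof.
have E : (fun i => ((F i : R[i])^*%C : Cplx R)) @^-1` [set~ 0] = F @^-1` [set~ 0].
  apply/seteqP; split => i /= n /eqP F0; apply: n; apply/eqP; first by rewrite conjc_eq0.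
  by rewrite -conjc_eq0.
have -> : finite_support 0 P (fun i => ((F i : R[i])^*%C : Cplx R)) =
    finite_support 0 P F by rewrite /finite_support !unlock E.
elim: (finite_support _ _ _) => [|i t ih]; first by rewrite !big_nil conjc0.
by rewrite !big_cons rmorphD/= ih.
Qed.

Lemma star_conv f1 f2 : star (conv f1 f2) = conv (star f2) (star f1).
Proof.
apply/funext => g; rewrite involutionE /convolution fsum_conj [RHS]fiber_translate grng_inv.
apply: eq_fsbigr => h; rewrite inE/= => hg.
have gh : s g = r h by [].
have gh' : s (inv (g ∘ h)) = r g by rewrite gsrc_inv grng_mul.
rewrite !involutionE (ginvM gh') ginvK gmulVK// (ginvM gh).
by rewrite rmorphM mulrC.
Qed.

Definition unitfun f := forall g, ~ gunits G g -> f g = 0.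

Lemma conv_unitl u f : unitfun u -> conv u f = fun g => u (r g) * f g.
Proof.
move=> u1; apply/funext => g.
rewrite (@conv_single _ _ _ (r g)) ?grng_rng//; last first.
  move=> k kg kr; rewrite u1 ?mul0r// => k1; apply: kr; rewrite -kg.
  by symmetry; exact: k1.
by rewrite unit_inv ?gmul1g//; exact: units_rng.
Qed.

Lemma unitfun_star u : unitfun u -> star u = fun g => (u g : R[i])^*%C.
Proof.
move=> u1; apply/funext => g; rewrite involutionE.
have [g1|ng1] := pselect (gunits G g); first by rewrite unit_inv.
rewrite !u1// => g1; apply: ng1.
by rewrite -(ginvK G g); rewrite unit_inv.
Qed.

Lemma conv_unitr u f : unitfun u -> conv f u = fun g => f g * u (s g).
Proof.
move=> u1; apply/funext => g; rewrite (@conv_single _ _ _ g)//; last first.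
  move=> k kg kr; rewrite u1 ?mulr0// => k1; apply: kr.
  have w : inv k ∘ g = s k.
    by rewrite -(k1 : r _ = _) grng_mul ?gsrc_inv// grng_inv.
  by rewrite -(gmulKV kg) w gmulg1.
by rewrite gmulVg.
Qed.

(** If the term of [k] at [g] is nonzero, [k^-1] and [k^-1 g] are two elements of [U] with the same
    range. They coincide, so [g] is a unit and the term is a squared modulus. *)
Lemma star_bisection f U : bisection G U -> (forall x, ~ U x -> f x = 0) ->
  unitfun (conv (star f) f) /\
  forall x, conv (star f) f x = 0 \/ exists y, conv (star f) f x = ((nrm (f y))^+2)%:C%C.
Proof.
move=> bU f0; have Z g k : r k = r g -> star f k * f (inv k ∘ g) <> 0 -> gunits G g.
  move=> kg; rewrite involutionE => fk.
  have Uk : U (inv k) by apply: contrapT => /f0 E; rewrite E conjc0 mul0r in fk.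
  have Ukg : U (inv k ∘ g) by apply: contrapT => /f0 E; rewrite E mulr0 in fk.
  have E : inv k = inv k ∘ g.
    by case: bU => _ + _; apply => //; rewrite grng_mul ?gsrc_inv.
  have := gmulKV kg; rewrite -E gmulgV => <-; exact: units_rng.
split=> [g ng|g]; first by apply: fsbig1 => k kg; apply: contrapT => /(Z _ _ kg).
have [g1|ng1] := pselect (gunits G g); last first.
  by left; apply: fsbig1 => k kg; apply: contrapT => /(Z _ _ kg).
have [[k [kg fk]]|n] := pselect (exists k, r k = r g /\ f (inv k) <> 0); last first.
  left; apply: fsbig1 => k kg; rewrite involutionE.
  have [->|fk] := pselect (f (inv k) = 0); first by rewrite conjc0 mul0r.
  by case: n; exists k.
have kg1 : inv k ∘ g = inv k.
  by rewrite -[RHS](gmulg1 G) gsrc_inv kg g1.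
right; exists (inv k); rewrite (@conv_single _ _ _ k)//.
  by rewrite involutionE kg1 conj_mul_nrm.
move=> h hg hk; rewrite involutionE.
have [Uh|/f0 ->] := pselect (U (inv h)); last by rewrite conjc0 mul0r.
have Uk : U (inv k) by apply: contrapT => /f0.
case: hk; apply: (@ginv_inj _ G); case: bU => _ _; apply => //.
by rewrite !gsrc_inv kg.
Qed.

End Convolution.

(** * Norm estimates in the enveloping algebra *)

Section EnvelopingNorm.
Context {R : realType} {T : topologicalType} (G : groupoid T).
Hypothesis HG : lch_etale G.
Context (A : cstarAlgebra R) (iota : (T -> Cplx R) -> A).
Hypothesis HA : is_groupoid_cstar G iota.
Let hT := lch_hausdorff HG.
Let lcT := lch_locally_compact HG.
Implicit Types (f : T -> Cplx R) (a u e : T -> R) (g h : T).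
Local Notation conv := (convolution G).
Local Notation star := (involution G).
Local Notation rc := (fun (e : T -> R) (x : T) => (e x)%:C%C : Cplx R).

(** A real function in C_c of the unit space, extended by zero to all arrows. *)
Definition unit_weight e :=
  [/\ continuous e, Cc (rc e) & unitfun G (rc e)].

Lemma unit_bump (K U : set T) : compact K -> K `<=` gunits G -> open U ->
  K `<=` U -> exists e, [/\ unit_weight e, forall x, 0 <= e x <= 1,
    forall x, K x -> e x = 1 & supp (rc e) `<=` U].
Proof.
move=> cK K1 oU KU.
have [||e [ce e01 [V [oV KV Ve]] eU ceK]] :=
  @bump_exists _ hT lcT R K (U `&` gunits G) cK.
- exact/openI/(open_gunits HG).
- by move=> x Kx; split; [exact: KU | exact: K1].
have se : supp (rc e) `<=` U `&` gunits G.
  apply: subset_trans eU; apply: closureS => x /=; apply: contra_neq => ->; exact: erefl.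
exists e; split => //.
- split => //; first exact: Cc_real.
  by move=> x n; apply: (@suppN _ _ (rc e)) => h; have [_ /n] := se _ h.
- by move=> x /KV/Ve.
- by move=> x /se[].
Qed.

Lemma iota_lin (k : R[i]) f1 f2 : Cc f1 -> Cc f2 ->
  iota (fun g => k * f1 g + f2 g) = k *: iota f1 + iota f2.
Proof. by case: HA => + _ _ _ _; apply. Qed.

Lemma iotaD f1 f2 : Cc f1 -> Cc f2 -> iota (f1 \+ f2) = iota f1 + iota f2.
Proof.
move=> C1 C2; rewrite -[iota f1]scale1r -iota_lin//; congr iota.
by apply/funext => x; rewrite mul1r.
Qed.

Lemma iota0 : iota (fun=> 0) = 0.
Proof.
have := iotaD (Cc0 hT) (Cc0 hT); rewrite (_ : _ \+ _ = fun=> 0); last first.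
  by apply/funext => x /=; rewrite addr0.
by move=> /eqP; rewrite addrC -subr_eq subrr eq_sym => /eqP.
Qed.

Lemma iotaZ (k : R[i]) f : Cc f -> iota (fun g => k * f g) = k *: iota f.
Proof.
move=> Cf; rewrite -[RHS]addr0 -iota0 -iota_lin//; last exact: (Cc0 hT).
by congr iota; apply/funext => x; rewrite addr0.
Qed.

Lemma iotaM f1 f2 : Cc f1 -> Cc f2 -> iota (conv f1 f2) = cmul (iota f1) (iota f2).
Proof. by case: HA => _ + _ _ _; apply. Qed.

Lemma iota_star f : Cc f -> iota (star f) = cstar (iota f).
Proof. by case: HA => _ _ + _ _; apply. Qed.

Lemma nrm_cstar_mul (B : cstarAlgebra R) (b : B) : nrm (cmul (cstar b) b) = nrm b ^+ 2.
Proof. by apply: complexI; rewrite -normE cnorm_star rmorphXn/= -normE. Qed.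

Lemma nrm_cmul (B : cstarAlgebra R) (a b : B) : nrm (cmul a b) <= nrm a * nrm b.
Proof. by rewrite -lecR rmorphM/= -!normE cnormM. Qed.

Lemma nrm_cstar (B : cstarAlgebra R) (b : B) : nrm (cstar b) = nrm b.
Proof.
have h (x : B) : nrm x <= nrm (cstar x).
  have := nrm_cmul (cstar x) x; rewrite nrm_cstar_mul expr2.
  have [->|x0] := eqVneq (nrm x) 0; first by rewrite nrm_ge0.
  by rewrite ler_pM2r// lt0r x0 nrm_ge0.
by apply/eqP; rewrite eq_le h -{2}(cstarK b) h.
Qed.

Lemma nrm_iota_conv f : Cc f -> nrm (iota (conv (star f) f)) = nrm (iota f) ^+ 2.
Proof.
move=> Cf; rewrite iotaM//; last exact: (Cc_star HG).
by rewrite iota_star// nrm_cstar_mul.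
Qed.

Lemma unitfun_conv_star (u : T -> Cplx R) : unitfun G u ->
  conv (star u) u = fun g => ((nrm (u g)) ^+ 2)%:C%C.
Proof.
move=> u1; have su : unitfun G (star u).
  by move=> g ng; rewrite (unitfun_star u1) u1// conjc0.
rewrite conv_unitl// (unitfun_star u1); apply/funext => g.
have [g1|ng1] := pselect (gunits G g); first by rewrite g1 conj_mul_nrm.
by rewrite (u1 _ ng1) mulr0 nrm0 expr0n.
Qed.

(* With [U = u + i sqrt (e^2 - u^2)] one has [U^* U = e^2], and [u] is the mean
   of [U] and [U^*]. *)
Lemma iota_weight_le u e : unit_weight u -> unit_weight e ->
  (forall x, `|u x| <= e x) -> nrm (iota (rc u)) <= nrm (iota (rc e)).
Proof.
move=> [cu Cu u1] [ce Ce e1] ue.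
have [e0 u0] : (forall x, 0 <= e x) /\ (forall x, 0 <= e x ^+ 2 - u x ^+ 2).
  by split=> x; have := ue x; have := normr_ge0 (u x);
    rewrite ?subr_ge0 -?(real_normK (num_real (u x))); nra.
pose v x : R := Num.sqrt (e x ^+ 2 - u x ^+ 2).
pose U x : Cplx R := (u x +i* v x)%C.
have CU : Cc U.
  apply: (Cc_intro hT (K := supp (rc e))); last 2 first.
  - exact: Cc_compact.
  - move=> x /suppN[ex0].
    have ux0 : u x = 0 by apply/eqP; rewrite -normr_le0 -ex0.
    by rewrite /U /v ux0 ex0 expr0n subrr sqrtr0.
  apply/continuous_ReIm; split => //= x.
  apply: (@continuous_comp _ _ _ (fun x => e x ^+ 2 - u x ^+ 2) Num.sqrt).
    apply: cvgB; rewrite /=; apply: cvgM; by [exact: ce | exact: cu].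
  exact: sqrt_continuous.
have U1 : unitfun G U.
  move=> x nx; have [ux0] := u1 _ nx; have [ex0] := e1 _ nx.
  by rewrite /U /v ux0 ex0 expr0n subrr sqrtr0.
have UE : nrm (iota U) = nrm (iota (rc e)).
  have : nrm (iota U) ^+ 2 = nrm (iota (rc e)) ^+ 2.
    rewrite -!nrm_iota_conv// !unitfun_conv_star//; congr (nrm (iota _)).
    apply/funext => g; rewrite nrm_real real_normK ?num_real// nrm_sqr/=.
    by rewrite sqr_sqrtr// addrC subrK.
  by move=> /eqP; rewrite eqrXn2 ?nrm_ge0// => /eqP.
have CsU : Cc (star U) by exact: (Cc_star HG).
have -> : rc u = fun g => 2^-1%:C%C * (U \+ star U) g.
  apply/funext => g /=; rewrite (unitfun_star U1); apply/eqP.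
  by rewrite eq_complex/=; apply/andP; split; apply/eqP; field.
rewrite iotaZ; last exact: (CcD hT).
rewrite iotaD// iota_star// nrmZ nrm_real ger0_norm ?invr_ge0//.
have := nrmD (iota U) (cstar (iota U)); rewrite nrm_cstar UE.
by lra.
Qed.

(** From [e^2 <= e] and the C*-identity, the norm [n] of [e] satisfies [n^2 <= n]. *)
Lemma iota_weight_le1 e : unit_weight e -> (forall x, 0 <= e x <= 1) ->
  nrm (iota (rc e)) <= 1.
Proof.
move=> we e01; have [ce Ce e1] := we.
pose e2 x := e x ^+ 2.
have E : conv (star (rc e)) (rc e) = rc e2.
  rewrite unitfun_conv_star//; apply/funext => g.
  by rewrite nrm_real real_normK ?num_real.
have we2 : unit_weight e2.
  split; first by move=> x; apply: cvgM; exact: ce.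
    by rewrite -E; apply: (Cc_conv HG) => //; exact: (Cc_star HG).
  by move=> x nx; have [ex0] := e1 _ nx; rewrite /e2 ex0 expr0n.
have : nrm (iota (rc e)) ^+ 2 <= nrm (iota (rc e)).
  rewrite -nrm_iota_conv// E; apply: iota_weight_le => // x.
  have /andP[e0 e1x] := e01 x; rewrite /e2 ger0_norm ?sqr_ge0//; nra.
by have := nrm_ge0 (iota (rc e)); nra.
Qed.

Lemma unitfun_conv_weight f U : Cc f -> bisection G U -> supp f `<=` U ->
  exists v, [/\ unit_weight v, conv (star f) f = rc v, forall x, 0 <= v x &
    forall M, (forall x, nrm (f x) <= M) -> forall x, v x <= M ^+ 2].
Proof.
move=> Cf bU fU.
have f0 x : ~ U x -> f x = 0 by move=> n; apply: suppN => /fU.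
have [F1 Fx] := star_bisection bU f0.
have CF : Cc (conv (star f) f) by apply: (Cc_conv HG) => //; exact: (Cc_star HG).
exists (fun x => complex.Re (conv (star f) f x)).
have E : conv (star f) f = rc (fun x => complex.Re (conv (star f) f x)).
  by apply/funext => x; have [->|[y ->]] := Fx x.
split => //.
- split; last 2 first.
  + by rewrite -E.
  + by move=> x nx; rewrite -[LHS](congr1 (@^~ x) E) F1.
  by have [/continuous_ReIm[]] := CF.
- by move=> x; have [->|[y ->]] := Fx x => //=; exact: sqr_ge0.
- move=> M fM x; have M0 : 0 <= M by apply: le_trans (fM x); exact: nrm_ge0.
  have [->|[y ->]] := Fx x => /=; first exact: sqr_ge0.
  by rewrite ler_pXn2r// nnegrE ?nrm_ge0.
Qed.

Lemma weight_dominate v : unit_weight v -> exists e, [/\ unit_weight e,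
  forall x, 0 <= e x <= 1 & forall x, v x <> 0 -> e x = 1].
Proof.
move=> [cv Cv v1]; have [||||e [we e01 eK _]] := @unit_bump (supp (rc v)) setT.
- exact: Cc_compact.
- apply: supp_closed; first exact: (closed_gunits HG).
  by move=> x /v1.
- exact: openT.
- by [].
exists e; split => // x vx; apply: eK; apply: contrapT => /suppN[].
exact: vx.
Qed.

Lemma weight_scale (k : R) e : unit_weight e -> unit_weight (fun x => k * e x).
Proof.
move=> [ce Ce e1]; have E : rc (fun x => k * e x) = fun x => k%:C%C * rc e x.
  by apply/funext => x; rewrite rmorphM.
split; first by move=> x; apply: cvgM; [exact: cvg_cst | exact: ce].
  by rewrite E; exact: CcZ.
by rewrite E => x /e1 ->; rewrite mulr0.
Qed.

(** [f^* f] is a weight bounded by [M^2], hence dominated by [M^2 e] for a bump [e] of norm at most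
    1; the C*-identity gives the bound for [f]. *)
Lemma iota_bisection_le f U M : Cc f -> bisection G U -> supp f `<=` U -> 0 <= M ->
  (forall x, nrm (f x) <= M) -> nrm (iota f) <= M.
Proof.
move=> Cf bU fU M0 fM; have [v [wv vE v0 vM]] := unitfun_conv_weight Cf bU fU.
have [e [we e01 ev]] := weight_dominate wv.
rewrite -(@ler_pXn2r _ 2)// ?nnegrE ?nrm_ge0// -nrm_iota_conv// vE.
apply: le_trans (iota_weight_le wv (weight_scale (M ^+ 2) we) _) _ => [x|].
  rewrite ger0_norm//; have [->|vx] := pselect (v x = 0).
    by rewrite mulr_ge0 ?sqr_ge0//; have /andP[] := e01 x.
  by rewrite ev// mulr1; exact: vM.
have [_ Ce _] := we.
rewrite (_ : rc _ = fun x => (M ^+ 2)%:C%C * rc e x); last first.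
  by apply/funext => x; rewrite rmorphM.
rewrite iotaZ// nrmZ nrm_real ger0_norm ?sqr_ge0// ler_piMr ?sqr_ge0//.
exact: iota_weight_le1.
Qed.

(** Continuity of [iota] for uniform convergence with supports in a fixed compact set. It makes the
    functionals in the Fourier interchange bounded and the remainder of the soft threshold small. *)
Lemma iota_compact_le (K : set T) : compact K -> exists2 C, 0 <= C &
  forall f M, Cc f -> supp f `<=` K -> 0 <= M -> (forall x, nrm (f x) <= M) ->
    nrm (iota f) <= C * M.
Proof.
move=> cK; apply: (bisection_bound HG (Q := fun f C => nrm (iota f) <= C) (B := 1)) => //.
- by rewrite iota0 nrm0.
- by move=> f1 f2 C1 C2 Cf1 Cf2 h1 h2; rewrite iotaD// (le_trans (nrmD _ _))// lerD.
- by move=> f U M; rewrite mul1r; exact: iota_bisection_le.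
Qed.

End EnvelopingNorm.

(** * Positive functionals and their GNS seminorms *)

Lemma conjcM (R : realType) (x y : R[i]) : (x * y)^*%C = x^*%C * y^*%C.
Proof. exact: rmorphM. Qed.

(** Cauchy-Schwarz for the expansion of <x + k y, x + k y>, with [al] = <x,x>, [be] = <x,y>, [be'] =
    <y,x>, [de] = <y,y>. The values [k = 1] and [k = i] give the symmetry, and [k = - t be^*] with
    real [t] leaves a real quadratic polynomial in [t]. *)
Lemma form_CS (R : realType) (al de : R) (be be' : R[i]) : 0 <= al -> 0 <= de ->
  (forall k : R[i], 0 <= al%:C%C + k * be + k^*%C * be' +
     (nrm (k : Cplx R) ^+ 2 * de)%:C%C) ->
  be' = be^*%C /\ nrm (be : Cplx R) ^+ 2 <= al * de.
Proof.
move=> al0 de0 H; have E : be' = be^*%C.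
  have := H 1; have := H 'i%C; case: be be' {H} => a b [c d].
  rewrite !lecE/= => /andP[/eqP h1 _] /andP[/eqP h2 _].
  by apply/eqP; rewrite eq_complex/=; apply/andP; split; apply/eqP; lra.
split => //; set n := nrm _ ^+ 2.
have n0 : 0 <= n by exact: sqr_ge0.
have Q t : 0 <= al - 2 * t * n + t ^+ 2 * n * de.
  have := Re_ge0 (H (- t%:C%C * be^*%C)).
  rewrite nrmM nrmN nrm_real nrm_conj exprMn real_normK ?num_real// -/n.
  rewrite E /n nrm_sqr; case: (be) => a b /=.
  by move=> h; apply: le_trans h _; rewrite le_eqVlt; apply/orP; left; apply/eqP; ring.
have [de1|de1] := eqVneq de 0.
  have [->|n1] := eqVneq n 0; first by rewrite mulr_ge0.
  have := Q ((al + 1) / n); rewrite de1 mulr0 addr0.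
  have -> : 2 * ((al + 1) / n) * n = 2 * (al + 1) by field.
  by move=> h; lra.
have := Q (de^-1).
have -> : al - 2 * de^-1 * n + de^-1 ^+ 2 * n * de = (al * de - n) / de by field.
by rewrite pmulr_lge0 ?invr_gt0 ?lt0r ?de1// subr_ge0.
Qed.

Section GNS.
Context {R : realType} {T : topologicalType} (G : groupoid T).
Hypothesis HG : lch_etale G.
Let hT := lch_hausdorff HG.
Let lcT := lch_locally_compact HG.
Implicit Types (f b : T -> Cplx R) (u e w : T -> R) (g h : T).
Local Notation conv := (convolution G).
Local Notation star := (involution G).
Local Notation rc := (fun (e : T -> R) (x : T) => (e x)%:C%C : Cplx R).
Local Notation r := (grng G).
Local Notation s := (gsrc G).

Record positive_functional (phi : (T -> Cplx R) -> Cplx R) : Prop := {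
  pf_lin : forall (k : Cplx R) f1 f2, Cc f1 -> Cc f2 ->
    phi (fun g => k * f1 g + f2 g) = k * phi f1 + phi f2;
  pf_pos : forall f, Cc f -> (0 : R[i]) <= phi (conv (star f) f);
  pf_bound : forall e, unit_weight G e -> (forall x, 0 <= e x <= 1) ->
    complex.Re (phi (rc e)) <= 1 }.

(** A weight equal to 1 on the ranges of the support of [f] acts as a left unit on [f]. *)
Lemma local_unit_l f : Cc f -> exists e, [/\ unit_weight G e,
  forall x, 0 <= e x <= 1 & conv (rc e) f = f].
Proof.
move=> Cf; have [||||e [we e01 eK _]] := @unit_bump R T G HG (r @` supp f) setT.
- apply: continuous_compact; last exact: Cc_compact.
  by apply: continuous_subspaceT => x; exact: (continuous_grng HG).
- by move=> _ [x _ <-]; exact: units_rng.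
- exact: openT.
- by [].
exists e; split => //; have [_ _ e1] := we; rewrite conv_unitl//.
apply/funext => g; have [fg|/suppN ->] := pselect (supp f g); last by rewrite mulr0.
by rewrite eK ?mul1r//; exists g.
Qed.

Lemma local_unit_r f : Cc f -> exists e, [/\ unit_weight G e,
  forall x, 0 <= e x <= 1 & conv f (rc e) = f].
Proof.
move=> Cf; have [||||e [we e01 eK _]] := @unit_bump R T G HG (s @` supp f) setT.
- apply: continuous_compact; last exact: Cc_compact.
  by apply: continuous_subspaceT => x; exact: (continuous_gsrc HG).
- by move=> _ [x _ <-]; exact: units_src.
- exact: openT.
- by [].
exists e; split => //; have [_ _ e1] := we; rewrite conv_unitr//.
apply/funext => g; have [fg|/suppN ->] := pselect (supp f g); last by rewrite mul0r.
by rewrite eK ?mulr1//; exists g.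
Qed.

Lemma unit_weight_star e : unit_weight G e -> star (rc e) = rc e.
Proof.
move=> [_ _ e1]; rewrite (unitfun_star e1); apply/funext => g.
by rewrite conjc_real.
Qed.

(** The arguments [k^-1] and [k^-1 g] of each term have the same range [s k], so the two factors [w]
    meet as a square: multiplication by a real function of the range is symmetric, whether or not
    [w] has compact support. *)
Lemma star_conv_weight w b : conv (star (fun g => (w (r g))%:C%C * b g))
    (fun g => (w (r g))%:C%C * b g) =
  conv (star b) (fun g => (w (r g) ^+ 2)%:C%C * b g).
Proof.
apply/funext => g; apply: eq_fsbigr => k; rewrite inE/= => kg.
rewrite !involutionE !grng_inv grng_mul ?gsrc_inv// grng_inv conjcM conjc_real.
by rewrite expr2 rmorphM/=; ring.
Qed.

Section Functional.
Variable phi : (T -> Cplx R) -> Cplx R.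
Hypothesis pphi : positive_functional phi.

Definition gns_norm f : R := Num.sqrt (complex.Re (phi (conv (star f) f))).
Local Notation N := gns_norm.

Lemma gns_norm_ge0 f : 0 <= N f. Proof. exact: sqrtr_ge0. Qed.

Lemma gns_normE f : Cc f -> phi (conv (star f) f) = (N f ^+ 2)%:C%C.
Proof.
move=> Cf; have p := pf_pos pphi Cf; rewrite sqr_sqrtr; first exact: Re_geE.
exact: Re_ge0.
Qed.

Lemma pfD f1 f2 : Cc f1 -> Cc f2 -> phi (f1 \+ f2) = phi f1 + phi f2.
Proof.
move=> C1 C2; rewrite -[phi f1]mul1r -(pf_lin pphi)//; congr phi.
by apply/funext => x; rewrite mul1r.
Qed.

Lemma pf0 : phi (fun=> 0) = 0.
Proof.
have := pfD (Cc0 hT) (Cc0 hT); rewrite (_ : _ \+ _ = fun=> 0); last first.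
  by apply/funext => x /=; rewrite addr0.
by move=> /eqP; rewrite addrC -subr_eq subrr eq_sym => /eqP.
Qed.

Lemma pfZ (k : Cplx R) f : Cc f -> phi (fun g => k * f g) = k * phi f.
Proof.
move=> Cf; rewrite -[RHS]addr0 -pf0 -(pf_lin pphi)//; last exact: (Cc0 hT).
by congr phi; apply/funext => x; rewrite addr0.
Qed.

Lemma pf_expand (k : Cplx R) f1 f2 : Cc f1 -> Cc f2 ->
  phi (conv (star (fun g => k * f2 g + f1 g)) (fun g => k * f2 g + f1 g)) =
  (N f1 ^+ 2)%:C%C + k * phi (conv (star f1) f2) + k^*%C * phi (conv (star f2) f1) +
  (nrm k ^+ 2 * N f2 ^+ 2)%:C%C.
Proof.
move=> C1 C2; have S1 := Cc_star HG C1; have S2 := Cc_star HG C2.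
have C11 := Cc_conv HG S1 C1; have C12 := Cc_conv HG S1 C2.
have C21 := Cc_conv HG S2 C1; have C22 := Cc_conv HG S2 C2.
have -> : conv (star (fun g => k * f2 g + f1 g)) (fun g => k * f2 g + f1 g) =
    fun g => k * conv (star f1) f2 g + (k^*%C * conv (star f2) f1 g +
      (k^*%C * k * conv (star f2) f2 g + conv (star f1) f1 g)).
  rewrite star_lin -[fun g => k * f2 g + f1 g]/((fun g => k * f2 g) \+ f1).
  rewrite -[X in conv X]/((fun g => k^*%C * star f2 g) \+ star f1).
  rewrite (convDl HG)//; last exact: (CcZ hT).
  rewrite !(convDr HG)//; last exact: (CcZ hT).
  by rewrite !convZl !convZr; apply/funext => g /=; ring.
rewrite (pf_lin pphi)//; last by do 2 apply: (Cc_lin hT) => //.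
rewrite (pf_lin pphi)//; last exact: (Cc_lin hT).
rewrite (pf_lin pphi)// !gns_normE// conj_mul_nrm !rmorphM.
by ring.
Qed.

Lemma pf_CS f1 f2 : Cc f1 -> Cc f2 ->
  phi (conv (star f2) f1) = (phi (conv (star f1) f2) : R[i])^*%C /\
  nrm (phi (conv (star f1) f2)) <= N f1 * N f2.
Proof.
move=> C1 C2; have [||k|-> h] := @form_CS R (N f1 ^+ 2) (N f2 ^+ 2)
    (phi (conv (star f1) f2)) (phi (conv (star f2) f1)).
- exact: sqr_ge0.
- exact: sqr_ge0.
- by rewrite -pf_expand//; apply: (pf_pos pphi); exact: (Cc_lin hT).
split => //; rewrite -(@ler_pXn2r _ 2)// ?nnegrE ?nrm_ge0//.
  by rewrite exprMn.
by rewrite mulr_ge0 ?gns_norm_ge0.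
Qed.

Lemma gns_normZ (k : Cplx R) f : Cc f -> N (fun g => k * f g) = nrm k * N f.
Proof.
move=> Cf; rewrite /gns_norm.
have -> : conv (star (fun g => k * f g)) (fun g => k * f g) =
    fun g => k^*%C * k * conv (star f) f g.
  have -> : star (fun g => k * f g) = fun g => k^*%C * star f g.
    by apply/funext => g; rewrite !involutionE rmorphM.
  by rewrite convZl convZr; apply/funext => g; rewrite mulrA.
rewrite pfZ; last by apply: (Cc_conv HG) => //; exact: (Cc_star HG).
rewrite gns_normE// conj_mul_nrm -rmorphM/= sqrtrM ?sqr_ge0// !sqrtr_sqr.
by rewrite !ger0_norm ?nrm_ge0 ?gns_norm_ge0.
Qed.

Lemma gns_normD f1 f2 : Cc f1 -> Cc f2 -> N (f1 \+ f2) <= N f1 + N f2.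
Proof.
move=> C1 C2; have := pf_expand 1 C1 C2.
have -> : (fun g => 1 * f2 g + f1 g) = f1 \+ f2.
  by apply/funext => g; rewrite mul1r addrC.
rewrite gns_normE; last exact: (CcD hT).
have [-> h] := pf_CS C1 C2.
move=> /(congr1 (@complex.Re R)); rewrite conjc1 !mul1r nrm_real normr1 expr1n mul1r.
rewrite !raddfD/= => E; have := Re_nrm (phi (conv (star f1) f2)).
rewrite ler_norml => /andP[_ h2].
rewrite -(@ler_pXn2r _ 2)// ?nnegrE ?addr_ge0 ?gns_norm_ge0//.
by rewrite E; case: (phi _) h2 h {E} => x y /= h2 h; rewrite sqrrD; nra.
Qed.

(** With [v = sqrt (M^2 - w^2)], the squared seminorm of [v f] is [M^2 N(f)^2 - N(w f)^2], and it is
    nonnegative. *)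
Lemma gns_norm_weight w f M : continuous w -> 0 <= M ->
  (forall x, `|w x| <= M) -> Cc f ->
  N (fun g => (w (r g))%:C%C * f g) <= M * N f.
Proof.
move=> cw M0 wM Cf; pose v x := Num.sqrt (M ^+ 2 - w x ^+ 2).
have wv x : 0 <= M ^+ 2 - w x ^+ 2.
  by have := wM x; have := normr_ge0 (w x); rewrite subr_ge0 -(real_normK (num_real (w x))); nra.
have cv : continuous v.
  move=> x; apply: (@continuous_comp _ _ _ (fun x => M ^+ 2 - w x ^+ 2) Num.sqrt).
    apply: cvgB; first exact: cvg_cst.
    by rewrite /=; apply: cvgM; exact: cw.
  exact: sqrt_continuous.
have Cw (u : T -> R) : continuous u -> Cc (fun g => (u (r g))%:C%C * f g).
  move=> cu; apply: (Cc_mul hT) => // x; apply: continuous_real_complex.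
  by apply: (@continuous_comp _ _ _ r u); [exact: (continuous_grng HG) | exact: cu].
have Cw2 : Cc (fun g => (w (r g) ^+ 2)%:C%C * f g).
  by apply: (Cw (fun x => w x ^+ 2)) => x; apply: cvgM; exact: cw.
have := pf_pos pphi (Cw v cv); rewrite star_conv_weight.
have -> : (fun g => (v (r g) ^+ 2)%:C%C * f g) =
    fun g => (-1) * ((w (r g) ^+ 2)%:C%C * f g) + (M ^+ 2)%:C%C * f g.
  by apply/funext => g; rewrite sqr_sqrtr// raddfB/=; ring.
rewrite -[X in conv _ X]/((fun g => (-1) * ((w (r g) ^+ 2)%:C%C * f g)) \+
  (fun g => (M ^+ 2)%:C%C * f g)).
have Sf := Cc_star HG Cf.
rewrite (convDr HG)// !convZr -star_conv_weight pfD; last 2 first.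
- by apply: (CcZ hT); apply: (Cc_conv HG); [apply: (Cc_star HG)|]; exact: Cw.
- by apply: (CcZ hT); exact: (Cc_conv HG).
rewrite !pfZ; last 2 first.
- exact: (Cc_conv HG).
- by apply: (Cc_conv HG); [apply: (Cc_star HG)|]; exact: Cw.
rewrite !gns_normE//; last exact: Cw.
rewrite -rmorphM mulN1r addrC subr_ge0 lecR => h.
rewrite -(@ler_pXn2r _ 2)// ?nnegrE ?mulr_ge0 ?gns_norm_ge0//.
by rewrite exprMn.
Qed.

(** [f^* f] is a weight [v] with values in [[0, M^2]], so [f b] has the same seminorm as
    [sqrt(v) b], to which [gns_norm_weight] applies. *)
Lemma gns_norm_bisection f U M b : Cc f -> bisection G U -> supp f `<=` U ->
  0 <= M -> (forall x, nrm (f x) <= M) -> Cc b -> N (conv f b) <= M * N b.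
Proof.
move=> Cf bU fU M0 fM Cb.
have [v [[cv Cv v1] vE v0 vM]] := unitfun_conv_weight HG Cf bU fU.
have Sf := Cc_star HG Cf; have Sb := Cc_star HG Cb; have Cfb := Cc_conv HG Cf Cb.
have E : conv (star (conv f b)) (conv f b) =
    conv (star b) (fun g => (Num.sqrt (v (r g)) ^+ 2)%:C%C * b g).
  rewrite star_conv -(convA HG)//; congr (conv _ _).
  rewrite (convA HG)// vE conv_unitl//; apply/funext => g.
  by rewrite sqr_sqrtr.
rewrite {1}/gns_norm E -(star_conv_weight (fun x => Num.sqrt (v x))).
apply: (gns_norm_weight (w := fun x => Num.sqrt (v x))) => // x.
  by apply: (@continuous_comp _ _ _ v Num.sqrt); [exact: cv | exact: sqrt_continuous].
by rewrite ger0_norm ?sqrtr_ge0// -(ger0_norm M0) -sqrtr_sqr ler_wsqrtr// vM.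
Qed.

(** The boundedness of left multiplication, which positivity on a bare *-algebra does not provide;
    here it comes from the finite covers by bisections. *)
Lemma gns_conv_bound f : Cc f ->
  exists2 C, 0 <= C & forall b, Cc b -> N (conv f b) <= C * N b.
Proof.
move=> Cf; have [||||C C0 h] := @bisection_bound R T G HG
  (fun f C => forall b, Cc b -> N (conv f b) <= C * N b) 1 (supp f) (Cc_compact Cf).
- by [].
- move=> b Cb; rewrite mul0r conv0l /gns_norm.
  have -> : conv (star (fun _ : T => 0 : Cplx R)) (fun=> 0) = (fun _ => 0).
    by apply/funext => g; apply: fsbig1 => k _; rewrite mulr0.
  by rewrite pf0 sqrtr0.
- move=> f1 f2 C1 C2 Cf1 Cf2 h1 h2 b Cb; rewrite (convDl HG)//.
  apply: le_trans (gns_normD (Cc_conv HG Cf1 Cb) (Cc_conv HG Cf2 Cb)) _.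
  by rewrite mulrDl; apply: lerD; [exact: h1 | exact: h2].
- move=> f1 U M Cf1 bU fU M0 fM b Cb; rewrite mul1r.
  exact: gns_norm_bisection fU M0 fM Cb.
have [M [M0 fM]] := Cc_bounded Cf.
exists (C * M); first by rewrite mulr_ge0// ltW.
exact: h (ltW M0) fM.
Qed.

(* The operator norm of [f] in the GNS representation of [phi]; [inf] of the
   empty set, which does not occur for [f] in [Cc], is [0]. *)
Definition gns_op f : R :=
  inf [set C | 0 <= C /\ forall b, Cc b -> N (conv f b) <= C * N b].

Lemma gns_op_ge0 f : 0 <= gns_op f.
Proof.
have [[C Cin]|n] := pselect ([set C | 0 <= C /\ forall b, Cc b -> N (conv f b) <= C * N b] !=set0).
  by apply: lb_le_inf; [exists C|move=> x []].
by rewrite /gns_op (_ : [set C | _] = set0) ?inf0//; apply/seteqP; split => // C h; apply: n; exists C.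
Qed.

Lemma gns_op_le f C : 0 <= C -> (forall b, Cc b -> N (conv f b) <= C * N b) ->
  gns_op f <= C.
Proof. by move=> C0 h; apply: ge_inf => //; exists 0 => x []. Qed.

Lemma gns_opP f b : Cc f -> Cc b -> N (conv f b) <= gns_op f * N b.
Proof.
move=> Cf Cb; have [C C0 hC] := gns_conv_bound Cf.
have [b0|b0] := eqVneq (N b) 0.
  by have := hC _ Cb; rewrite b0 !mulr0.
have bp : 0 < N b by rewrite lt0r b0 gns_norm_ge0.
rewrite -ler_pdivrMr//; apply: lb_le_inf; first by exists C.
by move=> x [x0 hx]; rewrite ler_pdivrMr//; exact: hx.
Qed.

(** Cauchy-Schwarz for the left side written as <b, f^* f b>. *)
Lemma gns_norm_sqr_conv f b : Cc f -> Cc b ->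
  N (conv f b) ^+ 2 <= N b * N (conv (star f) (conv f b)).
Proof.
move=> Cf Cb; have Sf := Cc_star HG Cf; have Sb := Cc_star HG Cb.
have Cfb := Cc_conv HG Cf Cb; have Cffb := Cc_conv HG Sf Cfb.
have [_ h] := pf_CS Cb Cffb; apply: le_trans h.
rewrite (convA HG Sb Sf Cfb) -star_conv gns_normE// nrm_real ger0_norm ?sqr_ge0//.
Qed.

Lemma gns_opM f1 f2 : Cc f1 -> Cc f2 ->
  gns_op (conv f1 f2) <= gns_op f1 * gns_op f2.
Proof.
move=> C1 C2; apply: gns_op_le => [|b Cb]; first by rewrite mulr_ge0 ?gns_op_ge0.
rewrite -(convA HG)//; apply: le_trans (gns_opP C1 (Cc_conv HG C2 Cb)) _.
by rewrite -mulrA ler_wpM2l ?gns_op_ge0//; exact: gns_opP.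
Qed.

Lemma gns_op_star f : Cc f -> gns_op (star f) = gns_op f.
Proof.
have h f' : Cc f' -> gns_op f' <= gns_op (star f').
  move=> Cf; have Sf := Cc_star HG Cf.
  apply: gns_op_le => [|b Cb]; first exact: gns_op_ge0.
  have := gns_norm_sqr_conv Cf Cb; have := gns_opP Sf (Cc_conv HG Cf Cb).
  have := gns_norm_ge0 b; have := gns_norm_ge0 (conv f' b).
  have := gns_op_ge0 (star f').
  set x := N (conv f' b); set y := N b; set o := gns_op _; set z := N _.
  move=> o0 x0 y0 h1 h2; have h3 : x * x <= x * (o * y) by rewrite -expr2; nra.
  have [x1|x1] := eqVneq x 0; first by rewrite x1 mulr_ge0.
  by move: h3; rewrite ler_pM2l// lt0r x1.
move=> Cf; apply/eqP; rewrite eq_le h// andbT -{2}(starK G f) h//.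
exact: (Cc_star HG).
Qed.

Lemma gns_op_seminorm : cstar_seminorm G (fun f => (gns_op f)%:C%C).
Proof.
have O f : 0 <= gns_op f by exact: gns_op_ge0.
split.
- by move=> f _; rewrite ler0c.
- move=> f1 f2 C1 C2; rewrite -rmorphD lecR; apply: gns_op_le => [|b Cb].
    by rewrite addr_ge0.
  rewrite (convDl HG)//; apply: le_trans (gns_normD (Cc_conv HG C1 Cb) (Cc_conv HG C2 Cb)) _.
  by rewrite mulrDl; apply: lerD; exact: gns_opP.
- have le (k : R[i]) f : Cc f -> gns_op (fun g => (k : Cplx R) * f g) <= nrm (k : Cplx R) * gns_op f.
    move=> Cf; apply: gns_op_le => [|b Cb]; first by rewrite mulr_ge0 ?nrm_ge0.
    rewrite convZl gns_normZ; last exact: (Cc_conv HG).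
    by rewrite -mulrA ler_wpM2l ?nrm_ge0//; exact: gns_opP.
  move=> k f Cf; rewrite (normE (k : Cplx R)) -rmorphM; congr (_%:C%C).
  apply/eqP; rewrite eq_le le//=; have [->|k0] := eqVneq k 0; first by rewrite nrm0 mul0r.
  have k1 : 0 < nrm (k : Cplx R).
    by rewrite lt0r nrm_ge0 andbT; apply: contra k0 => /eqP/nrm_eq0 ->.
  have := @le k^-1 (fun g => (k : Cplx R) * f g) (CcZ hT _ Cf).
  have -> : (fun g => (k^-1 : Cplx R) * ((k : Cplx R) * f g)) = f.
    by apply/funext => g; rewrite mulrA mulVf// mul1r.
  have -> : nrm (k^-1 : Cplx R) = (nrm (k : Cplx R))^-1.
    apply: (mulIf (lt0r_neq0 k1)); rewrite mulVf ?lt0r_neq0// -nrmM mulVf//.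
    by rewrite (nrm_real 1) normr1.
  by rewrite mulrC ler_pdivlMr// mulrC.
- by move=> f1 f2 C1 C2; rewrite -rmorphM lecR; exact: gns_opM.
- move=> f Cf; rewrite -rmorphXn/=; congr (_%:C%C); have Sf := Cc_star HG Cf.
  apply/eqP; rewrite eq_le; apply/andP; split.
    by rewrite expr2 -{1}(gns_op_star Cf); exact: gns_opM.
  (* Written as a square, so that the estimate of [N (f b)^2] can be turned into a bound on the
     operator seminorm of [f]. *)
  have -> : gns_op (conv (star f) f) = Num.sqrt (gns_op (conv (star f) f)) ^+ 2.
    by rewrite sqr_sqrtr.
  rewrite ler_pXn2r ?nnegrE ?sqrtr_ge0//; apply: gns_op_le => [|b Cb].
    exact: sqrtr_ge0.
  rewrite -(@ler_pXn2r _ 2)// ?nnegrE ?mulr_ge0 ?sqrtr_ge0 ?gns_norm_ge0//.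
  rewrite exprMn [X in _ <= X * _]sqr_sqrtr//.
  apply: le_trans (gns_norm_sqr_conv Cf Cb) _.
  rewrite mulrC expr2 mulrA ler_wpM2r ?gns_norm_ge0// (convA HG)//.
  by apply: gns_opP => //; exact: (Cc_conv HG).
Qed.

Lemma gns_norm_weight_le1 e : unit_weight G e -> (forall x, 0 <= e x <= 1) ->
  N (rc e) <= 1.
Proof.
move=> we e01; have [ce Ce e1] := we; rewrite -(sqrtr1 R) ler_wsqrtr//.
rewrite unitfun_conv_star//.
have -> : (fun g => (nrm (rc e g) ^+ 2)%:C%C : Cplx R) = rc (fun x => e x * e x).
  by apply/funext => g; rewrite nrm_real real_normK ?num_real.
apply: (pf_bound pphi); last by move=> x; have /andP[? ?] := e01 x; apply/andP; split; nra.
split; first by move=> x; apply: cvgM; exact: ce.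
  rewrite (_ : rc _ = fun x => rc e x * rc e x); last by apply/funext => x; rewrite rmorphM.
  by apply: (Cc_mul hT) => //; case: Ce.
by move=> x /e1 [ex]; rewrite ex mul0r.
Qed.

(** With local units [e] on the left and [e'] on the right, phi(f) = <e, f e'>. They act as an
    approximate cyclic vector, their GNS seminorms being at most 1. *)
Lemma pf_le_gns_op f : Cc f -> nrm (phi f) <= gns_op f.
Proof.
move=> Cf; have [e [we e01 ef]] := local_unit_l Cf.
have [e' [we' e01' fe]] := local_unit_r Cf.
have [_ Ce _] := we; have [_ Ce' _] := we'.
have := (pf_CS Ce (Cc_conv HG Cf Ce')).2.
rewrite (unit_weight_star we) fe ef => h; apply: le_trans h _.
have h1 := gns_norm_weight_le1 we e01; have h2 := gns_norm_weight_le1 we' e01'.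
have h3 := gns_opP Cf Ce'; rewrite fe in h3.
have z0 := gns_norm_ge0 (rc e); have y0 := gns_norm_ge0 (rc e').
have x0 := gns_norm_ge0 f; have o0 := gns_op_ge0 f.
apply: (@le_trans _ _ (N f)); first by rewrite ler_piMl.
by apply: le_trans h3 _; rewrite ler_piMr.
Qed.

Lemma pf_le_iota (A : cstarAlgebra R) (iota : (T -> Cplx R) -> A) f :
  is_groupoid_cstar G iota -> Cc f -> nrm (phi f) <= nrm (iota f).
Proof.
move=> [_ _ _ _ maxA] Cf; apply: le_trans (pf_le_gns_op Cf) _.
by rewrite -lecR -normE; apply: maxA gns_op_seminorm _ Cf.
Qed.

End Functional.
End GNS.

(** * Small constants and linear functionals on a C*-algebra *)

Lemma ler_addgt1 (R : realType) (x y C : R) :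
  (forall e, 0 < e -> e < 1 -> x <= y + C * e) -> x <= y.
Proof.
move=> h; apply/ler_addgt0Pr => e e0.
pose d := Num.min 2^-1 (e / (`|C| + 1)).
have C1 : 0 < `|C| + 1 by rewrite ltr_wpDl.
have d0 : 0 < d by rewrite lt_min invr_gt0 ltr0n/= divr_gt0.
have d1 : d < 1 by rewrite gt_min; apply/orP; left; rewrite invf_lt1// ltr1n.
apply: le_trans (h _ d0 d1) _; rewrite lerD2l.
apply: (@le_trans _ _ ((`|C| + 1) * d)).
  by rewrite ler_pM2r// (le_trans (ler_norm _))// lerDl.
by rewrite mulrC -ler_pdivlMr// ge_min lexx orbT.
Qed.

Lemma nrm_small (R : realType) (V : normedModType R[i]) (z : V) (C : R) :
  (forall e : R, 0 < e -> e < 1 -> nrm z <= C * e) -> z = 0.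
Proof.
move=> h; apply: nrm_eq0; apply/eqP; rewrite eq_le nrm_ge0 andbT.
by apply: (@ler_addgt1 _ _ _ C) => e e0 e1; rewrite add0r; exact: h.
Qed.

Section LinearFunctionals.
Context {R : realType} (A : cstarAlgebra R).
Implicit Types (phi : A -> Cplx R) (a b x : A).

Lemma lin_add phi : linear phi -> {morph phi : x y / x + y}.
Proof. by move=> lp x y; have := lp 1 x y; rewrite !scale1r. Qed.

Lemma lin_scale phi (k : R[i]) a : linear phi -> phi (k *: a) = (k : Cplx R) * phi a.
Proof.
move=> lp; have p0 : phi 0 = 0.
  by have := lin_add lp 0 0; rewrite addr0 => /eqP; rewrite -subr_eq subrr eq_sym => /eqP.
by have := lp k a 0; rewrite !addr0 p0 addr0.
Qed.

Lemma lin_sub phi a b : linear phi -> phi (a - b) = phi a - phi b.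
Proof. by move=> lp; rewrite -scaleN1r lin_add// lin_scale// mulN1r. Qed.

Lemma cstarB a b : cstar (a - b) = cstar a - cstar b.
Proof. by rewrite cstarD -scaleN1r cstarZ rmorphN rmorph1 scaleN1r. Qed.

Lemma cmulBl a b x : cmul (a - b) x = cmul a x - cmul b x.
Proof. by rewrite cmulDl -scaleN1r cmulZl scaleN1r. Qed.

Lemma cmulBr a b x : cmul x (a - b) = cmul x a - cmul x b.
Proof. by rewrite cmulDr -scaleN1r cmulZr scaleN1r. Qed.

Lemma nrm_cstar_mulB a b :
  nrm (cmul (cstar a) a - cmul (cstar b) b) <= nrm (a - b) * (nrm a + nrm b).
Proof.
have -> : cmul (cstar a) a - cmul (cstar b) b =
    cmul (cstar a) (a - b) + cmul (cstar (a - b)) b.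
  by rewrite cstarB cmulBl cmulBr addrA subrK.
apply: le_trans (nrmD _ _) _.
have := nrm_cmul (cstar a) (a - b); have := nrm_cmul (cstar (a - b)) b.
by rewrite !nrm_cstar; lra.
Qed.

Lemma state_le phi a : state phi -> nrm (phi a) <= nrm a.
Proof. by move=> [_ _ h _]; have := h a; rewrite !normE lecR. Qed.

Lemma positive_CS phi a b : linear phi ->
  (forall a, (0 : R[i]) <= phi (cmul (cstar a) a)) ->
  nrm (phi (cmul (cstar a) b)) ^+ 2 <=
    complex.Re (phi (cmul (cstar a) a)) * complex.Re (phi (cmul (cstar b) b)).
Proof.
move=> lp pos; have [||k|//] := @form_CS R (complex.Re (phi (cmul (cstar a) a)))
  (complex.Re (phi (cmul (cstar b) b)))
  (phi (cmul (cstar a) b)) (phi (cmul (cstar b) a)).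
- exact: Re_ge0.
- exact: Re_ge0.
have := pos (a + k *: b).
rewrite cstarD cstarZ !cmulDl !cmulDr !cmulZl !cmulZr scalerA !lin_add// !lin_scale//.
rewrite conjE rmorphM/= -(conj_mul_nrm k) -!Re_geE//.
by rewrite -!addrA.
Qed.

End LinearFunctionals.

(** * Extension of functionals and states from C_c(G) *)

Section Extension.
Context {R : realType} {T : topologicalType} (G : groupoid T).
Hypothesis HG : lch_etale G.
Context (A : cstarAlgebra R) (iota : (T -> Cplx R) -> A).
Hypothesis HA : is_groupoid_cstar G iota.
Let hT := lch_hausdorff HG.
Let lcT := lch_locally_compact HG.
Implicit Types (f b : T -> Cplx R) (u e w : T -> R) (g h : T).
Local Notation conv := (convolution G).
Local Notation star := (involution G).
Local Notation rc := (fun (e : T -> R) (x : T) => (e x)%:C%C : Cplx R).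

Lemma iota_dense (a : A) (e : R) : 0 < e -> exists2 f, Cc f & nrm (a - iota f) < e.
Proof.
move=> e0; have [_ _ _ d _] := HA.
have [||x [/= nb [f Cf fx]]] := d (ball a e%:C%C).
- by exists a; apply: ballxx; rewrite ltcR.
- exact: ball_open.
by exists f => //; rewrite fx; move: nb; rewrite -ball_normE/= normE ltcR.
Qed.

Lemma iotaB f1 f2 : Cc f1 -> Cc f2 -> iota (f1 \- f2) = iota f1 - iota f2.
Proof.
move=> C1 C2; rewrite addrC -scaleN1r -(iota_lin HA)//; congr iota.
by apply/funext => x /=; rewrite mulN1r addrC.
Qed.

Lemma functional_ext (p q : A -> Cplx R) (K : R) : linear p -> linear q ->
  (forall a, nrm (p a) <= K * nrm a) -> (forall a, nrm (q a) <= K * nrm a) ->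
  (forall f, Cc f -> p (iota f) = q (iota f)) -> p = q.
Proof.
move=> lp lq hp hq E; apply/funext => a; apply/eqP; rewrite -subr_eq0; apply/eqP.
have K0 : 0 <= `|K| by [].
apply: (@nrm_small _ _ _ (2 * `|K|)) => e e0 _; have [f Cf fe] := iota_dense a e0.
have -> : p a - q a = p (a - iota f) - q (a - iota f).
  by rewrite !lin_sub// E// opprB addrA subrK.
apply: le_trans (nrmD _ _) _; rewrite nrmN.
have KK : K <= `|K| by exact: ler_norm.
have := hp (a - iota f); have := hq (a - iota f); have := nrm_ge0 (a - iota f).
by nra.
Qed.

Section Extend.
Variable phi0 : (T -> Cplx R) -> Cplx R.
Hypothesis phi0_lin : forall (k : Cplx R) f1 f2, Cc f1 -> Cc f2 ->
    phi0 (fun g => k * f1 g + f2 g) = k * phi0 f1 + phi0 f2.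
Hypothesis phi0_le : forall f, Cc f -> nrm (phi0 f) <= nrm (iota f).

(** McShane's formula for extending the 1-Lipschitz function [Re phi0] from the dense image of
    [iota]; the supremum spares a choice of approximating sequences. By [phi0_le] the value [phi0 f]
    depends on [iota f] only. *)
Let S (a : A) := [set x | exists2 f, Cc f & x = complex.Re (phi0 f) - nrm (a - iota f)].
Let rho a := sup (S a).

Let phi0B f1 f2 : Cc f1 -> Cc f2 -> phi0 (f1 \- f2) = phi0 f1 - phi0 f2.
Proof.
move=> C1 C2; rewrite addrC -mulN1r -phi0_lin//; congr phi0.
by apply/funext => x /=; rewrite mulN1r addrC.
Qed.

Let S_ub a f : Cc f -> ubound (S a) (complex.Re (phi0 f) + nrm (a - iota f)).
Proof.
move=> Cf _ [f' Cf' ->].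
have Cff : Cc (f' \- f).
  have -> : f' \- f = fun g => (-1 : Cplx R) * f g + f' g.
    by apply/funext => g /=; rewrite mulN1r addrC.
  exact: (Cc_lin hT).
have := phi0_le Cff; rewrite phi0B// iotaB// => h.
have := Re_nrm (phi0 f' - phi0 f); rewrite raddfB/= ler_norml => /andP[_ h'].
have := nrmD (iota f' - a) (a - iota f); rewrite addrA subrK (nrmB (iota f') a).
by lra.
Qed.

Let S_sup a : has_sup (S a).
Proof.
split; first by exists (complex.Re (phi0 (fun=> 0)) - nrm (a - iota (fun=> 0))); exists (fun=> 0) => //; exact: (Cc0 hT).
by exists (complex.Re (phi0 (fun=> 0)) + nrm (a - iota (fun=> 0))); apply: S_ub; exact: (Cc0 hT).
Qed.

Let rho_near a f : Cc f -> `|rho a - complex.Re (phi0 f)| <= nrm (a - iota f).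
Proof.
move=> Cf; rewrite ler_norml lerBlDr lerBrDr -[X in _ && X]/(rho a <= _).
apply/andP; split.
  rewrite addrC; apply: sup_upper_bound; first exact: S_sup.
  by exists f.
rewrite addrC; apply: ge_sup; first by case: (S_sup a).
exact: S_ub.
Qed.

(** A complex linear functional is recovered from its real part, since Im z = - Re (i z). *)
Let ext a : Cplx R := (rho a -i* rho ('i%C *: a))%C.

Let ext_near a f : Cc f -> nrm (ext a - phi0 f) <= 2 * nrm (a - iota f).
Proof.
move=> Cf; apply: le_trans (nrm_ReIm _) _; rewrite !raddfB/=.
have h1 := rho_near a Cf.
have Cif : Cc (fun g => ('i%C : Cplx R) * f g) by exact: (CcZ hT).
have := rho_near ('i%C *: a) Cif; rewrite (iotaZ HG HA)//.
have -> : phi0 (fun g => ('i%C : Cplx R) * f g) = 'i%C * phi0 f.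
  have p0 : phi0 (fun=> 0) = 0.
    have E := phi0B (Cc0 hT) (Cc0 hT); rewrite subrr in E; rewrite -[RHS]E.
    by congr phi0; apply/funext => x /=; rewrite subrr.
  rewrite -[RHS]addr0 -p0 -phi0_lin//; last exact: (Cc0 hT).
  by congr phi0; apply/funext => x; rewrite addr0.
rewrite -scalerBr nrmZ.
have -> : nrm ('i%C : Cplx R) = 1.
  by rewrite /nrm normc_def/= expr0n expr1n add0r sqrtr1.
rewrite mul1r => h2; have E : complex.Re ('i%C * phi0 f) = - complex.Im (phi0 f).
  by rewrite mulrC ReiNIm.
rewrite E opprK in h2; rewrite mulrDl mul1r; apply: lerD => //.
by rewrite -opprD normrN.
Qed.

Lemma functional_extension : exists phi : A -> Cplx R,
  [/\ linear phi, forall a, nrm (phi a) <= nrm a &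
      forall f, Cc f -> phi (iota f) = phi0 f].
Proof.
exists ext; split.
- move=> k a b; apply/eqP; rewrite -subr_eq0; apply/eqP.
  apply: (@nrm_small _ _ _ (4 * nrm (k : Cplx R) + 4)) => e e0 _.
  have [f Cf fe] := iota_dense a e0; have [f' Cf' fe'] := iota_dense b e0.
  have Ck : Cc (fun g => (k : Cplx R) * f g + f' g) by exact: (Cc_lin hT).
  have h1 := ext_near (k *: a + b) Ck; have h2 := ext_near a Cf.
  have h3 := ext_near b Cf'; rewrite phi0_lin// (iota_lin HA)// in h1.
  have -> : ext (k *: a + b) - (k *: ext a + ext b) =
      (ext (k *: a + b) - (k * phi0 f + phi0 f')) -
      (k *: (ext a - phi0 f) + (ext b - phi0 f')).
    by rewrite -[k *: (ext a - phi0 f)]/((k : Cplx R) * (ext a - phi0 f)) -[k *: ext a]/((k : Cplx R) * ext a); ring.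
  have E : k *: a + b - (k *: iota f + iota f') = k *: (a - iota f) + (b - iota f').
    by rewrite scalerBr opprD addrACA.
  rewrite E in h1; have h4 := nrmD (k *: (a - iota f)) (b - iota f').
  rewrite nrmZ in h4; apply: le_trans (nrmD _ _) _; rewrite nrmN.
  have h5 := nrmD (k *: (ext a - phi0 f)) (ext b - phi0 f'); rewrite nrmZ in h5.
  have k0 := nrm_ge0 (k : Cplx R); move: h1 h2 h3 h4 h5 fe fe' k0.
  move: (nrm (ext (k *: a + b) - _)) (nrm (k *: (a - iota f) + _)) => x1 x2.
  move: (nrm (k *: (ext a - _) + _)) (nrm (ext a - _)) (nrm (ext b - _)) => x3 x4 x5.
  move: (nrm (a - _)) (nrm (b - _)) (nrm k) => y1 y2 n.
  move=> h1 h2 h3 h4 h5 fe fe' n0.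
  have : n * x4 <= n * (2 * e) by rewrite ler_wpM2l//; lra.
  have : n * y1 <= n * e by rewrite ler_wpM2l//; lra.
  by lra.
- move=> a; apply: (@ler_addgt1 _ _ _ 3) => e e0 _.
  have [f Cf fe] := iota_dense a e0; have h1 := ext_near a Cf.
  have h2 := phi0_le Cf; have := nrmD (ext a - phi0 f) (phi0 f).
  have := nrmD (iota f - a) a; rewrite !subrK (nrmB (iota f)); lra.
- move=> f Cf; have := ext_near (iota f) Cf; rewrite subrr nrm0 mulr0 => h.
  apply/eqP; rewrite -subr_eq0; apply/eqP/nrm_eq0/eqP.
  by rewrite eq_le h nrm_ge0.
Qed.

End Extend.

(** phi(a^* a) is a limit of the nonnegative values phi0(f^* f), hence real and nonnegative. The
    second hypothesis supplies the norm-one clause of [state], because bumps have norm at most 1. *)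
Lemma state_extension (phi0 : (T -> Cplx R) -> Cplx R) : positive_functional G phi0 ->
  (forall d : R, 0 < d -> exists e, [/\ unit_weight G e, forall x, 0 <= e x <= 1 &
     1 - d < complex.Re (phi0 (rc e))]) ->
  exists phi : A -> Cplx R, state phi /\ forall f, Cc f -> phi (iota f) = phi0 f.
Proof.
move=> pp sup1; have [phi [lp cp phiE]] := functional_extension (pf_lin pp)
  (fun f Cf => pf_le_iota HG pp HA Cf).
exists phi; split => //; split => //.
- move=> a; set z := phi _.
  have zn (e : R) : 0 < e -> e < 1 -> exists2 w : R, 0 <= w & nrm (z - w%:C%C) <= (2 * nrm a + 1) * e.
    move=> e0 e1; have [f Cf fe] := iota_dense a e0.
    have P := pf_pos pp Cf; exists (complex.Re (phi0 (conv (star f) f))).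
      exact: Re_ge0.
    rewrite -Re_geE// -phiE; last by apply: (Cc_conv HG) => //; exact: (Cc_star HG).
    rewrite (iotaM HA)//; last exact: (Cc_star HG).
    rewrite (iota_star HA)// /z -lin_sub//; apply: le_trans (cp _) _.
    apply: le_trans (nrm_cstar_mulB _ _) _; have := nrmD (iota f - a) a.
    by rewrite subrK (nrmB (iota f)); have := nrm_ge0 a; have := nrm_ge0 (a - iota f); nra.
  rewrite lecE/=; apply/andP; split.
    rewrite -normr_le0.
    apply: (@ler_addgt1 _ _ _ (2 * nrm a + 1)) => e e0 e1; rewrite add0r.
    have [w w0 zw] := zn e e0 e1; apply: le_trans zw.
    by have := Im_nrm (z - w%:C%C); rewrite raddfB/= subr0.
  apply: (@ler_addgt1 _ _ _ (2 * nrm a + 1)) => e e0 e1.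
  have [w w0 zw] := zn e e0 e1.
  have := Re_nrm (z - w%:C%C); rewrite raddfB/= ler_norml => /andP[h _].
  by lra.
- by move=> a; rewrite !normE lecR; exact: cp.
- move=> d d0; have [e [we e01 ed]] := sup1 _ d0; have [_ Ce _] := we.
  exists (iota (rc e)); split.
    by rewrite normE -[1]/(1%:C%C) lecR; exact: (iota_weight_le1 HG HA).
  suff : (1 - d)%:C%C < `|phi (iota (rc e)) : Cplx R| by [].
  rewrite normE ltcR phiE//; apply: lt_le_trans ed _.
  exact: le_trans (ler_norm _) (Re_nrm _).
Qed.

Lemma state_pf (phi : A -> Cplx R) : state phi ->
  positive_functional G (phi \o iota).
Proof.
move=> sp; have [lp pos _ _] := sp; split.
- by move=> k f1 f2 C1 C2 /=; rewrite (iota_lin HA)// lp.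
- move=> f Cf /=; rewrite (iotaM HA)//; last exact: (Cc_star HG).
  by rewrite (iota_star HA).
- move=> e we e01; apply: le_trans (iota_weight_le1 HG HA we e01).
  apply: le_trans (state_le _ sp); exact: le_trans (ler_norm _) (Re_nrm _).
Qed.

(** Take [f] near an almost norming element and a bump [e] with [e f = f]. Cauchy-Schwarz bounds
    |phi(f)| by [N(e) N(f)], where [N(f)] is at most about 1 and [N(e)^2 = phi(e^2) <= phi(e)]. *)
Lemma state_unit_sup (phi : A -> Cplx R) (d : R) : state phi -> 0 < d ->
  exists e, [/\ unit_weight G e, forall x, 0 <= e x <= 1 &
     1 - d < complex.Re (phi (iota (rc e)))].
Proof.
move=> sp d0; have [lp pos _ sup1] := sp.
(* The estimates lead to [N(e) > 1 - 4 d'], whose square costs at most [8 d' <= d]. *)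
pose d' := Num.min (2^-1) (d / 8); have d'0 : 0 < d' by rewrite lt_min invr_gt0 ltr0n divr_gt0.
have d'1 : d' <= 2^-1 by rewrite ge_min lexx.
have d'd : d' <= d / 8 by rewrite ge_min lexx orbT.
have [a [a1 pa0]] := sup1 _ d'0; rewrite normE -[1]/(1%:C%C) lecR in a1.
have pa : 1 - d' < nrm (phi a) by rewrite -ltcR -normE.
have [f Cf fa] := iota_dense a d'0.
have [e [we e01 ef]] := local_unit_l HG Cf; have [ce Ce e1] := we.
exists e; split => //.
have pp := state_pf sp.
have h := (pf_CS HG pp Ce Cf).2; rewrite (unit_weight_star we) ef /= in h.
set Ne := gns_norm _ _ _ in h.
have NeE : Ne ^+ 2 <= complex.Re (phi (iota (rc e))).
  have Cee : Cc (rc (fun x => e x ^+ 2)).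
    rewrite (_ : rc _ = fun x => rc e x * rc e x); last by apply/funext => x; rewrite rmorphM.
    by apply: (Cc_mul hT) => //; case: Ce.
  have := congr1 (@complex.Re R) (gns_normE pp Ce); rewrite -/Ne unitfun_conv_star//=.
  have -> : (fun g => (nrm (rc e g) ^+ 2)%:C%C : Cplx R) = rc (fun x => e x ^+ 2).
    by apply/funext => g; rewrite nrm_real real_normK ?num_real.
  (* phi(e - e^2) is nonnegative because [e - e^2] is [w^* w]. *)
  move=> <-; pose w x := Num.sqrt (e x - e x ^+ 2).
  have ww x : 0 <= e x - e x ^+ 2 by have /andP[? ?] := e01 x; nra.
  have cw : continuous w.
    move=> x; apply: (@continuous_comp _ _ _ (fun x => e x - e x ^+ 2) Num.sqrt).
      by apply: cvgB; [exact: ce | rewrite /=; apply: cvgM; exact: ce].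
    exact: sqrt_continuous.
  have w1 : unitfun G (rc w) by move=> x /e1[ex]; rewrite /w ex expr0n subrr sqrtr0.
  have Cw : Cc (rc w).
    apply: (Cc_intro hT (K := supp (rc e))); last 2 first.
    + exact: Cc_compact.
    + by move=> x /suppN[ex]; rewrite /w ex expr0n subrr sqrtr0.
    + by move=> x; exact/continuous_real_complex/cw.
  have := Re_ge0 (pf_pos pp Cw); rewrite unitfun_conv_star//=.
  have -> : (fun g => (nrm (rc w g) ^+ 2)%:C%C : Cplx R) =
      fun g => (-1) * rc (fun x => e x ^+ 2) g + rc e g.
    by apply/funext => g; rewrite nrm_real real_normK ?num_real// sqr_sqrtr// raddfB/=; ring.
  rewrite (iota_lin HA)// lp raddfD/= scaleN1r raddfN/=; lra.
have Nf : gns_norm G (phi \o iota) f <= nrm (iota f).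
  rewrite -(@ler_pXn2r _ 2)// ?nnegrE ?nrm_ge0 ?gns_norm_ge0//.
  have := congr1 (@complex.Re R) (gns_normE pp Cf) => /= <-.
  rewrite -(nrm_iota_conv HG HA Cf); apply: le_trans (state_le _ sp).
  exact: le_trans (ler_norm _) (Re_nrm _).
have Ne0 : 0 <= Ne by exact: gns_norm_ge0.
have i1 : nrm (iota f) <= 1 + d'.
  by have := nrmD (iota f - a) a; rewrite subrK (nrmB (iota f)); lra.
have i2 : 1 - 2 * d' < nrm (phi (iota f)).
  have := nrmD (phi (a - iota f)) (phi (iota f)); have := state_le (a - iota f) sp.
  by rewrite lin_sub// subrK => ? ?; lra.
have Ne1 : 1 - 2 * d' < Ne * (1 + d').
  by apply: lt_le_trans i2 _; apply: le_trans h _; rewrite ler_wpM2l// (le_trans Nf).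
apply: lt_le_trans NeE; have : 1 - 4 * d' < Ne by nra.
nra.
Qed.

End Extension.

(** * Closed subspaces *)

Section SubspaceTopology.
Context {X : topologicalType} (S : set X).

Lemma nbhs_setP (x : S) (B : set S) :
  nbhs x B <-> exists2 W, nbhs (val x) W & val @^-1` W `<=` B.
Proof.
split=> [[_ [[W oW <-] /= Wx] WB]|[W + WB]].
  by exists W => //; apply: open_nbhs_nbhs; split.
move=> Wx; have h : nbhs x (val @^-1` W) by exact: (@initial_continuous S X set_val x).
exact: filterS WB h.
Qed.

Lemma continuous_val : continuous (val : S -> X).
Proof. exact: initial_continuous. Qed.

Lemma continuous_to_set (Y : topologicalType) (f : Y -> S) (y : Y) :
  {for y, continuous (val \o f)} -> {for y, continuous f}.
Proof.
move=> cf B /nbhs_setP[W Wf WB].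
by have := cf _ Wf; rewrite /nbhs/= /nbhs/=; apply: filterS => z; exact: WB.
Qed.

Lemma hausdorff_set : hausdorff_space X -> hausdorff_space S.
Proof.
move=> hX p q pq; apply: val_inj; apply: hX => A B Ap Bq.
have [||z [Az Bz]] := pq (val @^-1` A) (val @^-1` B).
- by apply/nbhs_setP; exists A.
- by apply/nbhs_setP; exists B.
by exists (val z).
Qed.

Lemma compact_preimage_val (K : set X) : closed S -> compact K ->
  compact (val @^-1` K : set S).
Proof.
move=> cS cK F PF FK; have FKS : F (val @^-1` (K `&` S)).
  by apply: filterS FK => z Kz; split => //; exact: set_valP.
have [x [[Kx Sx] clx]] := @compact_closedI _ _ _ cK cS (val @ F) _ FKS.
have xE : val (exist _ x (mem_set Sx) : S) = x by [].
exists (exist _ x (mem_set Sx)); split => // A B FA /nbhs_setP[W Wx WB].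
have FA' : F (val @^-1` (val @` A)) by apply: filterS FA => a Aa; exists a.
have [z [[a Aa az] Wz]] := clx (val @` A) W FA' Wx.
by exists a; split => //; apply: WB; rewrite /= az.
Qed.

Lemma locally_compact_set : closed S -> locally_compact [set: X] ->
  locally_compact [set: S].
Proof.
move=> cS lX x _; have [U + [cU clU]] := lX (val x) I.
rewrite withinET => Ux; exists (val @^-1` U).
  by rewrite withinET; apply/nbhs_setP; exists U.
split; first exact: compact_preimage_val.
by apply: ((continuous_closedP _).1 continuous_val).
Qed.

End SubspaceTopology.

(** * Reduction of the groupoid to a closed set of units *)

Section ReductionFacts.
Context {T : topologicalType} (G : groupoid T).
Hypothesis HG : lch_etale G.
Variable Z : set T.
Hypotheses (cZ : closed Z) (Z1 : Z `<=` gunits G).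
Local Notation S := (reduction_set G Z).
Local Notation GZ := (reduction G Z).
Local Notation r := (grng G).
Local Notation s := (gsrc G).

Lemma closed_reduction_set : closed S.
Proof.
apply: closedI; first exact: ((continuous_closedP _).1 (continuous_grng HG)).
exact: ((continuous_closedP _).1 (continuous_gsrc HG)).
Qed.

Lemma reduction_lch_etale : etale GZ -> lch_etale GZ.
Proof.
move=> eGZ; split => //.
- exact/hausdorff_set/(lch_hausdorff HG).
- apply: locally_compact_set; [exact: closed_reduction_set|exact: (lch_locally_compact HG)].
- split.
    move=> x; apply: continuous_to_set.
    rewrite (_ : val \o _ = ginv G \o val); last by apply/funext => y /=; rewrite val_red_inv.
    by apply: continuous_comp; [exact: continuous_val | exact: (continuous_ginv HG)].
  apply/subspace_continuousP => -[x y] xy B /nbhs_setP[W Wxy WB].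
  have xy' := red_composable xy.
  have [_ /subspace_continuousP cm] := lch_topological HG.
  rewrite val_red_mul// in Wxy.
  have := cm (val x, val y) xy' _ Wxy.
  rewrite /nbhs/= /within/= => -[[P Q] /= [Px Qy] PQ].
  exists (val @^-1` P, val @^-1` Q) => /=.
    by split; [apply/nbhs_setP; exists P | apply/nbhs_setP; exists Q].
  move=> [u v] /= [Pu Qv] uv; apply: WB => /=; rewrite val_red_mul//.
  by apply: (PQ (val u, val v)) => //; exact: red_composable.
Qed.

(** The interior of the set of arrows that have both or neither of their ends in [Z]. Functions
    supported here are compatible with restriction to the reduction. *)
Definition good_set : set T :=
  \bigcup_(U in [set U | open U /\ forall u, U u -> Z (r u) <-> Z (s u)]) U.

Lemma open_good_set : open good_set.
Proof. by apply: bigcup_open => U []. Qed.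

Lemma good_setP u : good_set u -> Z (r u) <-> Z (s u).
Proof. by move=> [U [_ h] Uu]; exact: h. Qed.

Definition to_reduction (x : T) (Sx : S x) : S := exist _ x (mem_set Sx).

(** As the reduction is étale, the ranges of its arrows in a bisection [U] form a relatively open
    set, cut out by [V1]. If [u] in [U] has its range in [V1] and in [Z], this range is that of an
    arrow of the reduction in [U], and injectivity of [r] on [U] makes this arrow equal to [u]. The
    same holds for sources with [V2]. *)
Lemma reduction_set_good : etale GZ -> S `<=` good_set.
Proof.
move=> eGZ; have HGZ := reduction_lch_etale eGZ.
move=> g Sg; have [U [bU Ug _]] := bisection_nbhs HG (@filterT _ (nbhs g) _).
have [oU i1 i2] := bU.
have oU' : open (val @^-1` U : set S) by exact: ((continuousP _).1 (@continuous_val _ S)).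
have [V1 oV1 V1E] := open_grng HGZ oU'.
have [V2 oV2 V2E] := open_gsrc HGZ oU'.
have g1 : V1 (r g).
  suff : (set_val @^-1` V1) (grng GZ (to_reduction Sg)) by rewrite /= set_valE/= val_red_rng.
  by rewrite V1E; exists (to_reduction Sg).
have g2 : V2 (s g).
  suff : (set_val @^-1` V2) (gsrc GZ (to_reduction Sg)) by rewrite /= set_valE/= val_red_src.
  by rewrite V2E; exists (to_reduction Sg).
exists (U `&` (r @^-1` V1) `&` (s @^-1` V2)); last by [].
split.
  apply: openI; last exact: ((continuousP _).1 (continuous_gsrc HG)).
  by apply: openI => //; exact: ((continuousP _).1 (continuous_grng HG)).
move=> u [[Uu V1u] V2u]; split=> Zu.
  have Su : S (r u) by rewrite /reduction_set/= grng_rng gsrc_rng.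
  have : (set_val @^-1` V1) (to_reduction Su) by [].
  rewrite V1E => -[k Uk /(congr1 val)]; rewrite val_red_rng/= => ku.
  by rewrite -(i1 _ _ Uk Uu ku); have [] := redP k.
have Su : S (s u) by rewrite /reduction_set/= grng_src gsrc_src.
have : (set_val @^-1` V2) (to_reduction Su) by [].
rewrite V2E => -[k Uk /(congr1 val)]; rewrite val_red_src/= => ku.
by rewrite -(i2 _ _ Uk Uu ku); have [] := redP k.
Qed.

Section Functions.
Context {R : realType}.
Implicit Types (f : T -> Cplx R) (h : S -> Cplx R).
Let hT := lch_hausdorff HG.
Let lcT := lch_locally_compact HG.
Local Notation rc := (fun (e : T -> R) (x : T) => (e x)%:C%C : Cplx R).

Lemma Cc_restrict f : Cc f -> Cc (f \o (val : S -> T)).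
Proof.
move=> Cf; apply: (Cc_intro (hausdorff_set (S := S) hT) (K := val @^-1` supp f)).
- by move=> x; apply: continuous_comp; [exact: continuous_val|have [+ _] := Cf; exact].
- by apply: compact_preimage_val closed_reduction_set _; exact: Cc_compact.
- by move=> x n; exact: (@suppN _ _ f).
Qed.

Lemma real_extension (a : S -> R) (K : set S) : continuous a -> compact K ->
  (forall x, ~ K x -> a x = 0) ->
  exists b : T -> R, continuous b /\ forall x : S, b (val x) = a x.
Proof.
move=> ca cK aK; pose F : T -> R := valL_ 0 a.
have Fa (x : S) : F (val x) = a x.
  exact: (congr1 (@^~ x) (@valLK _ _ 0 S a)).
have cF : {within S, continuous F} by apply/subspace_valL_continuousP'.
have cK' : compact (val @` K).
  by apply: continuous_compact => //; apply/continuous_subspaceT/continuous_val.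
have [|b [cb bF]] := tietze_compact_support hT lcT closed_reduction_set cK' cF.
  move=> x Sx nK; rewrite -[x]/(val (to_reduction Sx)) Fa aK// => Kx.
  by apply: nK; exists (to_reduction Sx).
exists b; split => // x; rewrite bF ?Fa//; exact: redP.
Qed.

(** Tietze gives a continuous extension, and a bump around the support of [h] cuts it down to
    compact support inside [O]. With [O] the set [good_set], the extension satisfies the hypothesis
    of [star_conv_restrict]. *)
Lemma Cc_extension h (O : set T) : Cc h -> open O -> S `<=` O ->
  exists f, [/\ Cc f, f \o val = h & supp f `<=` O].
Proof.
move=> Ch oO SO; have [/continuous_ReIm[c1 c2] cK] := Ch.
have h0 x : ~ supp h x -> h x = 0 by exact: suppN.
have [|b1 [cb1 b1E]] := real_extension c1 cK; first by move=> x /h0 ->.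
have [|b2 [cb2 b2E]] := real_extension c2 cK; first by move=> x /h0 ->.
have cK' : compact (val @` supp h).
  by apply: continuous_compact => //; apply/continuous_subspaceT/continuous_val.
have [|e [ce e01 [V [oV KV Ve]] eO ceK]] := bump_exists hT lcT R cK' oO.
  by move=> _ [x _ <-]; apply: SO; exact: redP.
pose b x : Cplx R := (b1 x +i* b2 x)%C.
have cb : continuous b by apply/continuous_ReIm.
have Ce := Cc_real hT ce ceK.
exists (fun x => b x * rc e x); split.
- exact: (Cc_mul hT).
- apply/funext => x /=; have -> : b (val x) = h x.
    by rewrite /b b1E b2E; case: (h x).
  have [hx|/h0 ->] := pselect (supp h x); last by rewrite mul0r.
  by rewrite Ve ?mulr1//; apply: KV; exists x.
- apply: subset_trans eO; apply: closureS => x /=; apply: contra_neq => ->.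
  by rewrite mulr0.
Qed.

Lemma star_restrict f : involution G f \o val = involution GZ (f \o val).
Proof. by apply/funext => g /=; rewrite !involutionE /= val_red_inv. Qed.

(** The sum over [G] has the additional terms with [s k] outside [Z]; the hypothesis on [f1] kills
    exactly these. *)
Lemma conv_restrict f1 f2 : (forall k, f1 k != 0 -> Z (r k) -> Z (s k)) ->
  convolution G f1 f2 \o val = convolution GZ (f1 \o val) (f2 \o val).
Proof.
move=> f1Z; apply/funext => g /=; rewrite /convolution.
have zg := redP g.
have <- : \sum_(h \in val @` range_fiber GZ (grng GZ g)) (f1 h * f2 (gmul G (ginv G h) (val g)))
    = \sum_(h \in range_fiber G (r (val g))) (f1 h * f2 (gmul G (ginv G h) (val g))).
  apply: fsbig_widen.
    move=> _ [k kg <-]; move: kg => /(congr1 val).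
    by rewrite !val_red_rng.
  move=> k [kg nk] /=; have [->|fk] := eqVneq (f1 k) 0; first by rewrite mul0r.
  case: nk; have Zr : Z (r k) by rewrite kg; case: zg.
  exists (to_reduction (conj Zr (f1Z _ fk Zr))) => //.
  by apply: val_inj; rewrite /= !val_red_rng.
rewrite fsbig_image; last by move=> x y _ _; exact: val_inj.
apply: eq_fsbigr => k; rewrite inE => kg /=.
have kg' : red_src (red_inv k) = red_rng g by rewrite red_src_inv; exact: kg.
by rewrite (val_red_mul kg') val_red_inv.
Qed.

Lemma star_conv_restrict f : (forall k, f k != 0 -> Z (s k) -> Z (r k)) ->
  convolution G (involution G f) f \o val =
  convolution GZ (involution GZ (f \o val)) (f \o val).
Proof.
move=> fZ; rewrite -star_restrict; apply: conv_restrict => k.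
rewrite involutionE conjc_eq0 => /fZ.
by rewrite grng_inv gsrc_inv.
Qed.

Lemma unit_reduction (x : S) : gunits GZ x <-> gunits G (val x).
Proof.
rewrite /gunits/=; split=> [/(congr1 val)|E]; first by rewrite val_red_rng.
by apply: val_inj; rewrite val_red_rng.
Qed.

Lemma unit_weight_restrict (e : T -> R) : unit_weight G e ->
  unit_weight GZ (e \o val).
Proof.
move=> [ce Ce e1]; split.
- by move=> x; apply: continuous_comp; [exact: continuous_val|exact: ce].
- exact: (Cc_restrict Ce).
- by move=> x nx; apply: e1 => x1; apply: nx; apply/unit_reduction.
Qed.

Lemma unit_weight_extension (e : S -> R) : unit_weight GZ e ->
  (forall x, 0 <= e x <= 1) -> exists e', [/\ unit_weight G e',
    forall x, 0 <= e' x <= 1 & e' \o val = e].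
Proof.
move=> [ce Ce e1] e01.
have e0 x : ~ supp (fun x => (e x)%:C%C : Cplx R) x -> e x = 0 by move=> /suppN[].
have [b [cb bE]] := real_extension ce (Cc_compact Ce) e0.
have cK' : compact (val @` supp (fun x => (e x)%:C%C : Cplx R)).
  apply: continuous_compact; last exact: Cc_compact.
  exact/continuous_subspaceT/continuous_val.
have sub1 : supp (fun x => (e x)%:C%C : Cplx R) `<=` gunits GZ.
  apply: supp_closed => [|x n]; last exact: e1.
  rewrite (_ : gunits GZ = val @^-1` (gunits G)).
    by apply: ((continuous_closedP _).1 (@continuous_val _ S)); exact: (closed_gunits HG).
  by apply/seteqP; split => x /unit_reduction.
have [|||w [[cw Cw w1] w01 wK _]] := @unit_bump R T G HG _ setT cK'.
- by move=> _ [x /sub1 x1 <-]; apply/unit_reduction.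
- exact: openT.
- by [].
(* The Tietze extension [b] may leave [[0, 1]] and may be nonzero off the unit space; the clamp
   repairs the first and the factor [w] the second. *)
pose cut x := Num.max 0 (Num.min 1 (b x)).
have cut01 x : 0 <= cut x <= 1.
  by rewrite le_max lexx/= ge_max ler01 ge_min lexx.
exists (fun x => cut x * w x); split.
- split.
  + move=> x; apply: cvgM; last exact: cw.
    apply: (@continuous_max _ _ (fun=> 0) (fun x => Num.min 1 (b x)) x); first exact: cst_continuous.
    by apply: (@continuous_min _ _ (fun=> 1) b x); [exact: cst_continuous|exact: cb].
  + apply: (Cc_intro hT (K := supp (rc w))); last 2 first.
    * exact: Cc_compact.
    * by move=> x /suppN[wx]; rewrite wx mulr0.
    move=> x; apply: (@continuous_real_complex _ _ (fun x => cut x * w x)).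
    apply: cvgM; last exact: cw.
    apply: (@continuous_max _ _ (fun=> 0) (fun x => Num.min 1 (b x)) x); first exact: cst_continuous.
    by apply: (@continuous_min _ _ (fun=> 1) b x); [exact: cst_continuous|exact: cb].
  + by move=> x /w1[wx]; rewrite wx mulr0.
- by move=> x; have /andP[? ?] := cut01 x; have /andP[? ?] := w01 x; apply/andP; split; nra.
- apply/funext => x /=; have /andP[h0 h1] := e01 x.
  rewrite /cut bE (min_idPr h1) (max_idPr h0).
  have [ex|/e0 ->] := pselect (supp (fun x => (e x)%:C%C : Cplx R) x); last by rewrite mul0r.
  by rewrite wK ?mulr1//; exists x.
Qed.

End Functions.
End ReductionFacts.

(** [r] is open, so the ranges of the arrows with [c > 0] form an open set. *)
Lemma closed_boundary_set (R : realType) (T : topologicalType) (G : groupoid T)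
    (c : T -> R) : lch_etale G -> continuous c -> closed (boundary_set G c).
Proof.
move=> HG cc; rewrite (_ : boundary_set G c =
    gunits G `&` ~` (grng G @` (c @^-1` [set t | 0 < t]))).
  apply: closedI; first exact: (closed_gunits HG).
  apply: open_closedC; apply: (open_grng HG).
  by apply: ((continuousP _).1 cc); exact: open_gt.
apply/seteqP; split=> x [x1 h]; split => //.
  by move=> [g /= cg gx]; have := h g gx; rewrite leNgt cg.
by move=> g gx; rewrite leNgt; apply/negP => cg; apply: h; exists g.
Qed.

(** * Positivity of restriction to the reduction *)

Section ReductionPositive.
Context {R : realType} {T : topologicalType} (G : groupoid T).
Hypothesis HG : lch_etale G.
Variable Z : set T.
Hypotheses (cZ : closed Z) (Z1 : Z `<=` gunits G).
Hypothesis eGZ : etale (reduction G Z).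
Local Notation S := (reduction_set G Z).
Local Notation GZ := (reduction G Z).
Local Notation r := (grng G).
Local Notation s := (gsrc G).
Local Notation "g ∘ h" := (gmul G g h) (at level 40, left associativity).
Local Notation inv := (ginv G).
Local Notation conv := (convolution G).
Local Notation star := (involution G).
Local Notation rc := (fun (e : T -> R) (x : T) => (e x)%:C%C : Cplx R).
Implicit Types (f : T -> Cplx R) (w : T -> R).
Let hT := lch_hausdorff HG.
Let lcT := lch_locally_compact HG.

Lemma bisection_inv U : bisection G U -> bisection G (inv @` U).
Proof.
move=> [oU i1 i2]; split.
- rewrite (_ : inv @` U = inv @^-1` U).
    exact: ((continuousP _).1 (continuous_ginv HG)).
  apply/seteqP; split=> [_ [u Uu <-]|x Ux] /=; first by rewrite ginvK.
  by exists (inv x) => //; rewrite ginvK.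
- by move=> _ _ [u Uu <-] [v Uv <-]; rewrite !grng_inv => /(i2 _ _ Uu Uv) ->.
- by move=> _ _ [u Uu <-] [v Uv <-]; rewrite !gsrc_inv => /(i1 _ _ Uu Uv) ->.
Qed.

Lemma star_conv_weightl w f1 f2 :
  conv (star (fun g => (w (r g))%:C%C * f1 g)) f2 =
  conv (star f1) (fun g => (w (r g))%:C%C * f2 g).
Proof.
apply/funext => g; apply: eq_fsbigr => k; rewrite inE/= => kg.
rewrite !involutionE !grng_inv grng_mul ?gsrc_inv// grng_inv conjcM conjc_real.
by ring.
Qed.

Section Tube.
Variable K : set T.
Hypotheses (cK : compact K) (KZ : forall k, K k -> Z (s k)).

(** If [m] and [k] in [K] have the same range, [m^-1 k] has both ends in [Z] and lies in the open
    [good_set], hence so does [h^-1 k'] for nearby composable pairs. If the ranges differ, the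
    Hausdorff property keeps them apart nearby. Compactness of [K] makes the neighbourhood of [m]
    uniform in [k]. *)
Lemma tube m : K m -> exists U, [/\ bisection G U, U m &
  forall h k, U h -> K k -> r h = r k -> good_set G Z (inv h ∘ k)].
Proof.
move=> Km; have /compact_near_coveringP cK' := cK.
have H k : K k -> \forall k' \near k & h \near m, r h = r k' -> good_set G Z (inv h ∘ k').
  move=> Kk; have [mk|mk] := pselect (r m = r k).
    have comp : s (inv m) = r k by rewrite gsrc_inv.
    have gk : good_set G Z (inv m ∘ k).
      apply: (reduction_set_good HG cZ eGZ); split.
        by rewrite grng_mul// grng_inv; exact: KZ.
      by rewrite gsrc_mul//; exact: KZ.
    have [_ /subspace_continuousP cm] := lch_topological HG.
    have := cm (inv m, k) comp _ (open_nbhs_nbhs (conj (@open_good_set _ G Z) gk)).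
    rewrite /nbhs/= /within/= => -[[P Q] /= [Pm Qk] PQ].
    exists (Q, inv @^-1` P) => /=; first by split => //; exact: (continuous_ginv HG).
    move=> [k' h] /= [Qk' Ph] hk.
    by apply: (PQ (inv h, k')) => //; rewrite /composable/= gsrc_inv.
  move: hT; rewrite open_hausdorff => /(_ (r m) (r k)) [|[A B] /= [Am Bk] [oA oB AB]].
    exact/eqP.
  exists (r @^-1` B, r @^-1` A) => /=.
    by split; apply: (continuous_grng HG); apply: open_nbhs_nbhs; split=> //; exact: set_mem.
  move=> [k' h] /= [Bk' Ah] E; have : (A `&` B) (r h) by split => //; rewrite E.
  by rewrite (eqP AB).
have N := cK' _ (nbhs m) (fun h k' => r h = r k' -> good_set G Z (inv h ∘ k')) _ H.
have [U [bU Um UN]] := bisection_nbhs HG (N (nbhs_filter m)).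
by exists U; split => // h k /UN /= + Kk; apply.
Qed.

(* A pair [(chi, v)] consists of a bump [chi] on a small bisection and of the
   weight [v = chi * chi^*] on the unit space. *)
Definition tube_bump (p : (T -> R) * (T -> R)) :=
  [/\ Cc (rc p.1), unit_weight G p.2,
      conv (rc p.1) (star (rc p.1)) = rc p.2,
      (forall x, 0 <= p.2 x) /\ (forall m, p.1 m = 1 -> p.2 (r m) = 1) &
      forall f, (forall k, f k != 0 -> Z (s k) -> K k) ->
        forall k, conv (star (rc p.1)) f k != 0 -> Z (s k) -> Z (r k)].

Lemma tube_bump_exists m : K m ->
  exists p : {p | tube_bump p}, nbhs m [set x | (sval p).1 x = 1].
Proof.
move=> Km; have [U [bU Um tU]] := tube Km; have [oU i1 i2] := bU.
have [|chi [cchi chi01 [V [oV mV Vchi]] chiU chiK]] :=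
  bump_exists hT lcT R (@compact_set1 _ m) oU; first by move=> _ ->.
have Cchi : Cc (rc chi) := Cc_real hT cchi chiK.
have chi0 x : ~ U x -> rc chi x = 0.
  move=> nU; congr (_%:C%C); apply/eqP/negPn/negP => cx; apply: nU; apply: chiU.
  exact: subset_closure.
have schiU : supp (star (rc chi)) `<=` inv @` U.
  move=> x xs; exists (inv x); last by rewrite ginvK.
  apply: chiU; move: x xs; apply: supp_closed.
    by apply: ((continuous_closedP _).1 (continuous_ginv HG)); exact: closed_closure.
  move=> x n; rewrite involutionE; suff -> : chi (inv x) = 0 by rewrite conjc_real.
  by apply/eqP/negPn/negP => cx; apply: n; exact: subset_closure.
(* The lemma describes [f^* f]; taken at [f = chi^*], supported in the inverse bisection, it
   describes [chi chi^*]. *)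
have [v [wv vE v0 _]] := unitfun_conv_weight HG (Cc_star HG Cchi) (bisection_inv bU) schiU.
rewrite starK in vE.
have P : tube_bump (chi, v).
  split => //=.
    split => // m' chim.
    have Um' : U m'.
      by apply: contrapT => /chi0[]; rewrite chim => /eqP; rewrite oner_eq0.
    apply: complexI; rewrite -[LHS](congr1 (@^~ (r m')) vE).
    rewrite (conv_bisection _ _ bU chi0) grng_rng rsecE// involutionE.
    have -> : inv m' ∘ r m' = inv m'.
      by have := gmulg1 G (inv m'); rewrite gsrc_inv.
    by rewrite ginvK chim conjc_real -rmorphM mulr1.
  move=> f fK k nz Zk.
  (* A nonzero term writes [k] as [h (h^-1 k)] with [h^-1] in [U] and [h^-1 k] in [K], both of the
     same range; the tube property then puts [k] in [good_set]. *)
  have [h [hk nzh]] : exists h, r h = r k /\ star (rc chi) h * f (inv h ∘ k) != 0.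
    apply: contrapT => n; move/eqP: nz; apply; apply: fsbig1 => h hk.
    by apply/eqP/negPn/negP => nzh; apply: n; exists h.
  have Uh : U (inv h).
    apply: contrapT => /chi0 E; move/eqP: nzh; apply.
    by rewrite involutionE E conjc0 mul0r.
  have fh : f (inv h ∘ k) != 0 by apply: contra nzh => /eqP ->; rewrite mulr0.
  have comp : s (inv h) = r k by rewrite gsrc_inv.
  have Kh : K (inv h ∘ k) by apply: fK => //; rewrite gsrc_mul.
  have := tU _ _ Uh Kh; rewrite grng_mul// => /(_ erefl).
  rewrite ginvK gmulKV// => gk.
  exact: (good_setP gk).2.
exists (exist _ _ P) => /=.
have := open_nbhs_nbhs (conj oV (mV _ erefl)); apply: filterS => x /Vchi.
exact.
Qed.

End Tube.

(* On [G_Z] the function [f^* f] is the sum of [h^* h] over the restrictions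
   [h] of [chi^* f'], where [chi] runs over finitely many tube bumps and [f']
   is [f] divided by the square root of [\sum chi chi^*] at the range.
   Restriction commutes with the product [h^* h] because [chi^* f'] maps
   arrows that start in [Z] into [Z]. *)
Lemma reduction_positive f psi : positive_functional GZ psi -> Cc f ->
  (0 : R[i]) <= psi (conv (star f) f \o val).
Proof.
move=> ppsi Cf; have HGZ := reduction_lch_etale HG cZ eGZ.
pose K := supp f `&` (s @^-1` Z).
have cK : compact K.
  apply: compact_closedI; first exact: Cc_compact.
  exact: ((continuous_closedP _).1 (continuous_gsrc HG)).
have KZ k : K k -> Z (s k) by case.
have cs (t : seq {p | tube_bump K p}) : continuous (fun x => \sum_(p <- t) (sval p).2 x).
  elim: t => [|p t' ih].
    rewrite (_ : (fun x => _) = fun=> 0); first exact: cst_continuous.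
    by apply/funext => x; rewrite big_nil.
  rewrite (_ : (fun x => _) = fun x => (sval p).2 x + \sum_(p <- t') (sval p).2 x).
    move=> x; apply: cvgD; last exact: ih.
    by case: p => p [? [+ _ _] ? ? ?] /=; exact.
  by apply/funext => x; rewrite big_cons.
(* By induction on [t]: as [v = chi chi^*], the summand [f'^* (v f')] is [h^* h] for
   [h = chi^* f']. *)
have H (f' : T -> Cplx R) (t : seq {p | tube_bump K p}) : Cc f' ->
    (forall k, f' k != 0 -> Z (s k) -> K k) ->
    (0 : R[i]) <= psi (conv (star f')
      (fun g => (\sum_(p <- t) (sval p).2 (r g))%:C%C * f' g) \o val).
  move=> Cf' f'K; have Sf' := Cc_star HG Cf'.
  elim: t => [|p t ih].
    rewrite (_ : _ \o _ = fun=> 0) ?(pf0 HGZ ppsi)//.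
    by apply/funext => x /=; apply: fsbig1 => k _; rewrite big_nil mul0r mulr0.
  have [Cchi wv vE _ chiK] := svalP p; have [cv Cv v1] := wv.
  set chi := (sval p).1 in Cchi vE chiK; set v := (sval p).2 in wv vE cv Cv v1.
  have Schi := Cc_star HG Cchi; have Ch := Cc_conv HG Schi Cf'.
  have E1 : conv (star (conv (star (rc chi)) f')) (conv (star (rc chi)) f') =
      conv (star f') (fun g => (v (r g))%:C%C * f' g).
    rewrite star_conv starK -(convA HG)//; congr (conv _ _).
    by rewrite (convA HG)// vE conv_unitl.
  have -> : conv (star f') (fun g => (\sum_(p <- (p :: t)) (sval p).2 (r g))%:C%C * f' g) \o val =
     (conv (star f') (fun g => (v (r g))%:C%C * f' g) \o (val : S -> T)) \+
     (conv (star f') (fun g => (\sum_(p <- t) (sval p).2 (r g))%:C%C * f' g) \o val).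
    rewrite -[RHS]/((conv (star f') (fun g => (v (r g))%:C%C * f' g) \+
      conv (star f') (fun g => (\sum_(p <- t) (sval p).2 (r g))%:C%C * f' g)) \o val).
    rewrite -(convDr HG)//; congr (conv _ _ \o _); apply/funext => g /=.
    by rewrite big_cons raddfD/= mulrDl.
  rewrite (pfD ppsi); last 2 first.
  - by apply: (Cc_restrict HG) => //; rewrite -E1; apply: (Cc_conv HG) => //; exact: (Cc_star HG).
  - apply: (Cc_restrict HG) => //; apply: (Cc_conv HG) => //.
    apply: (Cc_mul hT) => // x.
    apply: (@continuous_real_complex _ _ (fun g => \sum_(p <- t) (sval p).2 (r g))).
    apply: (@continuous_comp _ _ _ r (fun g => \sum_(p <- t) (sval p).2 g)).
      exact: (continuous_grng HG).
    exact: cs.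
  apply: addr_ge0 => //; rewrite -E1 star_conv_restrict; last exact: chiK.
  apply: (pf_pos ppsi); exact: (Cc_restrict HG).
have [t Kt] := compact_finite_cover cK (tube_bump_exists cK KZ).
pose b x := \sum_(p <- t) (sval p).2 x.
have cb : continuous b by exact: cs.
have v0 (p : {p | tube_bump K p}) x : 0 <= (sval p).2 x.
  by case: p => p [? ? ? [+ _] ?] /=; exact.
have b1 m : K m -> 1 <= b (r m).
  move=> /Kt; rewrite /b; elim: (t) => [|p t' ih]; first by rewrite big_nil.
  rewrite !big_cons => -[pm|/ih h]; last by have := v0 p (r m); lra.
  have -> : (sval p).2 (r m) = 1.
    by case: p pm {ih} => p [? ? ? [_ +] ?] /=; exact.
  by rewrite lerDl; apply: sumr_ge0 => p' _; exact: v0.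
have b0 x : 0 <= b x by apply: sumr_ge0 => p' _; exact: v0.
(* The maximum with 1 keeps [beta] continuous on all of [T]; on the ranges of [K] the sum [b] is at
   least 1, and there [beta^2 b = 1]. *)
pose beta x := (Num.sqrt (Num.max (b x) 1))^-1.
have m1 x : 1 <= Num.max (b x) 1 by rewrite le_max lexx orbT.
have cbeta : continuous beta.
  move=> x; apply: (@continuousV _ _ (fun x => Num.sqrt (Num.max (b x) 1)) x).
    by rewrite gt_eqF// sqrtr_gt0 (lt_le_trans _ (m1 x)).
  apply: (@continuous_comp _ _ _ (fun x => Num.max (b x) 1) Num.sqrt).
    by apply: (@continuous_max _ _ b (fun=> 1)); [exact: cb|exact: cst_continuous].
  exact: sqrt_continuous.
have Cw (u : T -> R) f' : continuous u -> Cc f' -> Cc (fun g => (u (r g))%:C%C * f' g).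
  move=> cu; apply: (Cc_mul hT) => // x; apply: continuous_real_complex.
  by apply: (@continuous_comp _ _ _ r u); [exact: (continuous_grng HG) | exact: cu].
pose f' g := (beta (r g))%:C%C * f g : Cplx R.
have Cf' : Cc f' by exact: Cw.
have Sf' := Cc_star HG Cf'.
have f'K k : f' k != 0 -> Z (s k) -> K k.
  move=> fk Zk; split => //; apply: contrapT => /suppN E.
  by move: fk; rewrite /f' E mulr0 eqxx.
(* The two sides agree after restriction only: at an arrow of the reduction, a nonzero term has
   [k^-1] in the support of [f] with source in [Z], that is, in [K]. *)
have -> : conv (star f) f \o val =
    conv (star f') (fun g => (b (r g))%:C%C * f' g) \o (val : S -> T).
  rewrite [in RHS]/f' star_conv_weightl; apply/funext => x /=.
  apply: eq_fsbigr => k; rewrite inE/= => kx.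
  have [->|fk] := eqVneq (star f k) 0; first by rewrite !mul0r.
  congr (_ * _).
  have Kk : K (inv k).
    split; last by rewrite /= gsrc_inv kx; have [] := redP x.
    apply: contrapT => /suppN E; move: fk; rewrite involutionE E conjc0.
    by rewrite eqxx.
  have := b1 _ Kk; rewrite grng_inv grng_mul ?gsrc_inv// grng_inv => b1k.
  have E : beta (s k) * b (s k) * beta (s k) = 1.
    rewrite /beta (max_idPl b1k); set q := Num.sqrt _.
    have q2 : b (s k) = q * q by rewrite -expr2 sqr_sqrtr.
    have q0 : q != 0 by rewrite gt_eqF// sqrtr_gt0 (lt_le_trans _ b1k).
    by rewrite q2; field.
  by rewrite /f' ?grng_mul ?gsrc_inv// ?grng_inv !mulrA -!rmorphM E mul1r.
exact: H.
Qed.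

End ReductionPositive.

(** * Integrals with a fixed integrable majorant *)

Section DominatedIntegrals.
Context {R : realType}.
Local Notation mu := (@lebesgue_measure R).
Implicit Types (f g : R -> R) (K t x y : R).

(** 1/(1 + t^2), the common majorant of the integrands over the real line. *)
Definition weight t : R := (oneDsqr t)^-1.

Lemma weight_gt0 t : 0 < weight t.
Proof. by rewrite invr_gt0 (lt_le_trans ltr01)// oneDsqr_ge1. Qed.

Lemma weight_le1 t : weight t <= 1. Proof. exact: oneDsqrV_le1. Qed.

Lemma continuous_weight : continuous weight.
Proof. exact: continuous_oneDsqrV. Qed.

Lemma oneDsqr_weight t : (1 + t ^+ 2) * weight t = 1.
Proof. by rewrite /weight /oneDsqr mulfV// gt_eqF// ltr_pwDl// sqr_ge0. Qed.

Lemma integrable_weight : mu.-integrable setT (EFin \o weight).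
Proof.
apply/integrableP; split.
  apply/measurable_EFinP; apply: continuous_measurable_fun.
  exact: continuous_weight.
under eq_integral do rewrite /= ger0_norm ?(ltW (weight_gt0 _))//.
rewrite ge0_symfun_integralT.
- rewrite (_ : [set x | _] = `[0, +oo[%classic); last first.
    by apply/seteqP; split => x/=; rewrite in_itv/= andbT.
  by rewrite integral0y_oneDsqr -EFinM ltry.
- by move=> x; exact/ltW/weight_gt0.
- exact: continuous_weight.
- by move=> x; rewrite /weight /oneDsqr/= sqrrN.
Qed.

Definition weight_mass : R := \int[mu]_t weight t.

Lemma weight_mass_ge0 : 0 <= weight_mass.
Proof. by apply: Rintegral_ge0 => x _; exact/ltW/weight_gt0. Qed.

Definition dominated f K := measurable_fun setT f /\ forall t, `|f t| <= K * weight t.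

Lemma dominated_integrable f K : dominated f K -> mu.-integrable setT (EFin \o f).
Proof.
move=> [mf fK]; apply: (@le_integrable _ _ _ mu _ _ _ (EFin \o (fun t => K * weight t))) => //.
- exact/measurable_EFinP.
- by move=> x _ /=; rewrite lee_fin; apply: le_trans (fK x) (ler_norm _).
exact: (integrableZl _ K integrable_weight).
Qed.

Lemma dominated_le f K : dominated f K -> `|\int[mu]_t f t| <= K * weight_mass.
Proof.
move=> df; have [mf fK] := df.
apply: le_trans (le_normr_Rintegral _ (dominated_integrable df)) _ => //.
rewrite -RintegralZl//; last exact: integrable_weight.
apply: le_Rintegral => //.
- exact: (integrable_abse (dominated_integrable df)).
- exact: (integrableZl _ K integrable_weight).
Qed.

Lemma dominatedZ f K k : dominated f K -> dominated (fun t => k * f t) (`|k| * K).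
Proof.
move=> [mf fK]; split; first by apply: measurable_funM => //; exact: measurable_cst.
by move=> t; rewrite normrM -mulrA ler_wpM2l.
Qed.

(** On [|t| < P] one has [1 <= (1 + P^2) weight t]. *)
Lemma dominated_compact f P M : continuous f -> 0 <= P ->
  (forall y, P <= `|y| -> f y = 0) -> (forall y, `|f y| <= M) ->
  dominated f (M * (1 + P ^+ 2)).
Proof.
move=> cf P0 f0 fM; split; first exact: continuous_measurable_fun.
have M0 : 0 <= M by apply: le_trans (fM 0).
move=> t; have [Pt|tP] := leP P `|t|.
  by rewrite f0// normr0 !mulr_ge0 ?addr_ge0 ?sqr_ge0// ltW ?weight_gt0.
apply: le_trans (fM t) _; rewrite -mulrA ler_peMr// -[leLHS](oneDsqr_weight t).
rewrite ler_pM2r ?weight_gt0// lerD2l -(real_normK (num_real t)).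
by rewrite ler_pXn2r// ?nnegrE// ltW.
Qed.

Lemma continuous_support_bounded f P : continuous f -> 0 <= P ->
  (forall y, P <= `|y| -> f y = 0) -> exists M, forall y, `|f y| <= M.
Proof.
move=> cf P0 f0; have : compact (f @` `[-P, P]).
  apply: continuous_compact; last exact: segment_compact.
  exact: continuous_subspaceT.
move=> /compact_bounded[M [_ MP]]; exists (`|M| + 1) => y.
have M1 : M < `|M| + 1 by rewrite (le_lt_trans (ler_norm M)) // ltrDl.
have [Py|yP] := leP P `|y|; first by rewrite f0// normr0 addr_ge0.
apply: (MP _ M1); exists y => //; rewrite /= in_itv/=.
by move: yP; rewrite ltr_norml => /andP[/ltW -> /ltW ->].
Qed.

Lemma ftc_itv f g (a b : R) : a < b -> (forall y, is_derive y 1 f (g y)) ->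
  continuous g -> \int[mu]_(x in `[a, b]) g x = f b - f a.
Proof.
move=> ab df cg; have cf : continuous f.
  move=> x; apply: differentiable_continuous; apply/derivable1_diffP.
  by have [] := df x.
rewrite /Rintegral (@continuous_FTC2 _ _ f)//.
- exact: continuous_subspaceT.
- split.
  + by move=> x _; have [] := df x.
  + by apply: cvg_at_right_filter; exact: cf.
  + by apply: cvg_at_left_filter; exact: cf.
- by move=> x _; rewrite derive1E; have [] := df x.
Qed.

Lemma Rintegral_support g P : (forall y, P <= `|y| -> g y = 0) ->
  \int[mu]_y g y = \int[mu]_(y in `[-P, P]) g y.
Proof.
move=> g0; rewrite [RHS]Rintegral_mkcond; apply: eq_Rintegral => x _.
rewrite patchE; case: ifPn => //; rewrite notin_setE/= in_itv/= => /negP.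
rewrite -ler_norml -ltNge => /ltW; exact: g0.
Qed.

Lemma ftc_compact f g P : 0 < P -> (forall y, is_derive y 1 f (g y)) ->
  continuous g -> (forall y, P <= `|y| -> f y = 0) ->
  (forall y, P <= `|y| -> g y = 0) -> \int[mu]_y g y = 0.
Proof.
move=> P0 df cg f0 g0; rewrite (Rintegral_support g0) (ftc_itv _ df)//.
  by rewrite (f0 P) ?(f0 (- P)) ?subrr// ?normrN ger0_norm// ltW.
by rewrite gtrN.
Qed.

End DominatedIntegrals.

(** * Complex-valued integrals *)

Section ComplexIntegrals.
Context {R : realType}.
Local Notation mu := (@lebesgue_measure R).
Implicit Types (f g : R -> R[i]) (K t x y : R).

Definition cdominated f K := [/\ measurable_fun setT (fun t => complex.Re (f t)),
  measurable_fun setT (fun t => complex.Im (f t)) &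
  forall t, nrm (f t : Cplx R) <= K * weight t].

Lemma cdominated_Re f K : cdominated f K -> dominated (fun t => complex.Re (f t)) K.
Proof. by move=> [? ? h]; split => // t; exact: le_trans (Re_nrm _) (h t). Qed.

Lemma cdominated_Im f K : cdominated f K -> dominated (fun t => complex.Im (f t)) K.
Proof. by move=> [? ? h]; split => // t; exact: le_trans (Im_nrm _) (h t). Qed.

Lemma cdominated_integrable f K : cdominated f K -> cintegrable f.
Proof.
move=> cf; split.
  exact: (dominated_integrable (cdominated_Re cf)).
exact: (dominated_integrable (cdominated_Im cf)).
Qed.

(** The factor 2 comes from estimating real and imaginary parts separately. *)
Lemma cintegral_le f K : cdominated f K ->
  nrm (cintegral f : Cplx R) <= 2 * K * weight_mass.
Proof.
move=> cf; apply: le_trans (nrm_ReIm _) _.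
have := dominated_le (cdominated_Re cf); have := dominated_le (cdominated_Im cf).
by rewrite /cintegral/=; lra.
Qed.

Lemma cintegralD f g : cintegrable f -> cintegrable g ->
  cintegral (fun t => f t + g t) = cintegral f + cintegral g.
Proof.
move=> [f1 f2] [g1 g2]; apply/eqP; rewrite eq_complex /cintegral/=.
rewrite -!RintegralD//; apply/andP.
by split; apply/eqP; apply: eq_Rintegral => x _; rewrite raddfD.
Qed.

Lemma cintegralZ (k : R[i]) f : cintegrable f ->
  cintegral (fun t => k * f t) = k * cintegral f.
Proof.
move=> [f1 f2]; case: k => a b; apply/eqP; rewrite eq_complex /cintegral/=.
have Z (c : R) (h : R -> R) : mu.-integrable setT (EFin \o h) ->
    mu.-integrable setT (EFin \o (fun t => c * h t)).
  by move=> ih; exact: (integrableZl _ c ih).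
rewrite -!RintegralZl// -RintegralB ?Z// -RintegralD ?Z//; apply/andP.
by split; apply/eqP; apply: eq_Rintegral => x _; case: (f x).
Qed.

Lemma integrable_lin (a b : R) (h1 h2 : R -> R) : mu.-integrable setT (EFin \o h1) ->
  mu.-integrable setT (EFin \o h2) ->
  mu.-integrable setT (EFin \o (fun t => a * h1 t + b * h2 t)).
Proof.
move=> i1 i2; have j1 := integrableZl measurableT a i1.
have j2 := integrableZl measurableT b i2; exact: (integrableD measurableT j1 j2).
Qed.

Lemma cintegrable_lin (k : R[i]) f g : cintegrable f -> cintegrable g ->
  cintegrable (fun t => k * f t + g t).
Proof.
move=> [f1 f2] [g1 g2]; case: k => a b; split.
  rewrite (_ : (fun t => _) = EFin \o (fun t => 1 * (a * complex.Re (f t) + - b * complex.Im (f t)) + 1 * complex.Re (g t))).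
    by apply: integrable_lin => //; exact: integrable_lin.
  by apply/funext => t /=; congr EFin; case: (f t) (g t) => x y [z w] /=; ring.
rewrite (_ : (fun t => _) = EFin \o (fun t => 1 * (a * complex.Im (f t) + b * complex.Re (f t)) + 1 * complex.Im (g t))).
  by apply: integrable_lin => //; exact: integrable_lin.
by apply/funext => t /=; congr EFin; case: (f t) (g t) => x y [z w] /=; ring.
Qed.

Lemma cintegrable0 : cintegrable (fun _ : R => 0 : R[i]).
Proof. by split; exact: integrable0. Qed.

Lemma cintegrableZ (k : R[i]) f : cintegrable f -> cintegrable (fun t => k * f t).
Proof.
move=> /(cintegrable_lin k)/(_ cintegrable0); congr cintegrable.
by apply/funext => t; rewrite addr0.
Qed.

Lemma cintegrableD f g : cintegrable f -> cintegrable g ->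
  cintegrable (fun t => f t + g t).
Proof.
move=> cf /(cintegrable_lin 1 cf); congr cintegrable.
by apply/funext => t; rewrite mul1r.
Qed.

Lemma cintegral0 : cintegral (fun _ : R => 0 : R[i]) = 0.
Proof.
have E := cintegralZ 0 cintegrable0; rewrite (mul0r (cintegral _)) in E.
by rewrite -[RHS]E; congr cintegral; apply/funext => t; rewrite mul0r.
Qed.

Lemma cintegral_sum (I : Type) (s : seq I) (F : I -> R -> R[i]) :
  (forall i, cintegrable (F i)) ->
  cintegrable (fun t => \sum_(i <- s) F i t) /\
  cintegral (fun t => \sum_(i <- s) F i t) = \sum_(i <- s) cintegral (F i).
Proof.
move=> iF; elim: s => [|i s [ih1 ih2]].
  rewrite big_nil (_ : (fun t => _) = fun=> 0); last by apply/funext => t; rewrite big_nil.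
  by split; [exact: cintegrable0 | exact: cintegral0].
rewrite big_cons (_ : (fun t => _) = fun t => F i t + \sum_(j <- s) F j t); last first.
  by apply/funext => t; rewrite big_cons.
by rewrite cintegralD// ih2; split => //; exact: cintegrableD.
Qed.

Lemma continuous_cdominated f K : continuous (f : R -> Cplx R) ->
  (forall t, nrm (f t : Cplx R) <= K * weight t) -> cdominated f K.
Proof.
by move=> /continuous_ReIm[c1 c2] fK; split => //; exact: continuous_measurable_fun.
Qed.

End ComplexIntegrals.

(** * Decay of the cosine transform *)

Section CosineTransform.
Context {R : realType}.
Local Notation mu := (@lebesgue_measure R).
Implicit Types (f g : R -> R) (t th x y : R).

Lemma cos_dist (a b : R) : `|cos a - cos b| <= `|a - b|.
Proof.
wlog ab : a b / a <= b.
  move=> h; have [|/ltW] := leP a b; first exact: h.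
  by move=> /h; rewrite distrC (distrC b).
move: ab; rewrite le_eqVlt => /predU1P[->|ab]; first by rewrite !subrr.
rewrite distrC (distrC a) -(@ftc_itv _ cos (fun y => - sin y))//; last first.
  by move=> x; apply: cvgN; exact: continuous_sin.
have ci (h : R -> R) : continuous h -> mu.-integrable `[a, b] (EFin \o h).
  move=> ch; apply: continuous_compact_integrable; first exact: segment_compact.
  exact: continuous_subspaceT.
apply: le_trans (le_normr_Rintegral _ _) _ => //.
  by apply: ci => x; apply: cvgN; exact: continuous_sin.
have -> : `|b - a| = \int[mu]_(x in `[a, b]) 1.
  rewrite (@ftc_itv _ id (fun=> 1))//; last exact: cst_continuous.
  by rewrite ger0_norm// subr_ge0 ltW.
apply: le_Rintegral => //.
- by apply: ci => x; apply: cvg_norm; apply: cvgN; exact: continuous_sin.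
- by apply: ci => x; exact: cst_continuous.
- move=> x _; rewrite normrN ler_norml; apply/andP; split; last exact: sin_le1.
  exact: sin_geN1.
Qed.

(** The phase [th] treats cosine and sine transforms together: [th = - pi / 2] turns the cosine into
    a sine. *)
Definition ctr f t th : R := \int[mu]_y (f y * cos (t * y + th)).

Definition compact_smooth f := smooth f /\ exists2 P, 0 < P & forall y, P <= `|y| -> f y = 0.

Lemma smooth_is_derive f y : smooth f -> is_derive y 1 f ((derive1 f) y).
Proof. by move=> sf; split; [exact: (sf 0%N)|rewrite derive1E]. Qed.

Lemma smooth_derive1 f : smooth f -> smooth (derive1 f).
Proof. by move=> sf n x; have := sf n.+1 x; rewrite /derive1n iterSr. Qed.

Lemma smooth_continuous f : smooth f -> continuous f.
Proof.
by move=> sf x; apply: differentiable_continuous; apply/derivable1_diffP; exact: (sf 0%N).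
Qed.

Lemma compact_smooth_derive1 f : compact_smooth f -> compact_smooth (derive1 f).
Proof.
move=> [sf [P P0 fP]]; split; first exact: smooth_derive1.
(* Enlarged by 1, so that [f] vanishes on a whole neighbourhood of [y] and its derivative there is
   0. *)
exists (P + 1) => [|y yP]; first by rewrite addr_gt0.
rewrite derive1E -[RHS](@derive_cst _ _ _ (0 : R) y 1).
apply: near_eq_derive.
have Py : P < `|y| by rewrite (lt_le_trans _ yP)// ltrDl.
near=> z; rewrite fP//; apply: ltW; near: z.
have := @norm_continuous _ _ y => /(_ _ (lt_nbhsr _)).
by move=> /(_ _ Py).
Unshelve. all: by end_near. Qed.

Lemma compact_continuous_dominated f P : continuous f -> 0 < P ->
  (forall y, P <= `|y| -> f y = 0) ->
  exists M, [/\ 0 <= M, forall y, `|f y| <= M &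
    forall h, continuous h -> (forall y, `|h y| <= 1) ->
      dominated (fun y => f y * h y) (M * (1 + P ^+ 2))].
Proof.
move=> cf P0 fP; have [M fM] := continuous_support_bounded cf (ltW P0) fP.
exists M; split => //; first exact: le_trans (fM 0).
move=> h ch h1; apply: dominated_compact; [|exact: ltW| |].
- by move=> x; apply: cvgM; [exact: cf | exact: ch].
- by move=> y /fP ->; rewrite mul0r.
- by move=> y; rewrite normrM; have := fM y; have := h1 y; have := normr_ge0 (f y); nra.
Qed.

Lemma compact_smooth_dominated f : compact_smooth f ->
  exists M P, [/\ 0 <= M, 0 < P, forall y, P <= `|y| -> f y = 0, forall y, `|f y| <= M &
    forall h, continuous h -> (forall y, `|h y| <= 1) ->
      dominated (fun y => f y * h y) (M * (1 + P ^+ 2))].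
Proof.
move=> [sf [P P0 fP]].
have [M [M0 fM d]] := compact_continuous_dominated (smooth_continuous sf) P0 fP.
by exists M, P.
Qed.

Lemma continuous_affine t th : continuous (fun y : R => t * y + th).
Proof.
by move=> y; apply: cvgD; [apply: cvgM; [exact: cvg_cst|exact: cvg_id]|exact: cvg_cst].
Qed.

Lemma continuous_cos_affine t th : continuous (fun y : R => cos (t * y + th)).
Proof.
move=> y; apply: (@continuous_comp _ _ _ (fun y => t * y + th) cos); last exact: continuous_cos.
exact: continuous_affine.
Qed.

Lemma continuous_sin_affine t th : continuous (fun y : R => sin (t * y + th)).
Proof.
move=> y; apply: (@continuous_comp _ _ _ (fun y => t * y + th) sin); last exact: continuous_sin.
exact: continuous_affine.
Qed.

Lemma cos_norm_le1 (x : R) : `|cos x| <= 1.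
Proof. by rewrite ler_norml cos_le1 cos_geN1. Qed.

Lemma is_derive_affine t th y : is_derive y 1 (fun y : R => t * y + th) t.
Proof.
by apply: is_derive_eq; rewrite addr0 -[LHS]/(t * 1) mulr1.
Qed.

Lemma is_derive_cos_affine t th y :
  is_derive y 1 (fun y : R => cos (t * y + th)) (- t * sin (t * y + th)).
Proof.
have h := is_derive_affine t th y.
by apply: is_derive_eq; ring.
Qed.

Lemma is_derive_sin_affine t th y :
  is_derive y 1 (fun y : R => sin (t * y + th)) (t * cos (t * y + th)).
Proof.
have h := is_derive_affine t th y.
by apply: is_derive_eq; ring.
Qed.

(* [f'' cos + t^2 f cos] is the derivative of [f' cos + t f sin]. *)
Lemma ctr_derive2 f t th : compact_smooth f ->
  t ^+ 2 * ctr f t th = - ctr (derive1 (derive1 f)) t th.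
Proof.
move=> csf; have csf1 := compact_smooth_derive1 csf.
have csf2 := compact_smooth_derive1 csf1.
have [M [P [M0 P0 fP fM df]]] := compact_smooth_dominated csf.
have [M1 [P1 [M10 P10 f1P f1M df1]]] := compact_smooth_dominated csf1.
have [M2 [P2 [M20 P20 f2P f2M df2]]] := compact_smooth_dominated csf2.
have dc := df _ (@continuous_cos_affine t th) (fun y => cos_norm_le1 _).
have d2c := df2 _ (@continuous_cos_affine t th) (fun y => cos_norm_le1 _).
apply/eqP; rewrite -subr_eq0 opprK /ctr -RintegralZl//; last exact: dominated_integrable dc.
rewrite -RintegralD//; last 2 first.
- exact: dominated_integrable (dominatedZ (t ^+ 2) dc).
- exact: dominated_integrable d2c.
pose Q := P + P1 + P2; apply/eqP.
have PQ : P <= Q by rewrite /Q; lra.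
have P1Q : P1 <= Q by rewrite /Q; lra.
have P2Q : P2 <= Q by rewrite /Q; lra.
apply: (@ftc_compact _ (fun y => (derive1 f) y * cos (t * y + th) + t * (f y * sin (t * y + th))) _ Q).
- by rewrite /Q; lra.
- move=> y; have h1 := smooth_is_derive y csf.1; have h2 := smooth_is_derive y csf1.1.
  have h3 := is_derive_cos_affine t th y; have h4 := is_derive_sin_affine t th y.
  apply: is_derive_eq.
  have sc (a b : R) : a *: b = a * b by [].
  by rewrite !sc; ring.
- have c2 := smooth_continuous csf2.1; have c0 := smooth_continuous csf.1.
  have cc := @continuous_cos_affine t th.
  move=> y; apply: cvgD; last by apply: cvgM; [exact: c2 | exact: cc].
  by apply: cvgM; [exact: cvg_cst|apply: cvgM; [exact: c0 | exact: cc]].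
- by move=> y Qy; rewrite f1P ?fP ?mul0r ?mulr0 ?addr0//; lra.
- by move=> y Qy; rewrite f2P ?fP ?mul0r ?mulr0 ?addr0//; lra.
Qed.

(** [(1 + t^2)^2] times the transform of [f] is the transform of [f - 2 f'' + f'''']. Fourth
    derivatives are taken to reach the square of [weight]: one factor remains for integrability when
    the other absorbs a factor [|t|]. *)
Lemma ctr_decay f : compact_smooth f ->
  exists2 K, 0 <= K & forall t th, `|ctr f t th| <= K * weight t ^+ 2.
Proof.
move=> csf; have csf2 := compact_smooth_derive1 (compact_smooth_derive1 csf).
have csf4 := compact_smooth_derive1 (compact_smooth_derive1 csf2).
have B g : compact_smooth g -> exists2 C, 0 <= C & forall t th, `|ctr g t th| <= C.
  move=> /compact_smooth_dominated[M [P [M0 P0 _ _ d]]].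
  exists (M * (1 + P ^+ 2) * weight_mass).
    by rewrite !mulr_ge0 ?weight_mass_ge0// addr_ge0 ?sqr_ge0.
  move=> t th; apply: dominated_le; apply: d; first exact: continuous_cos_affine.
  by move=> y; exact: cos_norm_le1.
have [C0 C00 h0] := B _ csf; have [C2 C20 h2] := B _ csf2; have [C4 C40 h4] := B _ csf4.
exists (C0 + 2 * C2 + C4) => [|t th]; first by rewrite !addr_ge0// mulr_ge0.
have w0 := weight_gt0 t; have w1 := oneDsqr_weight t.
have main (x0 x2 x4 : R) : t ^+ 2 * x0 = - x2 -> t ^+ 2 * x2 = - x4 ->
    `|x0| <= C0 -> `|x2| <= C2 -> `|x4| <= C4 ->
    `|x0| <= (C0 + 2 * C2 + C4) * weight t ^+ 2.
  move=> e2 e4 b0 b2 b4.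
  have -> : x0 = (x0 - 2 * x2 + x4) * weight t ^+ 2.
    have -> : x2 = - (t ^+ 2 * x0) by rewrite e2 opprK.
    have -> : x4 = t ^+ 2 * (t ^+ 2 * x0) by rewrite -[LHS]opprK -e4 e2 mulrN.
    rewrite [RHS](_ : _ = x0 * ((1 + t ^+ 2) * weight t) ^+ 2); last by ring.
    by rewrite w1 expr1n mulr1.
  rewrite normrM (@ger0_norm _ (_ ^+ 2)) ?sqr_ge0// ler_wpM2r ?sqr_ge0//.
  apply: le_trans (ler_normD _ _) _; apply: lerD => //.
  apply: le_trans (ler_normB _ _) _; apply: lerD => //.
  by rewrite normrM ger0_norm// ler_wpM2l.
exact: (main _ _ _ (ctr_derive2 t th csf) (ctr_derive2 t th csf2)
  (h0 t th) (h2 t th) (h4 t th)).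
Qed.

Lemma ctr_lipschitz f P : continuous f -> 0 < P ->
  (forall y, P <= `|y| -> f y = 0) -> exists2 K, 0 <= K &
  forall t th t' th', `|ctr f t th - ctr f t' th'| <= K * (`|t - t'| + `|th - th'|).
Proof.
move=> cf P0 fP; have [M [M0 fM d]] := compact_continuous_dominated cf P0 fP.
have M2 : 0 <= M * (1 + P) * (1 + P ^+ 2) by rewrite !mulr_ge0 ?addr_ge0 ?sqr_ge0// ltW.
exists (M * (1 + P) * (1 + P ^+ 2) * weight_mass); first by rewrite mulr_ge0 ?weight_mass_ge0.
move=> t th t' th'.
have i1 := dominated_integrable (d _ (@continuous_cos_affine t th) (fun y => cos_norm_le1 _)).
have i2 := dominated_integrable (d _ (@continuous_cos_affine t' th') (fun y => cos_norm_le1 _)).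
rewrite /ctr -RintegralB//.
have -> : M * (1 + P) * (1 + P ^+ 2) * weight_mass * (`|t - t'| + `|th - th'|) =
  M * (1 + P) * (`|t - t'| + `|th - th'|) * (1 + P ^+ 2) * weight_mass by ring.
apply: dominated_le; apply: dominated_compact (ltW P0) _ _.
- move=> y.
  by apply: cvgB; (apply: cvgM; [exact: cf|exact: continuous_cos_affine]).
- by move=> y /fP ->; rewrite !mul0r subrr.
move=> y; rewrite -mulrBr normrM; have [yP|Py] := leP P `|y|.
  by rewrite fP// normr0 mul0r !mulr_ge0 ?addr_ge0// ltW.
rewrite -mulrA; apply: ler_pM => //.
apply: le_trans (cos_dist _ _) _.
have -> : t * y + th - (t' * y + th') = (t - t') * y + (th - th') by ring.
apply: le_trans (ler_normD _ _) _; rewrite normrM.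
have := normr_ge0 (t - t'); have := normr_ge0 (th - th'); have := normr_ge0 y; nra.
Qed.

End CosineTransform.

(** * The Fejér kernel *)

Section Fejer.
Context {R : realType}.
Local Notation mu := (@lebesgue_measure R).
Implicit Types (f g : R -> R) (S t th s x y : R).

Definition tent S t : R := Num.max 0 (1 - `|t| / S).

Lemma tent_ge0 S t : 0 <= tent S t.
Proof. by rewrite le_max lexx. Qed.

Lemma tent_le1 S t : 0 < S -> tent S t <= 1.
Proof.
by move=> S0; rewrite ge_max ler01/= gerBl divr_ge0// ltW.
Qed.

Lemma tent_dist S t : 0 < S -> `|1 - tent S t| <= `|t| / S.
Proof.
move=> S0; rewrite ger0_norm; last by rewrite subr_ge0 tent_le1.
by rewrite lerBlDl -lerBlDr le_max lexx orbT.
Qed.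

Lemma tent_support S t : 0 < S -> S <= `|t| -> tent S t = 0.
Proof.
by move=> S0 St; apply/max_idPl; rewrite subr_le0 ler_pdivlMr// mul1r.
Qed.

Lemma tentE S t : 0 < S -> `|t| <= S -> tent S t = 1 - `|t| / S.
Proof.
by move=> S0 St; apply/max_idPr; rewrite subr_ge0 ler_pdivrMr// mul1r.
Qed.

Lemma continuous_tent S : continuous (tent S).
Proof.
move=> t; apply: (@continuous_max _ _ (fun=> 0) (fun t => 1 - `|t| / S) t).
  exact: cst_continuous.
apply: cvgB; first exact: cvg_cst.
by apply: cvgM; [exact: norm_continuous|exact: cvg_cst].
Qed.

(** The Fejér kernel, up to normalisation, as the transform of the tent function, with a phase. *)
Definition fejer S s th : R := \int[mu]_t (tent S t * cos (t * s + th)).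

Lemma dominated_tent S s th : 0 < S ->
  dominated (fun t => tent S t * cos (t * s + th)) (1 + S ^+ 2).
Proof.
move=> S0; have cc : continuous (fun t => cos (t * s + th)).
  rewrite (_ : (fun t => _) = fun t => cos (s * t + th)).
    by move=> t; exact: continuous_cos_affine.
  by apply/funext => u; rewrite mulrC.
rewrite -[1 + _]mul1r; apply: dominated_compact (ltW S0) _ _.
- by move=> t; apply: cvgM; [exact: continuous_tent|exact: cc].
- by move=> t /(tent_support S0) ->; rewrite mul0r.
- move=> t; rewrite normrM; have := cos_norm_le1 (t * s + th).
  by have := tent_ge0 S t; have := tent_le1 t S0 => ? ?; rewrite ger0_norm//; nra.
Qed.

Lemma continuous_fejer S th : 0 < S -> continuous (fun s => fejer S s th).
Proof.
move=> S0; have [K K0 h] := ctr_lipschitz (@continuous_tent S) S0 (fun t => tent_support S0).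
have E s : fejer S s th = ctr (tent S) s th.
  by apply: eq_Rintegral => t _; rewrite (mulrC t).
move=> s; apply/cvgrPdist_lt => e e0; have k0 : 0 < K + 1 by rewrite ltr_wpDl.
near=> u; rewrite !E; apply: le_lt_trans (h _ _ _ _) _; rewrite subrr normr0 addr0.
have tu : `|s - u| < e / (K + 1).
  by near: u; apply: cvgr_dist_lt; [exact: cvg_id|exact: divr_gt0].
have tu' : `|s - u| * (K + 1) < e by rewrite -ltr_pdivlMr.
by have := normr_ge0 (s - u); nra.
Unshelve. all: by end_near. Qed.

Lemma fejer_split S s th : 0 < S -> fejer S s th =
  \int[mu]_(t in `[- S, 0]) ((1 + t / S) * cos (s * t + th)) +
  \int[mu]_(t in `[0, S]) ((1 - t / S) * cos (s * t + th)).
Proof.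
move=> S0; pose h t := tent S t * cos (t * s + th).
have ih : mu.-integrable setT (EFin \o h) := dominated_integrable (dominated_tent s th S0).
have ihA (A : set R) : measurable A -> mu.-integrable A (EFin \o h).
  by move=> mA; apply: integrableS ih.
rewrite /fejer (@Rintegral_support _ h S); last first.
  by move=> t /(tent_support S0) E; rewrite /h E mul0r.
have mI : measurable `[- S, S]%classic by exact: measurable_itv.
have p1 : (BLeft (- S) <= BRight (0 : R))%O by rewrite bnd_simp oppr_le0 ltW.
have p2 : (BRight (0 : R) <= BRight S)%O by rewrite bnd_simp ltW.
have E := Rintegral_itvB (ihA _ mI) p1 p2.
have {E} -> : \int[mu]_(y in `[- S, S]) h y = \int[mu]_(t in `[- S, 0]) h t + \int[mu]_(t in `]0, S]) h t.
  by move/eqP: E; rewrite subr_eq => /eqP ->; rewrite [LHS]addrC.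
rewrite Rintegral_itv_obnd_cbnd; last by apply: ihA; exact: measurable_itv.
congr (_ + _); apply: eq_Rintegral => t; rewrite inE/= in_itv/= => /andP[t1 t2].
  have tS : `|t| <= S by rewrite ler0_norm//; lra.
  by rewrite /h (tentE S0 tS) ler0_norm// mulNr opprK (mulrC t s).
have tS : `|t| <= S by rewrite ger0_norm.
by rewrite /h (tentE S0 tS) ger0_norm// (mulrC t s).
Qed.

Lemma fejerE S s th : 0 < S -> s != 0 ->
  fejer S s th = 2 * cos th * (1 - cos (S * s)) / (S * s ^+ 2).
Proof.
move=> S0 s0; rewrite fejer_split//; have S1 : S != 0 by rewrite gt_eqF.
have c (k : R) : continuous (fun t : R => (1 + t * k) * cos (s * t + th)).
  move=> t; apply: cvgM; last exact: continuous_cos_affine.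
  by apply: cvgD; [exact: cvg_cst|apply: cvgM; [exact: cvg_id|exact: cvg_cst]].
(* One antiderivative serves both halves of the tent, with [k = 1/S] on the left and [k = - 1/S] on
   the right. *)
have d (k : R) (t : R) : is_derive t 1 (fun t => (1 + t * k) * sin (s * t + th) / s
     + k * cos (s * t + th) / s ^+ 2) ((1 + t * k) * cos (s * t + th)).
  have h1 := is_derive_cos_affine s th t; have h2 := is_derive_sin_affine s th t.
  have sc (a b : R) : a *: b = a * b by [].
  have h3 : is_derive t 1 (fun t : R => 1 + t * k) k.
    by apply: is_derive_eq; rewrite !sc; ring.
  apply: is_derive_eq; rewrite !sc.
  by field.
rewrite (ftc_itv _ (d (S^-1)))//; last by rewrite oppr_lt0.
have -> : (fun t => (1 - t / S) * cos (s * t + th)) = fun t => (1 + t * - S^-1) * cos (s * t + th).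
  by apply/funext => t; rewrite mulrN.
rewrite (ftc_itv _ (d (- S^-1)))//.
have -> : s * 0 + th = th by rewrite mulr0 add0r.
have -> : cos (s * - S + th) = cos th * cos (S * s) + sin th * sin (S * s).
  by rewrite -cosB; congr cos; ring.
have -> : cos (s * S + th) = cos th * cos (S * s) - sin th * sin (S * s).
  by rewrite -cosD; congr cos; ring.
by field; rewrite s0 S1.
Qed.

Lemma fejer_le S s th : 0 < S -> s != 0 -> `|fejer S s th| <= 4 / (S * s ^+ 2).
Proof.
move=> S0 s0; rewrite fejerE// normrM normfV.
have D0 : 0 < S * s ^+ 2 by rewrite mulr_gt0// exprn_even_gt0.
rewrite (ger0_norm (ltW D0)) ler_pM2r ?invr_gt0//.
rewrite !normrM ger0_norm//; have := cos_norm_le1 th; have := cos_norm_le1 (S * s).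
have := ler_normB 1 (cos (S * s)); rewrite normr1.
have := normr_ge0 (cos th); have := normr_ge0 (1 - cos (S * s)); nra.
Qed.

Lemma fejer_ge0 S s : 0 < S -> s != 0 -> 0 <= fejer S s 0.
Proof.
move=> S0 s0; rewrite fejerE// cos0 mulr1; apply: divr_ge0.
  by rewrite mulr_ge0// subr_ge0 cos_le1.
by rewrite mulr_ge0 ?sqr_ge0// ltW.
Qed.

(** On [|t| <= S/2], an interval of length [S], tent and cosine are both at least 1/2; on the rest
    of the support of the tent the integrand is nonnegative. *)
Lemma fejer_near : exists2 rho : R, 0 < rho &
  forall S s, 0 < S -> `|s| * S <= rho -> S / 4 <= fejer S s 0.
Proof.
have : {for 0, continuous (@cos R)} by exact: continuous_cos.
move=> /cvgrPdist_lt/(_ _ (divr_gt0 ltr01 (ltr0n _ 2)))/nbhs_ballP[e /= e0 eP].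
have ch z : `|z| < e -> 2^-1 <= cos z.
  move=> ze; have := eP z; rewrite /ball/= sub0r normrN => /(_ ze).
  by rewrite cos0 ltr_norml => /andP[_]; lra.
exists (e / 2) => [|S s S0 sS]; first by rewrite divr_gt0.
have S20 : 0 < S / 2 by rewrite divr_gt0.
have ih := dominated_integrable (dominated_tent s 0 S0).
have sub : S / 4 = \int[mu]_(t in `[- (S / 2), S / 2]) 4^-1.
  have dd (y : R) : is_derive y 1 (fun t : R => 4^-1 * t) 4^-1.
    by apply: is_derive_eq; rewrite -[LHS]/(4^-1 * 1) mulr1.
  have SS : - (S / 2) < S / 2 by lra.
  rewrite (ftc_itv SS dd); last by move=> x; exact: cvg_cst.
  by field.
have mI : measurable `[- (S / 2), S / 2]%classic by exact: measurable_itv.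
rewrite sub Rintegral_mkcond; apply: le_Rintegral => //.
  apply: (@dominated_integrable _ _ (4^-1 * (1 + (S / 2) ^+ 2))); split.
    exact: ((measurable_restrictT (cst (4^-1 : R)) mI).1 (measurable_cst _)).
  move=> t; rewrite patchE; case: ifPn => [|_]; last first.
    by rewrite normr0 !mulr_ge0 ?addr_ge0 ?sqr_ge0 ?invr_ge0// ltW ?weight_gt0.
  rewrite inE/= in_itv/= -ler_norml => tS; rewrite ger0_norm ?invr_ge0//.
  rewrite -mulrA ler_peMr ?invr_ge0// -[leLHS](oneDsqr_weight t) ler_pM2r ?weight_gt0//.
  by rewrite lerD2l -(real_normK (num_real t)) ler_pXn2r// nnegrE// ltW.
move=> t _; rewrite patchE addr0; have St : `|t| <= S -> 2^-1 <= cos (t * s).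
  move=> tS; apply: ch; rewrite normrM; have := normr_ge0 s; have := normr_ge0 t; nra.
case: ifPn => [|_].
  rewrite inE/= in_itv/= -ler_norml => tS.
  have h1 : 2^-1 <= tent S t.
    rewrite tentE//; last by lra.
    have : `|t| / S <= 2^-1 by rewrite ler_pdivrMr//; lra.
    by lra.
  have := St ltac:(lra); have : 4^-1 = 2^-1 * 2^-1 :> R by field.
  by move=> ->; nra.
have [tS|/ltW St'] := leP `|t| S; first by rewrite mulr_ge0 ?tent_ge0// (le_trans _ (St tS))// invr_ge0.
by rewrite tent_support// mul0r.
Qed.

Lemma integral_fin_real (h : R -> R) : mu.-integrable setT (EFin \o h) ->
  (\int[mu]_t (h t)%:E = (\int[mu]_t h t)%:E)%E.
Proof. by move=> ih; rewrite /Rintegral fineK//; exact: integrable_fin_num ih. Qed.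

Section FubiniFejer.
Variable f : R -> R.
Hypothesis csf : compact_smooth f.

(** Real building block of [inv_fourier F t * expi (t * x)]: [th = 0] gives the cosine part and
    [th = - pi / 2] the sine part. *)
Definition cosine_at x th t : R := \int[mu]_y (f y * cos (t * (x - y) + th)).

Lemma cosine_atE x th t : cosine_at x th t = ctr f t (- (t * x) - th).
Proof.
apply: eq_Rintegral => y _; rewrite -(cosN (t * (x - y) + th)); congr (_ * cos _).
by ring.
Qed.

Lemma cosine_at_decay : exists2 K, 0 <= K &
  forall x th t, `|cosine_at x th t| <= K * weight t ^+ 2.
Proof.
by have [K K0 h] := ctr_decay csf; exists K => // x th t; rewrite cosine_atE.
Qed.

Lemma continuous_cosine_at x th : continuous (cosine_at x th).
Proof.
have [sf [P P0 fP]] := csf.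
have [K K0 h] := ctr_lipschitz (smooth_continuous sf) P0 fP.
move=> t; apply/cvgrPdist_lt => e e0.
have k0 : 0 < K * (1 + `|x|) + 1 by rewrite ltr_wpDl// mulr_ge0// addr_ge0.
near=> u; rewrite !cosine_atE; apply: le_lt_trans (h _ _ _ _) _.
have -> : - (t * x) - th - (- (u * x) - th) = - ((t - u) * x) by ring.
rewrite normrN normrM.
have tu : `|t - u| < e / (K * (1 + `|x|) + 1).
  near: u; apply: cvgr_dist_lt; [exact: cvg_id|exact: divr_gt0].
have tu' : `|t - u| * (K * (1 + `|x|) + 1) < e by rewrite -ltr_pdivlMr.
have := normr_ge0 (t - u); nra.
Unshelve. all: by end_near. Qed.

(** The tent makes the double integrand absolutely integrable; the inner integral over [t] then is
    the Fejér kernel. *)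
Lemma fubini_fejer S x th : 0 < S ->
  \int[mu]_t (tent S t * cosine_at x th t) = \int[mu]_y (f y * fejer S (x - y) th).
Proof.
move=> S0; have [M [P [M0 P0 fP fM df]]] := compact_smooth_dominated csf.
have cf := smooth_continuous csf.1.
pose h (p : R * R) : R := tent S p.1 * (f p.2 * cos (p.1 * (x - p.2) + th)).
have mh : measurable_fun setT h.
  apply: measurable_funM.
    apply: (measurableT_comp (f := tent S)) => //.
    by apply: continuous_measurable_fun; exact: continuous_tent.
  apply: measurable_funM.
    by apply: (measurableT_comp (f := f)) => //; exact: continuous_measurable_fun.
  apply: (measurableT_comp (f := @cos R)).
    by apply: continuous_measurable_fun; exact: continuous_cos.
  apply: measurable_funD => //; apply: measurable_funM => //.
  by apply: measurable_funB.
have dt t : dominated (fun y => f y * cos (t * (x - y) + th)) (M * (1 + P ^+ 2)).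
  apply: df; last by move=> y; exact: cos_norm_le1.
  rewrite (_ : (fun y => _) = fun y => cos (- t * y + (t * x + th))).
    by move=> y; exact: continuous_cos_affine.
  by apply/funext => y; congr cos; ring.
have dy y := dominated_tent (x - y) th S0.
have ih : (mu \x mu)%E.-integrable setT (EFin \o h).
  apply/integrable12ltyP; first exact/measurable_EFinP.
  pose C := M * (1 + P ^+ 2).
  have mh' : measurable_fun setT (fun p => `|(EFin \o h) p|)%E.
    by apply: measurableT_comp => //; exact/measurable_EFinP.
  have B t : (\int[mu]_y `|(EFin \o h) (t, y)| <= (C * weight_mass * (1 + S ^+ 2) * weight t)%:E)%E.
    have d1 := dominatedZ (tent S t) (dt t).
    have d2 : dominated (fun y => `|tent S t * (f y * cos (t * (x - y) + th))|) (`|tent S t| * C).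
      have [m1 m2] := d1; split; first exact: measurableT_comp.
      by move=> y; rewrite normr_id; exact: m2.
    have -> : (\int[mu]_y `|(EFin \o h) (t, y)| =
        (\int[mu]_y `|tent S t * (f y * cos (t * (x - y) + th))|)%:E)%E.
      exact: (integral_fin_real (dominated_integrable d2)).
    rewrite lee_fin; apply: le_trans (ler_norm _) (le_trans (dominated_le d2) _).
    have := (dominated_tent 0 0 S0).2 t; rewrite mulr0 addr0 cos0 mulr1 => h1.
    have C0 : 0 <= C by rewrite mulr_ge0// addr_ge0 ?sqr_ge0.
    rewrite (_ : _ * weight_mass = C * weight_mass * `|tent S t|); last by ring.
    by rewrite -[leRHS]mulrA ler_wpM2l// mulr_ge0// weight_mass_ge0.
  have I1 : (\int[mu]_t \int[mu]_y `|(EFin \o h) (t, y)| <=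
      \int[mu]_t (C * weight_mass * (1 + S ^+ 2) * weight t)%:E)%E.
    apply: ge0_le_integral => //.
    - by move=> t _; exact: integral_ge0.
    - have ge0 (p : R * R) : (0 <= (abse \o (EFin \o h)) p)%E by exact: abse_ge0.
      exact: (@measurable_fun_fubini_tonelli_F _ _ _ _ R
        (@lebesgue_measure R : {sigma_finite_measure set _ -> \bar R}) _ mh' ge0).
    - apply/measurable_EFinP; apply: measurable_funM => //.
      by apply: continuous_measurable_fun; exact: continuous_weight.
  apply: le_lt_trans I1 _.
  rewrite (integral_fin_real (h := fun t => C * weight_mass * (1 + S ^+ 2) * weight t)) ?ltry//.
  exact: (integrableZl measurableT (C * weight_mass * (1 + S ^+ 2)) integrable_weight).
have E1 t : (\int[mu]_y (EFin \o h) (t, y) = (tent S t * cosine_at x th t)%:E)%E.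
  rewrite /cosine_at -(RintegralZl _ measurableT (dominated_integrable (dt t))).
  exact: (integral_fin_real (dominated_integrable (dominatedZ (tent S t) (dt t)))).
have E2 y : (\int[mu]_t (EFin \o h) (t, y) = (f y * fejer S (x - y) th)%:E)%E.
  rewrite /fejer -(RintegralZl _ measurableT (dominated_integrable (dy y))).
  rewrite -(integral_fin_real (dominated_integrable (dominatedZ (f y) (dy y)))).
  by apply: eq_integral => t _; rewrite /h/= mulrCA.
rewrite /Rintegral; congr fine.
transitivity (\int[mu]_t \int[mu]_y (EFin \o h) (t, y))%E.
  by apply: eq_integral => t _; rewrite E1.
rewrite (Fubini ih); apply: eq_integral => y _; exact: E2.
Qed.

End FubiniFejer.
End Fejer.

(** * The inversion integral through Fejér means *)

Section FejerLimit.
Context {R : realType}.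
Local Notation mu := (@lebesgue_measure R).
Implicit Types (S t th s x y : R).

Lemma norm_weight_le1 t : `|t| * weight t <= 1.
Proof.
rewrite -[leRHS](oneDsqr_weight t) ler_pM2r ?weight_gt0//.
rewrite -(real_normK (num_real t)); have := sqr_ge0 (`|t| - 1); have := normr_ge0 t; nra.
Qed.

Section Limit.
Variable f : R -> R.
Hypothesis csf : compact_smooth f.

Lemma dominated_cosine_at : exists2 K, 0 <= K & forall x th, [/\
  dominated (cosine_at f x th) K &
  dominated (fun t => `|t| * cosine_at f x th t) K].
Proof.
have [K K0 h] := cosine_at_decay csf; exists K => // x th.
have cc := @continuous_cosine_at _ f csf x th.
split; split.
- exact: continuous_measurable_fun.
- move=> t; apply: le_trans (h x th t) _; rewrite ler_wpM2l// expr2.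
  by rewrite ler_piMl ?weight_le1// ltW ?weight_gt0.
- apply: continuous_measurable_fun => t; apply: cvgM; last exact: cc.
  exact: norm_continuous.
- move=> t; rewrite normrM normr_id; apply: (@le_trans _ _ (`|t| * (K * weight t ^+ 2))).
    by rewrite ler_wpM2l.
  rewrite expr2 [leLHS](_ : _ = K * weight t * (`|t| * weight t)); last by ring.
  by rewrite ler_piMr ?norm_weight_le1// mulr_ge0// ltW ?weight_gt0.
Qed.

(** [1 - tent S t] is at most [|t| / S], and [|t|] times the transform is still integrable. *)
Lemma cosine_at_tent : exists2 C, 0 <= C & forall x th S, 0 < S ->
  `|\int[mu]_t cosine_at f x th t - \int[mu]_t (tent S t * cosine_at f x th t)| <= C / S.
Proof.
have [K K0 h] := dominated_cosine_at; exists (K * weight_mass).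
  by rewrite mulr_ge0 ?weight_mass_ge0.
move=> x th S S0; have [d1 d2] := h x th.
have ct := @continuous_tent R S.
have d3 : dominated (fun t => tent S t * cosine_at f x th t) K.
  have [m1 b1] := d1; split.
    by apply: measurable_funM => //; exact: continuous_measurable_fun.
  move=> t; rewrite normrM ger0_norm ?tent_ge0//; apply: le_trans (b1 t).
  by rewrite ler_piMl// tent_le1.
rewrite -RintegralB//; last 2 first.
- exact: dominated_integrable d1.
- exact: dominated_integrable d3.
rewrite (_ : K * weight_mass / S = K / S * weight_mass); last by ring.
apply: dominated_le; split.
  by apply: measurable_funB; [exact: d1.1|exact: d3.1].
move=> t; rewrite -[X in X - _]mul1r -mulrBl normrM.
apply: (@le_trans _ _ (`|t| / S * `|cosine_at f x th t|)).
  by rewrite ler_wpM2r// tent_dist.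
have := d2.2 t; rewrite normrM normr_id => b2.
rewrite mulrAC (mulrAC K) ler_pM2r ?invr_gt0//.
Qed.

(** On the support of [f] the kernel is at most [4 / (S d^2)]. The Fejér mean and its distance to
    the integral are therefore both of order [1/S]. *)
Lemma cosine_at_off_support x th d : 0 < d ->
  (forall y, f y != 0 -> d <= `|x - y|) -> \int[mu]_t cosine_at f x th t = 0.
Proof.
move=> d0 fd; have [C C0 hC] := cosine_at_tent.
have [M [P [M0 P0 fP fM _]]] := compact_smooth_dominated csf.
have cf := smooth_continuous csf.1.
pose C' := M * (4 / d ^+ 2) * (1 + P ^+ 2) * weight_mass.
have d2 : 0 < d ^+ 2 by rewrite exprn_gt0.
apply/eqP; rewrite -normr_le0; apply: (@ler_addgt1 _ _ _ (C + C')) => e e0 e1.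
pose S := e^-1; have S0 : 0 < S by rewrite invr_gt0.
have := hC x th S S0; rewrite (fubini_fejer csf)//.
suff : `|\int[mu]_y (f y * fejer S (x - y) th)| <= C' * e.
  rewrite /S invrK add0r mulrDl => h1 h2.
  rewrite -[X in `|X|](subrK (\int[mu]_y (f y * fejer S (x - y) th))).
  by apply: le_trans (ler_normD _ _) _; exact: lerD.
have -> : C' * e = M * (4 / (S * d ^+ 2)) * (1 + P ^+ 2) * weight_mass.
  by rewrite /C' /S; field; rewrite !gt_eqF.
apply: dominated_le; apply: dominated_compact (ltW P0) _ _.
- move=> y; apply: cvgM; first exact: cf.
  apply: (@continuous_comp _ _ _ (fun y => x - y) (fun s => fejer S s th)).
    by apply: cvgB; [exact: cvg_cst|exact: cvg_id].
  exact: continuous_fejer.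
- by move=> y /fP ->; rewrite mul0r.
- move=> y; have [->|fy] := eqVneq (f y) 0.
    by rewrite mul0r normr0 mulr_ge0// divr_ge0// ltW ?mulr_gt0.
  have dy := fd _ fy; have xy0 : x - y != 0.
    by apply: contraTneq dy => ->; rewrite normr0 -ltNge.
  rewrite normrM; apply: ler_pM => //; apply: le_trans (fejer_le th S0 xy0) _.
  have dxy : S * d ^+ 2 <= S * (x - y) ^+ 2.
    rewrite ler_pM2l// -(real_normK (num_real (x - y))).
    by rewrite ler_pXn2r// nnegrE// ltW.
  have D1 : 0 < S * d ^+ 2 by rewrite mulr_gt0.
  by rewrite ler_pM2l// lef_pV2// posrE// (lt_le_trans D1).
Qed.

(** On the interval of radius [a = rho / S] around [x] the kernel is at least [S/4], so the Fejér
    mean is at least [de rho / 2] for all large [S], while its distance to the integral is at most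
    [C / S]. *)
Lemma cosine_at_bump x (de et : R) : 0 < de -> 0 < et -> (forall y, 0 <= f y) ->
  (forall y, `|x - y| <= et -> de <= f y) -> 0 < \int[mu]_t cosine_at f x 0 t.
Proof.
move=> de0 et0 f0 fde; have [C C0 hC] := cosine_at_tent.
have [rho rho0 near] := @fejer_near R.
have [M [P [M0 P0 fP fM _]]] := compact_smooth_dominated csf.
have cf := smooth_continuous csf.1.
(* The first summand gives [rho / S <= et], the second makes [C / S] at most [de rho / 4]. *)
pose S := rho / et + (C + 1) * 4 / (de * rho).
have X0 : 0 < (C + 1) * 4 / (de * rho) by rewrite divr_gt0 ?mulr_gt0// ltr_wpDl.
have S0 : 0 < S by rewrite addr_gt0// divr_gt0.
pose a := rho / S; have a0 : 0 < a by rewrite divr_gt0.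
have aet : a <= et.
  by rewrite ler_pdivrMr// -ler_pdivrMl// mulrC lerDl ltW.
have := hC x 0 S S0; rewrite (fubini_fejer csf)//.
have arith (I1 I2 q c : R) : q / 2 <= I2 -> - c <= I1 - I2 -> c <= q / 4 ->
    0 < q -> 0 < I1 by move=> ? ? ? ?; lra.
suff h : de * rho / 2 <= \int[mu]_y (f y * fejer S (x - y) 0).
  rewrite ler_norml => /andP[h1 _].
  apply: (arith _ _ _ _ h h1); last by rewrite mulr_gt0.
  rewrite ler_pdivrMr// -ler_pdivrMl ?divr_gt0 ?mulr_gt0//.
  apply: (@le_trans _ _ ((C + 1) * 4 / (de * rho))); last by rewrite lerDr ltW// divr_gt0.
  rewrite (_ : (de * rho / 4)^-1 * C = C * 4 / (de * rho)); last by field; rewrite !gt_eqF.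
  by rewrite ler_pM2r ?invr_gt0 ?mulr_gt0// ler_pM2r// lerDl.
have xa : x - a < x + a by lra.
have -> : de * rho / 2 = \int[mu]_(y in `[x - a, x + a]) (de * (S / 4)).
  have dd (y : R) : is_derive y 1 (fun t : R => de * (S / 4) * t) (de * (S / 4)).
    by apply: is_derive_eq; rewrite -[LHS]/(de * (S / 4) * 1) mulr1.
  rewrite (ftc_itv xa dd); last by move=> z; exact: cvg_cst.
  by rewrite /a; field; rewrite gt_eqF.
have mI : measurable `[x - a, x + a]%classic by exact: measurable_itv.
have cfj : continuous (fun y => f y * fejer S (x - y) 0).
  move=> y; apply: cvgM; first exact: cf.
  apply: (@continuous_comp _ _ _ (fun y => x - y) (fun s => fejer S s 0)).
    by apply: cvgB; [exact: cvg_cst|exact: cvg_id].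
  exact: continuous_fejer.
have [M' fM'] : exists M', forall y, `|f y * fejer S (x - y) 0| <= M'.
  apply: (continuous_support_bounded cfj (ltW P0)) => y /fP ->; exact: mul0r.
rewrite Rintegral_mkcond; apply: le_Rintegral => //.
- have [] : exists K, dominated ((fun=> de * (S / 4)) \_ `[x - a, x + a]) K.
    exists (de * (S / 4) * (1 + (`|x| + a) ^+ 2)); split.
      exact: ((measurable_restrictT (cst (de * (S / 4))) mI).1 (measurable_cst _)).
    have k0 : 0 < de * (S / 4) by rewrite mulr_gt0// divr_gt0.
    move=> t; rewrite patchE; case: ifPn => [|_]; last first.
      by rewrite normr0 !mulr_ge0 ?addr_ge0 ?sqr_ge0// ltW ?weight_gt0// divr_gt0.
    rewrite inE/= in_itv/= => tx; rewrite (ger0_norm (ltW k0)); set k := de * (S / 4).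
    rewrite -(mulrA k); apply: ler_peMr; first exact: ltW.
    rewrite -[leLHS](oneDsqr_weight t) ler_pM2r ?weight_gt0//.
    have tb : `|t| <= `|x| + a.
      rewrite -[t](subrK x) (le_trans (ler_normD _ _))// addrC lerD2l ler_norml.
      by move: tx => /andP[? ?]; apply/andP; split; lra.
    rewrite lerD2l -(real_normK (num_real t)) ler_pXn2r// nnegrE//.
    by rewrite addr_ge0// ltW.
  by move=> K; exact: dominated_integrable.
- apply: (dominated_integrable (K := M' * (1 + P ^+ 2))).
  by apply: dominated_compact (ltW P0) _ _ => // y /fP ->; rewrite mul0r.
have fg s : 0 <= fejer S s 0.
  have [->|s0] := eqVneq s 0; last exact: fejer_ge0.
  by apply: le_trans (near S 0 S0 _); rewrite ?normr0 ?mul0r ?ltW// divr_gt0.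
move=> y _; rewrite patchE; case: ifPn => [|_]; last by rewrite mulr_ge0.
rewrite inE/= in_itv/= => /andP[y1 y2].
have xya : `|x - y| <= a by rewrite ler_norml; apply/andP; split; lra.
apply: ler_pM; first exact: ltW.
- by apply: divr_ge0 => //; exact: ltW.
- by apply: fde; exact: le_trans xya aet.
by apply: near => //; rewrite -ler_pdivlMr.
Qed.

End Limit.
End FejerLimit.

(** * The Fourier inversion of a test function *)

Section FourierInversion.
Context {R : realType}.
Local Notation mu := (@lebesgue_measure R).
Implicit Types (t x y : R) (F : R -> R[i]).

Lemma expiD t x : expi (t + x) = expi t * expi x.
Proof.
apply/eqP; rewrite eq_complex/= cosD sinD; apply/andP; split; apply/eqP => //.
by rewrite [RHS]addrC.
Qed.

Lemma expi0 : expi 0 = 1 :> R[i].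
Proof. by rewrite /expi cos0 sin0. Qed.

Lemma nrm_expi t : nrm (expi t : Cplx R) = 1.
Proof. by rewrite /nrm normc_def/= cos2Dsin2 sqrtr1. Qed.

Lemma sin_cos_shift x : cos (x + - (pi / 2)) = sin x.
Proof. by rewrite cosD cosN sinN cos_pihalf sin_pihalf mulr0 add0r mulrN mulr1 opprK. Qed.

Lemma sin_dist (a b : R) : `|sin a - sin b| <= `|a - b|.
Proof.
rewrite -!sin_cos_shift; apply: le_trans (cos_dist _ _) _.
by have -> : a + - (pi / 2) - (b + - (pi / 2)) = a - b by ring.
Qed.

Lemma expi_dist (a b : R) : nrm (expi a - expi b : Cplx R) <= 2 * `|a - b|.
Proof.
apply: le_trans (nrm_ReIm _) _ => /=.
by rewrite mulrDl mul1r lerD ?cos_dist ?sin_dist.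
Qed.

Lemma continuous_expi (c : R) : continuous (fun t => expi (t * c) : Cplx R).
Proof.
have E : (fun t : R => t * c) = (fun t => c * t + 0).
  by apply/funext => t; rewrite addr0 mulrC.
have E' (h : R -> R) : (fun t => h (t * c)) = (fun t => h (c * t + 0)).
  by apply/funext => t; rewrite addr0 mulrC.
apply/continuous_ReIm; split => /=.
  by rewrite (E' cos) => t; exact: continuous_cos_affine.
by rewrite (E' sin) => t; exact: continuous_sin_affine.
Qed.

Section TestFunction.
Variable F : R -> R[i].
Hypothesis tF : test_function F.
Let F1 y := complex.Re (F y).
Let F2 y := complex.Im (F y).

Lemma test_function_compact_smooth : compact_smooth F1 /\ compact_smooth F2.
Proof.
have [s1 s2 cF] := tF; move: (cF) => /compact_bounded[M [_ MP]].
have M1 : M < `|M| + 1 by rewrite (le_lt_trans (ler_norm M)) // ltrDl.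
have F0 y : `|M| + 2 <= `|y| -> F y = 0.
  move=> My; apply/eqP/negPn/negP => Fy.
  have /= := MP _ M1 y (subset_closure (A := [set y | F y != 0]) Fy).
  by rewrite leNgt => /negP; apply; rewrite (lt_le_trans _ My)// ltrD2l ltr1n.
have P0 : 0 < `|M| + 2 by rewrite ltr_wpDl.
by split; split => //; exists (`|M| + 2) => // y /F0; rewrite /F1 /F2 => ->.
Qed.
Let cs1 := test_function_compact_smooth.1.
Let cs2 := test_function_compact_smooth.2.

Lemma cintegrable_test t : cintegrable (fun y => F y * expi (- (t * y))).
Proof.
have [M1 [P1 [_ _ _ _ d1]]] := compact_smooth_dominated cs1.
have [M2 [P2 [_ _ _ _ d2]]] := compact_smooth_dominated cs2.
have n1 (y : R) : `|1| <= 1 :> R by rewrite normr1.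
have := (d1 (fun=> 1) (@cst_continuous _ _ _) n1).2.
have := (d2 (fun=> 1) (@cst_continuous _ _ _) n1).2.
move=> b2 b1; apply: (@cdominated_integrable _ _ (M1 * (1 + P1 ^+ 2) + M2 * (1 + P2 ^+ 2))).
apply: continuous_cdominated.
  have E : (fun y => expi (- (t * y))) = (fun y => expi (y * - t)).
    by apply/funext => z; rewrite mulrN mulrC.
  move=> y; apply: (@continuous_mulc _ _ F (fun y => expi (- (t * y)))).
    apply/continuous_ReIm_at; split.
      exact: (smooth_continuous cs1.1).
    exact: (smooth_continuous cs2.1).
  by rewrite E; exact: continuous_expi.
move=> y; rewrite nrmM nrm_expi mulr1 mulrDl; apply: le_trans (nrm_ReIm _) _.
apply: lerD; first by have := b1 y; rewrite mulr1.
by have := b2 y; rewrite mulr1.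
Qed.

Lemma inv_fourier_expi x t : inv_fourier F t * expi (t * x) =
  ((2 * pi)^-1)%:C%C *
  ((cosine_at F1 x 0 t - cosine_at F2 x (- (pi / 2)) t) +i*
   (cosine_at F2 x 0 t + cosine_at F1 x (- (pi / 2)) t))%C.
Proof.
rewrite /inv_fourier -mulrA; congr (_ * _).
rewrite mulrC -cintegralZ; last exact: cintegrable_test.
have [M1 [P1 [_ _ _ _ d1]]] := compact_smooth_dominated cs1.
have [M2 [P2 [_ _ _ _ d2]]] := compact_smooth_dominated cs2.
have cc th : continuous (fun y => cos (t * (x - y) + th)).
  rewrite (_ : (fun y => _) = fun y => cos (- t * y + (t * x + th))).
    by move=> y; exact: continuous_cos_affine.
  by apply/funext => y; congr cos; ring.
have i1 th := dominated_integrable (d1 _ (cc th) (fun y => cos_norm_le1 _)).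
have i2 th := dominated_integrable (d2 _ (cc th) (fun y => cos_norm_le1 _)).
have E y : expi (t * x) * (F y * expi (- (t * y))) =
    ((F1 y * cos (t * (x - y) + 0) - F2 y * cos (t * (x - y) + - (pi / 2))) +i*
     (F2 y * cos (t * (x - y) + 0) + F1 y * cos (t * (x - y) + - (pi / 2))))%C.
  rewrite mulrCA -expiD -mulrBr sin_cos_shift addr0 /F1 /F2 /expi; case: (F y) => a b.
  by apply/eqP; rewrite eq_complex/=; apply/andP; split; apply/eqP; ring.
rewrite /cintegral /cosine_at -RintegralB// -RintegralD//; congr (_ +i* _)%C.
  by apply: eq_Rintegral => y _; rewrite E.
by apply: eq_Rintegral => y _; rewrite E.
Qed.

(** The second bound, with the factor [|t|], makes [fourier_inverse] Lipschitz and controls the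
    interpolation error in [fourier_interchange]. *)
Lemma inv_fourier_dominated : exists2 K, 0 <= K & forall t,
  nrm (inv_fourier F t : Cplx R) <= K * weight t /\
  `|t| * nrm (inv_fourier F t : Cplx R) <= K * weight t.
Proof.
have [K1 K10 h1] := dominated_cosine_at cs1.
have [K2 K20 h2] := dominated_cosine_at cs2.
pose c := `|(2 * pi)^-1 : R|.
have c0 : 0 <= c by exact: normr_ge0.
exists (c * (2 * (K1 + K2))) => [|t]; first by rewrite !mulr_ge0 ?addr_ge0.
have E : nrm (inv_fourier F t : Cplx R) <= c *
    (`|cosine_at F1 0 0 t| + `|cosine_at F2 0 (- (pi / 2)) t| +
     (`|cosine_at F2 0 0 t| + `|cosine_at F1 0 (- (pi / 2)) t|)).
  have := inv_fourier_expi 0 t; rewrite mulr0 expi0 mulr1 => ->.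
  rewrite nrmM nrm_real ler_wpM2l//; apply: le_trans (nrm_ReIm _) _ => /=.
  by apply: lerD; [exact: ler_normB|exact: ler_normD].
have [[_ a1] [_ b1]] := h1 0 0; have [[_ a2] [_ b2]] := h1 0 (- (pi / 2)).
have [[_ a3] [_ b3]] := h2 0 0; have [[_ a4] [_ b4]] := h2 0 (- (pi / 2)).
split.
  apply: le_trans E _; rewrite -mulrA ler_wpM2l//.
  have := a1 t; have := a2 t; have := a3 t; have := a4 t; lra.
apply: (le_trans (ler_wpM2l (normr_ge0 t) E)); rewrite mulrCA -mulrA ler_wpM2l//.
have := b1 t; have := b2 t; have := b3 t; have := b4 t; rewrite !normrM !normr_id.
rewrite !mulrDr; lra.
Qed.

Lemma continuous_inv_fourier : continuous (inv_fourier F : R -> Cplx R).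
Proof.
have -> : inv_fourier F = fun t => ((2 * pi)^-1)%:C%C *
  ((cosine_at F1 0 0 t - cosine_at F2 0 (- (pi / 2)) t) +i*
   (cosine_at F2 0 0 t + cosine_at F1 0 (- (pi / 2)) t))%C.
  by apply/funext => t; rewrite -inv_fourier_expi mulr0 expi0 mulr1.
move=> t; apply: (@continuous_mulc _ _ (fun=> ((2 * pi)^-1)%:C%C) (fun t =>
  ((cosine_at F1 0 0 t - cosine_at F2 0 (- (pi / 2)) t) +i*
   (cosine_at F2 0 0 t + cosine_at F1 0 (- (pi / 2)) t))%C)); first exact: cvg_cst.
have c1 th := @continuous_cosine_at _ F1 cs1 0 th.
have c2 th := @continuous_cosine_at _ F2 cs2 0 th.
apply/continuous_ReIm_at; split => /=.
  by apply: cvgB; [exact: c1|exact: c2].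
by apply: cvgD; [exact: c2|exact: c1].
Qed.

Lemma continuous_inv_fourier_expi x :
  continuous (fun t => inv_fourier F t * expi (t * x) : Cplx R).
Proof.
move=> t; apply: (@continuous_mulc _ _ (inv_fourier F) (fun t => expi (t * x))).
  exact: continuous_inv_fourier.
exact: continuous_expi.
Qed.

Definition fourier_inverse x : R[i] := cintegral (fun t => inv_fourier F t * expi (t * x)).

Lemma cintegrable_fourier_inverse x : cintegrable (fun t => inv_fourier F t * expi (t * x)).
Proof.
have [K K0 h] := inv_fourier_dominated; apply: (@cdominated_integrable _ _ K).
apply: continuous_cdominated => t; first exact: continuous_inv_fourier_expi.
by rewrite nrmM nrm_expi mulr1; have [] := h t.
Qed.

Lemma fourier_inverse_lipschitz : exists2 K, 0 <= K & forall x y,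
  nrm (fourier_inverse x - fourier_inverse y : Cplx R) <= K * `|x - y|.
Proof.
have [K K0 h] := inv_fourier_dominated; exists (4 * K * weight_mass).
  by rewrite !mulr_ge0 ?weight_mass_ge0.
move=> x y; have ix := cintegrable_fourier_inverse x; have iy := cintegrable_fourier_inverse y.
have -> : fourier_inverse x - fourier_inverse y =
    cintegral (fun t => -1 * (inv_fourier F t * expi (t * y)) + inv_fourier F t * expi (t * x)).
  by rewrite cintegralD// ?cintegralZ ?mulN1r 1?addrC//; exact: cintegrableZ.
rewrite (_ : 4 * K * weight_mass * `|x - y| = 2 * (2 * K * `|x - y|) * weight_mass); last by ring.
apply: cintegral_le; apply: continuous_cdominated => t.
  apply: cvgD; last exact: continuous_inv_fourier_expi.
  apply: (@continuous_mulc _ _ (fun=> -1) (fun t => inv_fourier F t * expi (t * y))).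
    exact: cvg_cst.
  exact: continuous_inv_fourier_expi.
rewrite mulN1r addrC -mulrBr nrmM.
apply: (le_trans (ler_wpM2l (nrm_ge0 _) (expi_dist _ _))).
rewrite -mulrBr normrM; have := (h t).2; have := normr_ge0 (x - y).
move=> d0 ht; rewrite [leLHS](_ : _ = 2 * `|x - y| * (`|t| * nrm (inv_fourier F t : Cplx R))); last by ring.
by rewrite [leRHS](_ : _ = 2 * `|x - y| * (K * weight t)); [rewrite ler_wpM2l// mulr_ge0|ring].
Qed.

Lemma fourier_inverse_off_support x : ~ closure [set y | F y != 0] x ->
  fourier_inverse x = 0.
Proof.
move=> nx; have : nbhs x (~` closure [set y | F y != 0]).
  by apply: open_nbhs_nbhs; split => //; exact/closed_openC/closed_closure.
move=> /nbhs_ballP[d /= d0 hd].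
have Fd y : F y != 0 -> d <= `|x - y|.
  move=> Fy; rewrite leNgt; apply/negP => xy.
  by apply: (hd y) => //; exact: subset_closure.
have z1 th : \int[mu]_t cosine_at F1 x th t = 0.
  apply: (cosine_at_off_support cs1 th d0) => y Fy; apply: Fd.
  by apply: contra Fy => /eqP E; rewrite /F1 E.
have z2 th : \int[mu]_t cosine_at F2 x th t = 0.
  apply: (cosine_at_off_support cs2 th d0) => y Fy; apply: Fd.
  by apply: contra Fy => /eqP E; rewrite /F2 E.
have [K1 K10 h1] := dominated_cosine_at cs1.
have [K2 K20 h2] := dominated_cosine_at cs2.
have i1 th := dominated_integrable (h1 x th).1.
have i2 th := dominated_integrable (h2 x th).1.
rewrite /fourier_inverse (_ : (fun t => _) = fun t => ((2 * pi)^-1)%:C%C *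
  ((cosine_at F1 x 0 t - cosine_at F2 x (- (pi / 2)) t) +i*
   (cosine_at F2 x 0 t + cosine_at F1 x (- (pi / 2)) t))%C); last first.
  by apply/funext => t; rewrite inv_fourier_expi.
rewrite cintegralZ; last by split; [exact: integrableB (i1 _) (i2 _)|exact: integrableD (i2 _) (i1 _)].
by rewrite /cintegral/= RintegralB// RintegralD// !z1 !z2 subrr addr0 mulr0.
Qed.

Lemma fourier_inverse_neq0 x (de et : R) : 0 < de -> 0 < et ->
  (forall y, F y = (F1 y)%:C%C) -> (forall y, 0 <= F1 y) ->
  (forall y, `|x - y| <= et -> de <= F1 y) -> fourier_inverse x <> 0.
Proof.
move=> de0 et0 FE F10 Fde; have F20 y : F2 y = 0 by rewrite /F2 FE.
have J := cosine_at_bump cs1 de0 et0 F10 Fde.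
have [K1 K10 h1] := dominated_cosine_at cs1.
have z2 th t : cosine_at F2 x th t = 0.
  rewrite /cosine_at (_ : (fun y => _) = fun=> 0) ?Rintegral_cst ?mul0r//.
  by apply/funext => y; rewrite F20 mul0r.
have E t : complex.Re (inv_fourier F t * expi (t * x)) = (2 * pi)^-1 * cosine_at F1 x 0 t.
  by rewrite inv_fourier_expi !z2/= mul0r !subr0.
rewrite /fourier_inverse /cintegral => /(congr1 (@complex.Re R))/=.
rewrite -[LHS]/(\int[mu]_t complex.Re (inv_fourier F t * expi (t * x))).
under eq_Rintegral do rewrite E.
rewrite RintegralZl//; last exact: dominated_integrable (h1 x 0).1.
by move/eqP; rewrite mulf_eq0 (gt_eqF J) orbF invr_eq0 mulf_eq0 (gt_eqF (pi_gt0 R)) orbF pnatr_eq0.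
Qed.

End TestFunction.
End FourierInversion.

(** * Smooth bumps on the real line *)

Section SmoothBump.
Context {R : realType}.
Implicit Types (t x y : R) (n : nat).

(** The powers of [1/x] are included so that the derivative of a member of the family is a
    combination of members. *)
Definition flat n x : R := if 0 < x then x^-1 ^+ n * expR (- x^-1) else 0.

Lemma flat_ge0 n x : 0 <= flat n x.
Proof.
rewrite /flat; case: ifPn => // x0.
by rewrite mulr_ge0 ?expR_ge0// exprn_ge0// invr_ge0 ltW.
Qed.

(** With [u = 1/x], the exponential series gives [u^(n+1) <= (n+1)! e^u]. *)
Lemma flat_le n : exists2 C, 0 <= C & forall x, flat n x <= C * `|x|.
Proof.
exists (n.+1`!%:R) => [|x]; first exact: ler0n.
rewrite /flat; case: ifPn => [x0|_]; last by rewrite mulr_ge0// ler0n.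
rewrite (ger0_norm (ltW x0)); pose u := x^-1; have u0 : 0 < u by rewrite invr_gt0.
have k0 : 0 < n.+1`!%:R :> R by rewrite ltr0n fact_gt0.
have h : u ^+ n.+1 <= n.+1`!%:R * expR u.
  rewrite mulrC -ler_pdivrMr//; apply: le_trans (expR_ge1Dxn n (ltW u0)).
  by rewrite lerDr.
have xu : x = u^-1 by rewrite invrK.
rewrite -/u expRN [in leRHS]xu ler_pdivrMr ?expR_gt0// mulrAC ler_pdivlMr//.
by rewrite -exprSr.
Qed.

Lemma is_derive_flat n x : is_derive x 1 (flat n) (- n%:R * flat n.+1 x + flat n.+2 x).
Proof.
have [x0|x0|->] := ltgtP x 0.
- have z m : flat m x = 0 by rewrite /flat ltNge (ltW x0).
  rewrite !z mulr0 addr0; apply: (@near_eq_is_derive _ _ _ (fun=> 0)).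
  near=> y; rewrite /flat ltNge (_ : y <= 0)//; apply: ltW; near: y.
  exact: lt_nbhsl.
- have xn0 : x != 0 by rewrite gt_eqF.
  have sc (a b : R) : a *: b = a * b by [].
  have d1 : is_derive x 1 (fun y : R => y^-1) (- (x^-1 * x^-1)).
    apply: (is_derive_eq (is_deriveV (f := id) xn0 (is_derive_id x 1))).
    by rewrite sc mulr1 -invfM -expr2.
  have d2 m : is_derive x 1 (fun y : R => y^-1 ^+ m * expR (- y^-1))
      (- m%:R * (x^-1 ^+ m.+1 * expR (- x^-1)) + x^-1 ^+ m.+2 * expR (- x^-1)).
    elim: m => [|m ih].
      have -> : (fun y : R => y^-1 ^+ 0 * expR (- y^-1)) = (fun y => expR (- y^-1)).
        by apply/funext => y; rewrite expr0 mul1r.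
      by apply: is_derive_eq; ring.
    have -> : (fun y : R => y^-1 ^+ m.+1 * expR (- y^-1)) =
        (fun y => y^-1 * (y^-1 ^+ m * expR (- y^-1))).
      by apply/funext => y; rewrite exprS mulrA.
    apply: is_derive_eq; rewrite !sc !exprS -[m.+1]addn1 natrD; ring.
  apply: (@near_eq_is_derive _ _ _ (fun y => y^-1 ^+ n * expR (- y^-1))).
    near=> y; rewrite /flat (_ : 0 < y)//; near: y; exact: lt_nbhsr.
  by rewrite /flat x0.
have z m : flat m 0 = 0 by rewrite /flat ltxx.
rewrite !z mulr0 addr0.
(* At 0 the difference quotient of [flat n] has absolute value [flat n.+1 h], which tends to 0
   linearly. *)
have [C C0 hC] := flat_le n.+1.
have L : (h^-1 *: (flat n (h *: 1 + 0) - flat n 0)) @[h --> 0^'] --> (0 : R).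
  apply/cvgrPdist_lt => e e0; near=> h.
  have h0 : h != 0 by near: h; exact: nbhs_dnbhs_neq.
  rewrite sub0r normrN -[h *: 1]/(h * 1) mulr1 addr0 z subr0.
  rewrite -[_ *: _]/(_ * _).
  have -> : `|h^-1 * flat n h| = flat n.+1 h.
    rewrite /flat; case: ifPn => [hp|_]; last by rewrite mulr0 normr0.
    rewrite exprS -mulrA ger0_norm//.
    by rewrite !mulr_ge0 ?expR_ge0 ?exprn_ge0 ?invr_ge0 ?(ltW hp).
  apply: le_lt_trans (hC h) _.
  have he : `|h| < e / (C + 1).
    by near: h; apply: dnbhs0_lt; rewrite divr_gt0// ltr_wpDl.
  have : `|h| * (C + 1) < e by rewrite -ltr_pdivlMr// ltr_wpDl.
  have := normr_ge0 h; nra.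
split; first by apply/cvg_ex; exists 0; exact: L.
exact: cvg_lim L.
Unshelve. all: by end_near. Qed.

(* Contains all products [flat n (a + x) * flat m (b - x)] and is closed under
   derivation. *)
Inductive flat_class : (R -> R) -> Prop :=
| flat_base n (a : R) : flat_class (fun x => flat n (a + x))
| flat_refl n (a : R) : flat_class (fun x => flat n (a - x))
| flat_add f g : flat_class f -> flat_class g -> flat_class (fun x => f x + g x)
| flat_mul f g : flat_class f -> flat_class g -> flat_class (fun x => f x * g x)
| flat_scale (k : R) f : flat_class f -> flat_class (fun x => k * f x).

Lemma flat_class_derive f : flat_class f ->
  exists2 g, flat_class g & forall x, is_derive x 1 f (g x).
Proof.
have sc (a b : R) : a *: b = a * b by [].
elim=> [n a|n a|f1 f2 _ [g1 G1 d1] _ [g2 G2 d2]|f1 f2 F1 [g1 G1 d1] F2 [g2 G2 d2]|k f1 _ [g1 G1 d1]].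
- exists (fun x => - n%:R * flat n.+1 (a + x) + flat n.+2 (a + x)).
    by apply: flat_add; [apply: flat_scale|]; exact: flat_base.
  move=> x; have h := is_derive_flat n (a + x).
  have h' : is_derive x 1 (fun x : R => a + x) 1.
    by apply: is_derive_eq; ring.
  by apply: is_derive_eq; rewrite ?sc; ring.
- exists (fun x => -1 * (- n%:R * flat n.+1 (a - x) + flat n.+2 (a - x))).
    by apply: flat_scale; apply: flat_add; [apply: flat_scale|]; exact: flat_refl.
  move=> x; have h := is_derive_flat n (a - x).
  have h' : is_derive x 1 (fun x : R => a - x) (-1).
    by apply: is_derive_eq; ring.
  by apply: is_derive_eq; rewrite ?sc; ring.
- by exists (fun x => g1 x + g2 x); [exact: flat_add|move=> x; apply: is_derive_eq].
- exists (fun x => f1 x * g2 x + f2 x * g1 x).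
    by apply: flat_add; exact: flat_mul.
  by move=> x; apply: is_derive_eq; rewrite ?sc.
- by exists (fun x => k * g1 x); [exact: flat_scale|move=> x; apply: is_derive_eq; rewrite ?sc].
Qed.

Lemma flat_class_smooth f : flat_class f -> smooth f.
Proof.
move=> Ff n; suff [g G -> x] : exists2 g, flat_class g & derive1n n f = g.
  by have [g' _ d] := flat_class_derive G; have [] := d x.
elim: n => [|n [g G E]]; first by exists f.
have [g' G' d] := flat_class_derive G; exists g' => //.
rewrite /derive1n iterS -/(derive1n n f) E; apply/funext => x.
by rewrite derive1E; have [_] := d x.
Qed.

Lemma smooth_bump (a b : R) : a < b -> exists f : R -> R, [/\ smooth f,
  forall x, 0 <= f x, forall x, f x != 0 -> a < x < b &
  forall x, a < x -> x < b -> 0 < f x].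
Proof.
move=> ab; exists (fun x => flat 0 (- a + x) * flat 0 (b - x)); split.
- by apply: flat_class_smooth; apply: flat_mul; [exact: flat_base|exact: flat_refl].
- by move=> x; rewrite mulr_ge0 ?flat_ge0.
- move=> x; rewrite mulf_eq0 negb_or /flat addrC !subr_gt0.
  by have [ax|ax] := boolP (a < x); have [xb|xb] := boolP (x < b); rewrite ?eqxx ?andbF.
- move=> x ax xb; rewrite /flat addrC !subr_gt0 ax xb.
  by rewrite !mulr_gt0 ?expR_gt0// exprn_gt0// invr_gt0 subr_gt0.
Qed.

End SmoothBump.

Lemma negative_test_function (R : realType) (y0 : R) : y0 < 0 ->
  exists F, [/\ test_function F, closure [set y | F y != 0] `<=` [set y | y < 0] &
    fourier_inverse F y0 <> 0].
Proof.
(* For [y0 < 0] the interval from [2 y0] to [y0 / 2] contains [y0] in its interior and its closure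
   is negative. *)
move=> y00; pose a := 2 * y0; pose b := y0 / 2.
have ay : a < y0 by rewrite /a; lra.
have yb : y0 < b by rewrite /b; lra.
have b0 : b < 0 by rewrite /b; lra.
have [f [sf f0 fab fpos]] := smooth_bump (lt_trans ay yb).
pose F := fun y => (f y)%:C%C : R[i].
have FE y : (F y != 0) = (f y != 0) by rewrite /F -(inj_eq (@complexI R)).
have cl : closure [set y | F y != 0] `<=` `[a, b].
  rewrite [X in _ `<=` X](closure_id _).1; last exact: interval_closed.
  apply: closureS => y /=; rewrite FE in_itv/= => /fab/andP[/ltW-> /ltW->//].
have tF : test_function F.
  split=> //.
    move=> n x; suff -> : derive1n n (fun _ : R => 0 : R) = fun=> 0 by exact: derivable_cst.
    by elim: n => //= n ->; apply/funext => z; rewrite derive1E derive_cst.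
  by apply: (subclosed_compact _ (@segment_compact R a b)) => //; exact: closed_closure.
exists F; split=> //.
  by move=> y /cl/=; rewrite in_itv/= => /andP[_ /le_lt_trans]; exact.
pose de := f y0 / 2.
have fy0 : 0 < f y0 by exact: fpos.
have de0 : 0 < de by rewrite divr_gt0.
have cf : {for y0, continuous f}.
  by apply: differentiable_continuous; apply/derivable1_diffP; exact: (sf 0).
have /cvgrPdist_lt/(_ _ de0)/nbhs_ballP[et /= et0 h] := cf.
have et2 : 0 < et / 2 by rewrite divr_gt0.
apply: (fourier_inverse_neq0 tF de0 et2) => //= y yet.
have : `|f y0 - f y| < de by apply: h; rewrite /ball/=; apply: le_lt_trans yet _; lra.
by rewrite ltr_norml /de => /andP[_]; lra.
Qed.

(** * Exchange of a functional with the inversion integral *)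

Section FourierInterchange.
Context {R : realType}.
Local Notation mu := (@lebesgue_measure R).
(** [L u] stands for the value of a continuous functional at [iota ((u o c) f)], and [[-M, M]] for
    an interval containing the values of [c] where [f] is nonzero. In this form the vector integral
    becomes a question about functions on a bounded interval. *)
Variables (F : R -> R[i]) (L : (R -> Cplx R) -> Cplx R) (C M : R).
Hypothesis tF : test_function F.
Hypothesis C0 : 0 <= C.
Hypothesis M0 : 0 <= M.
Hypothesis L_lin : forall (k : R[i]) (u v : R -> Cplx R), continuous u -> continuous v ->
  L (fun y => k * u y + v y) = k * L u + L v.
Hypothesis L_le : forall (u : R -> Cplx R) S, continuous u -> 0 <= S ->
  (forall y, `|y| <= M -> nrm (u y) <= S) -> nrm (L u) <= C * S.

Let ex t y : Cplx R := expi (t * y).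

Let cex t : continuous (ex t).
Proof.
rewrite /ex (_ : (fun y => _) = fun y => expi (y * t)); first exact: continuous_expi.
by apply/funext => y; rewrite mulrC.
Qed.

Let L0 : L (fun=> 0) = 0.
Proof.
apply: nrm_eq0; apply/eqP; rewrite eq_le nrm_ge0 andbT -(mulr0 C).
by apply: L_le => // [|y _]; [exact: cst_continuous|rewrite nrm0].
Qed.

Let csub (u v : R -> Cplx R) : continuous u -> continuous v ->
  continuous (fun y => u y - v y).
Proof.
move=> /continuous_ReIm[u1 u2] /continuous_ReIm[v1 v2]; apply/continuous_ReIm; split=> y.
  rewrite (_ : (fun y => _) = fun y => complex.Re (u y) - complex.Re (v y)).
    by apply: cvgB; [exact: u1|exact: v1].
  by apply/funext => z; rewrite raddfB.
rewrite (_ : (fun y => _) = fun y => complex.Im (u y) - complex.Im (v y)).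
  by apply: cvgB; [exact: u2|exact: v2].
by apply/funext => z; rewrite raddfB.
Qed.

Let L_sub (u v : R -> Cplx R) : continuous u -> continuous v -> L (fun y => u y - v y) = L u - L v.
Proof.
move=> cu cv; have := L_lin (-1) cv cu; rewrite mulN1r addrC => <-; congr L.
by apply/funext => y; rewrite mulN1r addrC.
Qed.

Let continuous_sum (J : Type) (s : seq J) (p : J -> R -> Cplx R) (k : J -> Cplx R) :
  (forall j, continuous (p j)) -> continuous (fun y => \sum_(j <- s) k j * p j y).
Proof.
move=> cp; elim: s => [|j s ih].
  rewrite (_ : (fun y => _) = fun=> 0); first exact: cst_continuous.
  by apply/funext => y; rewrite big_nil.
rewrite (_ : (fun y => _) = fun y => k j * p j y + \sum_(j <- s) k j * p j y).
  move=> y; apply: cvgD; last exact: ih.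
  by apply: (@continuous_mulc _ _ (fun=> k j) (p j)); [exact: cvg_cst|exact: cp].
by apply/funext => y; rewrite big_cons.
Qed.

Let L_sum (J : Type) (s : seq J) (p : J -> R -> Cplx R) (k : J -> Cplx R) :
  (forall j, continuous (p j)) ->
  L (fun y => \sum_(j <- s) k j * p j y) = \sum_(j <- s) k j * L (p j).
Proof.
move=> cp; elim: s => [|j s ih].
  by rewrite big_nil -L0; congr L; apply/funext => y; rewrite big_nil.
rewrite big_cons -ih -L_lin//; last exact: continuous_sum.
by congr L; apply/funext => y; rewrite big_cons.
Qed.

Lemma continuous_interchange : continuous (fun t => L (ex t)).
Proof.
move=> t; apply/continuous_nrmP => e e0.
have CM : 0 < 2 * C * M + 1 by rewrite ltr_wpDl// !mulr_ge0.
have d0 : 0 < e / (2 * C * M + 1) by rewrite divr_gt0.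
apply/nbhs_ballP; exists (e / (2 * C * M + 1)) => //= s; rewrite /ball/= => ts.
rewrite -L_sub//; apply: (@le_lt_trans _ _ (C * (2 * `|t - s| * M))).
  apply: L_le => [||y yM]; first exact: csub.
    by rewrite !mulr_ge0.
  apply: le_trans (expi_dist _ _) _; rewrite -mulrBl normrM mulrA.
  by rewrite ler_wpM2l// mulr_ge0.
move: ts; rewrite ltr_pdivlMr//; have := normr_ge0 (t - s); nra.
Qed.

Let integrand_cdominated (K : R) (v : R -> Cplx R) (S : R) :
  (forall t, nrm (inv_fourier F t : Cplx R) <= K * weight t) ->
  continuous v -> (forall t, nrm (v t) <= S) ->
  cdominated (fun t => inv_fourier F t * v t) (K * S).
Proof.
move=> hK cv vS; apply: continuous_cdominated => t.
  by apply: (@continuous_mulc _ _ (inv_fourier F) v); [exact: continuous_inv_fourier|exact: cv].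
rewrite nrmM mulrAC; apply: ler_pM => //; exact: nrm_ge0.
Qed.

Lemma interchange_integrable : cintegrable (fun t => inv_fourier F t * L (ex t)).
Proof.
have [K K0 hK] := inv_fourier_dominated tF.
apply: (cdominated_integrable (integrand_cdominated (S := C) (fun t => (hK t).1) continuous_interchange _)).
move=> t; rewrite -[leRHS]mulr1; apply: L_le => [||y _]; [exact: cex|exact: ler01|].
by rewrite /ex nrm_expi.
Qed.

(** The clamp of [z] to [[0, 1]], written with absolute values. *)
Let ramp (z : R) := (`|z| - `|z - 1| + 1) / 2.

Let ramp0 z : z <= 0 -> ramp z = 0.
Proof. by move=> z0; rewrite /ramp !ler0_norm ?subr_le0; lra. Qed.

Let ramp1 z : 1 <= z -> ramp z = 1.
Proof. by move=> z1; rewrite /ramp !ger0_norm ?subr_ge0; lra. Qed.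

Let ramp_mono z : ramp (z - 1) <= ramp z.
Proof.
rewrite /ramp; have [a|a] := ler0P z; have [b|b] := ler0P (z - 1);
  have [d|d] := ler0P (z - 1 - 1); lra.
Qed.

(** The piecewise linear hat function with peak at the grid point [j e - M] and half-width [e]. As a
    difference of consecutive ramps it has telescoping sums, equal to 1 on [[-M, M]] as soon as the
    grid covers this interval. *)
Let bump (e : R) (j : nat) (y : R) : R :=
  let w := (y + M) / e + 1 - j%:R in ramp w - ramp (w - 1).

Let continuous_bump e j : continuous (bump e j).
Proof.
have cn (b : R) : continuous (fun y : R => `|(y + M) / e + 1 - b|).
  move=> y; apply: cvg_norm; apply: cvgB; last exact: cvg_cst.
  apply: cvgD; last exact: cvg_cst.
  apply: cvgMl; apply: cvgD; [exact: cvg_id|exact: cvg_cst].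
have cr (b : R) : continuous (fun y : R => ramp ((y + M) / e + 1 - b)).
  rewrite (_ : (fun y => _) = fun y => (`|(y + M) / e + 1 - b| -
      `|(y + M) / e + 1 - (b + 1)| + 1) / 2).
    by move=> y; apply: cvgMl; apply: cvgD; [apply: cvgB; exact: cn|exact: cvg_cst].
  by apply/funext => y; rewrite /ramp opprD addrA.
rewrite (_ : bump e j = fun y => ramp ((y + M) / e + 1 - j%:R) -
    ramp ((y + M) / e + 1 - (j%:R + 1))).
  by move=> y; apply: cvgB; exact: cr.
by apply/funext => y; rewrite /bump opprD addrA.
Qed.

Let bump_ge0 e j y : 0 <= bump e j y.
Proof. by rewrite subr_ge0 ramp_mono. Qed.

Let bump_near e j y : 0 < e -> bump e j y != 0 -> `|y - (j%:R * e - M)| <= e.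
Proof.
move=> e0; rewrite /bump; set w := _ + 1 - _ => h.
have w0 : 0 < w by rewrite ltNge; apply: contra h => w0; rewrite !ramp0 ?subrr//; lra.
have w2 : w < 2 by rewrite ltNge; apply: contra h => w2; rewrite !ramp1 ?subrr//; lra.
have -> : y - (j%:R * e - M) = (w - 1) * e.
  rewrite (_ : (w - 1) * e = (y + M) / e * e - j%:R * e); last by rewrite /w; ring.
  by rewrite divfK ?gt_eqF//; ring.
rewrite normrM (gtr0_norm e0) ger_pMl// ler_norml; lra.
Qed.

Let bump_sum e y (N : nat) : 0 < e -> (2 * M) / e + 1 <= N%:R -> `|y| <= M ->
  \sum_(j < N) bump e j y = 1.
Proof.
move=> e0 hN; rewrite ler_norml => /andP[y1 y2].
have -> : \sum_(j < N) bump e j y =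
    ramp ((y + M) / e + 1) - ramp ((y + M) / e + 1 - N%:R).
  elim: N {hN} => [|N ih]; first by rewrite big_ord0 subr0 subrr.
  rewrite big_ord_recr/= ih /bump -natr1 opprD !addrA; lra.
have h1 : 0 <= (y + M) / e by rewrite divr_ge0 ?(ltW e0)//; lra.
have h2 : (y + M) / e <= (2 * M) / e by rewrite ler_pM2r ?invr_gt0//; lra.
by rewrite ramp1 ?ramp0 ?subr0//; lra.
Qed.

Let approx (e : R) (N : nat) (u : R -> Cplx R) y : Cplx R :=
  \sum_(j < N) u (j%:R * e - M) * (bump e j y)%:C%C.

Let approx_le e N (u : R -> Cplx R) (K : R) y : 0 < e -> 0 <= K ->
  (forall x y, nrm (u x - u y) <= K * `|x - y|) ->
  (2 * M) / e + 1 <= N%:R -> `|y| <= M -> nrm (u y - approx e N u y) <= K * e.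
Proof.
move=> e0 K0 uK hN yM; have S1 := bump_sum e0 hN yM.
have -> : u y = \sum_(j < N) u y * (bump e j y)%:C%C.
  by rewrite -mulr_sumr -(raddf_sum (real_complex R)) S1 mulr1.
rewrite /approx -sumrB.
apply: (@le_trans _ _ (\sum_(j < N) K * e * bump e j y)); last first.
  by rewrite -mulr_sumr S1 mulr1.
elim/big_ind2: _ => [|x1 x2 z1 z2 h1 h2|j _]; first by rewrite nrm0.
  by apply: le_trans (nrmD _ _) _; exact: lerD.
rewrite -mulrBl nrmM nrm_real (ger0_norm (bump_ge0 _ _ _)).
have [->|nz] := eqVneq (bump e j y) 0; first by rewrite !mulr0.
rewrite ler_wpM2r//; apply: le_trans (uK _ _) _; rewrite ler_wpM2l//.
exact: bump_near.
Qed.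

Let cbump e j : continuous (fun y => (bump e j y)%:C%C : Cplx R).
Proof. by move=> y; apply: continuous_real_complex; exact: continuous_bump. Qed.

Let continuous_approx e N u : continuous (approx e N u).
Proof. by apply: continuous_sum => j; exact: cbump. Qed.

Let L_approx e N u : L (approx e N u) =
  \sum_(j < N) u (j%:R * e - M) * L (fun y => (bump e j y)%:C%C).
Proof. by apply: L_sum => j; exact: cbump. Qed.

Lemma continuous_fourier_inverse : continuous (fourier_inverse F : R -> Cplx R).
Proof.
have [K K0 h] := fourier_inverse_lipschitz tF; move=> x; apply/continuous_nrmP => e e0.
have K1 : 0 < K + 1 by rewrite ltr_wpDl.
apply/nbhs_ballP; exists (e / (K + 1)) => /=; first by rewrite divr_gt0.
move=> y; rewrite /ball/= ltr_pdivlMr// => xy; apply: le_lt_trans (h _ _) _.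
have := normr_ge0 (x - y); nra.
Qed.

Let interchange_approx e N : cintegrable (fun t => inv_fourier F t * L (approx e N (ex t))) /\
  L (approx e N (fourier_inverse F)) =
  cintegral (fun t => inv_fourier F t * L (approx e N (ex t))).
Proof.
have E : (fun t => inv_fourier F t * L (approx e N (ex t))) = fun t =>
    \sum_(j < N) L (fun y => (bump e j y)%:C%C) * (inv_fourier F t * ex t (j%:R * e - M)).
  apply/funext => t; rewrite L_approx mulr_sumr; apply: eq_bigr => j _.
  by rewrite mulrA mulrC.
have ij (j : 'I_N) := cintegrable_fourier_inverse tF (j%:R * e - M).
have [i1 i2] := @cintegral_sum R _ (index_enum 'I_N) (fun j t =>
  L (fun y => (bump e j y)%:C%C) * (inv_fourier F t * ex t (j%:R * e - M)))
  (fun j => cintegrableZ _ (ij j)).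
rewrite E; split=> //; rewrite i2 L_approx; apply: eq_bigr => j _.
by rewrite mulrC -[RHS]/(cintegral (fun t => _ * (inv_fourier F t * expi (t * (j%:R * e - M))))) cintegralZ//.
Qed.

(* The difference is estimated by replacing both sides by the interpolation
   on a grid of mesh [e], where the interchange is that of a finite sum. *)
Lemma fourier_interchange :
  L (fourier_inverse F) = cintegral (fun t => inv_fourier F t * L (ex t)).
Proof.
have [K K0 hK] := inv_fourier_dominated tF.
have [W W0 hW] := fourier_inverse_lipschitz tF.
apply/eqP; rewrite -subr_eq0; apply/eqP.
apply: (@nrm_small _ _ _ (C * W + 2 * (2 * C * K) * weight_mass)) => e e0 _.
pose N := (Num.truncn ((2 * M) / e + 1)).+1.
have hN : (2 * M) / e + 1 <= N%:R by exact/ltW/truncnS_gt.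
have [ia Ea] := interchange_approx e N; have ii := interchange_integrable.
(* As a function of [y], [expi (t * y)] has Lipschitz constant [2 |t|]; the growth in [t] is
   absorbed by the bound on [|t|] times [inv_fourier]. *)
have cd t : nrm (L (ex t) - L (approx e N (ex t))) <= C * (2 * `|t| * e).
  rewrite -L_sub; [|exact: cex|exact: continuous_approx].
  apply: L_le => [||y yM].
  - by apply: csub; [exact: cex|exact: continuous_approx].
  - by apply: mulr_ge0; [rewrite mulr_ge0|exact: ltW].
  apply: approx_le => //.
  by move=> x z; apply: le_trans (expi_dist _ _) _; rewrite -mulrBr normrM mulrA.
have -> : L (fourier_inverse F) - cintegral (fun t => inv_fourier F t * L (ex t)) =
    (L (fourier_inverse F) - L (approx e N (fourier_inverse F))) +
    cintegral (fun t => -1 * (inv_fourier F t * L (ex t)) +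
      inv_fourier F t * L (approx e N (ex t))).
  rewrite cintegralD//; last exact: cintegrableZ.
  by rewrite cintegralZ// Ea mulN1r [- _ + _]addrC addrA subrK.
apply: le_trans (nrmD _ _) _; rewrite mulrDl; apply: lerD.
  rewrite -L_sub; [|exact: continuous_fourier_inverse|exact: continuous_approx].
  rewrite -mulrA; apply: L_le => [||y yM].
  - by apply: csub; [exact: continuous_fourier_inverse|exact: continuous_approx].
  - by apply: mulr_ge0 => //; exact: ltW.
  exact: approx_le.
rewrite (_ : _ * weight_mass * e = 2 * (2 * C * K * e) * weight_mass); last by ring.
have mi (h : R -> R) : mu.-integrable setT (EFin \o h) -> measurable_fun setT h.
  by move=> /integrableP[/measurable_EFinP].
have id := cintegrableD (cintegrableZ (-1) ii) ia.
apply: cintegral_le; split; [exact: mi id.1|exact: mi id.2|] => t.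
rewrite mulN1r addrC -mulrBr nrmM nrmB.
apply: (le_trans (ler_wpM2l (nrm_ge0 _) (cd t))).
have := (hK t).2; have := nrm_ge0 (inv_fourier F t : Cplx R) => i0 h.
rewrite [leLHS](_ : _ = 2 * C * e * (`|t| * nrm (inv_fourier F t : Cplx R))); last by ring.
rewrite [leRHS](_ : _ = 2 * C * e * (K * weight t)); last by ring.
by rewrite ler_wpM2l// !mulr_ge0// ltW.
Qed.

End FourierInterchange.

(** * Boundedness of *-automorphisms *)

Section AutomorphismBound.
Context {R : realType} (A : cstarAlgebra R).
Implicit Types a b x q : A.

Lemma complete_geometric (u : nat -> A) (C : R) : 0 <= C ->
  (forall n, nrm (u n.+1 - u n) <= C * 2^-1 ^+ n) ->
  exists q, forall e : R, 0 < e -> exists N, forall n, (N <= n)%N -> nrm (q - u n) < e.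
Proof.
move=> C0 hu.
have p0 n : 0 <= 2^-1 ^+ n :> R by rewrite exprn_ge0// invr_ge0.
have tail N k : nrm (u (N + k)%N - u N) <= 2 * C * 2^-1 ^+ N * (1 - 2^-1 ^+ k).
  elim: k => [|k ih]; first by rewrite addn0 subrr nrm0 expr0 subrr mulr0.
  rewrite addnS; have -> : u (N + k).+1 - u N = (u (N + k).+1 - u (N + k)%N) + (u (N + k)%N - u N).
    by rewrite addrA subrK.
  apply: le_trans (nrmD _ _) _; have := hu (N + k)%N; rewrite exprD exprS; lra.
have small (e : R) : 0 < e -> exists N : nat, 2 * C * 2^-1 ^+ N < e.
  move=> e0; pose N := (Num.truncn (2 * C / e)).+1; exists N.
  have : 2 * C / e < 2 ^+ N.
    by apply: lt_le_trans (truncnS_gt _) _; rewrite -natrX ler_nat; exact/ltnW/ltn_expl.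
  by rewrite exprVn ltr_pdivrMr// ltr_pdivrMr ?exprn_gt0// [e * _]mulrC.
have cu : cauchy (u @ \oo).
  apply: cauchy_exP => e e0; have [|N hN] := small (complex.Re e).
    by rewrite -ltcR -Re_geE ?ltW.
  exists (u N), N => // n /= Nn; rewrite -ball_normE/= normE (Re_geE (ltW e0)) ltcR nrmB.
  apply: le_lt_trans hN; rewrite -(subnKC Nn); apply: le_trans (tail _ _) _.
  by rewrite ler_piMr ?mulr_ge0// gerBl.
have /cauchy_cvg/cvg_ex[q /cvg_nrm h] := cu.
by exists q => e /h[N _ hN]; exists N => n; exact: hN.
Qed.

Let half : R[i] := (2^-1)%:C%C.

Let nrm_half x : nrm (half *: x) = nrm x / 2.
Proof. by rewrite nrmZ nrm_real ger0_norm ?invr_ge0// mulrC. Qed.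

Let halfD x : half *: x + half *: x = x.
Proof.
rewrite -scalerDl -rmorphD/= (_ : 2^-1 + 2^-1 = 1 :> R) ?scale1r//; lra.
Qed.

(* [1 - q] is a square root of [1 - a^2]. *)
Lemma sqrt_one_minus a : cstar a = a -> nrm a <= 2^-1 ->
  exists q, [/\ cstar q = q, cmul q a = cmul a q & q + q = cmul a a + cmul q q].
Proof.
(* Picard iteration for [q = (a^2 + q^2) / 2]. All iterates have norm at most 1/4, so each step
   contracts by at least 1/2, and they inherit from [a] that they are self-adjoint and commute with
   [a]. *)
move=> sa na; pose u := fix u n := if n is n.+1 then half *: (cmul a a + cmul (u n) (u n)) else 0.
have usa n : cstar (u n) = u n.
  elim: n => [|n ih] /=; first by have := cstarB a a; rewrite !subrr.
  by rewrite cstarZ cstarD !cstarM sa ih conjE /half conjc_real.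
have uc n : cmul (u n) a = cmul a (u n).
  elim: n => [|n ih] /=; first by have := cmulBl a a a; have := cmulBr a a a; rewrite !subrr => -> ->.
  by rewrite cmulZl cmulZr cmulDl cmulDr !cmulA -[in LHS](cmulA (u n)) ih cmulA ih.
have un n : nrm (u n) <= 4^-1.
  elim: n => [|n ih] /=; first by rewrite nrm0 invr_ge0.
  rewrite nrm_half; have := nrmD (cmul a a) (cmul (u n) (u n)).
  have := nrm_cmul a a; have := nrm_cmul (u n) (u n).
  have := nrm_ge0 a; have := nrm_ge0 (u n); nra.
have sq x y : cmul x x - cmul y y = cmul x (x - y) + cmul (x - y) y.
  by rewrite cmulBl cmulBr addrA subrK.
have du n : nrm (u n.+1 - u n) <= 1 * 2^-1 ^+ n.
  rewrite mul1r; elim: n => [|n ih].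
    rewrite expr0 [u 0]/(0 : A) subr0; apply: le_trans (un _) _.
    by rewrite invf_le1// ler1n.
  have -> : u n.+2 - u n.+1 = half *: (cmul (u n.+1) (u n.+1) - cmul (u n) (u n)).
    by rewrite -[u n.+2]/(half *: _) -[u n.+1 in X in _ - X]/(half *: _) -scalerBr opprD addrACA subrr add0r.
  rewrite nrm_half sq exprS.
  have := nrmD (cmul (u n.+1) (u n.+1 - u n)) (cmul (u n.+1 - u n) (u n)).
  have := nrm_cmul (u n.+1) (u n.+1 - u n); have := nrm_cmul (u n.+1 - u n) (u n).
  have := un n; have := un n.+1; have := nrm_ge0 (u n.+1 - u n); nra.
have [q hq] := complete_geometric ler01 du; exists q; split.
- apply/eqP; rewrite -subr_eq0; apply/eqP; apply: (@nrm_small _ _ _ 2) => e e0 _.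
  have [N /(_ N (leqnn _)) h] := hq _ e0.
  have -> : cstar q - q = cstar (q - u N) - (q - u N).
    by rewrite cstarB usa opprB addrA subrK.
  apply: le_trans (nrmD _ _) _; rewrite nrmN nrm_cstar; lra.
- apply/eqP; rewrite -subr_eq0; apply/eqP; apply: (@nrm_small _ _ _ (2 * nrm a)) => e e0 _.
  have [N /(_ N (leqnn _)) h] := hq _ e0.
  have -> : cmul q a - cmul a q = cmul (q - u N) a - cmul a (q - u N).
    by rewrite cmulBl cmulBr uc opprB addrA subrK.
  apply: le_trans (nrmD _ _) _; rewrite nrmN.
  have := nrm_cmul (q - u N) a; have := nrm_cmul a (q - u N).
  have := nrm_ge0 a; nra.
- apply/eqP; rewrite -subr_eq0; apply/eqP; apply: (@nrm_small _ _ _ (5 + nrm q)) => e e0 _.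
  have [N h] := hq _ e0; have h1 := h N (leqnn _); have h2 := h N.+1 (leqnSn _).
  have E : u N.+1 + u N.+1 = cmul a a + cmul (u N) (u N) by exact: halfD.
  have -> : q + q - (cmul a a + cmul q q) = (q - u N.+1) + (q - u N.+1) -
      (cmul q (q - u N) + cmul (q - u N) (u N)).
    rewrite -sq [(q - _) + _]addrACA -opprD E !opprD !opprK !addrA.
    by rewrite -[in RHS]addrA (addrC (- _) (cmul (u N) _)) !addrA addrNK.
  apply: le_trans (nrmD _ _) _; rewrite nrmN.
  have := nrmD (q - u N.+1) (q - u N.+1).
  have := nrmD (cmul q (q - u N)) (cmul (q - u N) (u N)).
  have := nrm_cmul q (q - u N); have := nrm_cmul (q - u N) (u N).
  have := un N; have := nrm_ge0 q; have := nrm_ge0 (q - u N); nra.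
Qed.

Variable alpha : A -> A.
Hypothesis aut : cstar_automorphism alpha.

Let alphaM a b : alpha (cmul a b) = cmul (alpha a) (alpha b).
Proof. by have [_ + _ _] := aut; exact. Qed.
Let alpha_star a : alpha (cstar a) = cstar (alpha a).
Proof. by have [_ _ + _] := aut; exact. Qed.
Let alphaD a b : alpha (a + b) = alpha a + alpha b.
Proof. by have [l _ _ _] := aut; have := l 1 a b; rewrite !scale1r. Qed.
Let alphaZ k a : alpha (k *: a) = k *: alpha a.
Proof.
have a0 : alpha 0 = 0 by apply: (addrI (alpha 0)); rewrite -alphaD !addr0.
by have [l _ _ _] := aut; have := l k a 0; rewrite !addr0 a0 addr0.
Qed.

(* [b + s (1 - p)] is formally unitary: [b^2 + (1 - p)^2 = 1]. *)
Let unitary_combination b p x (s : R[i]) : cstar b = b -> cstar p = p ->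
  cmul p b = cmul b p -> p + p = cmul b b + cmul p p -> s^* = - s -> s * s = -1 ->
  nrm (cmul b x + s *: (x - cmul p x)) = nrm x.
Proof.
move=> sb sp pb pp sc ss.
suff E : cmul (cstar (cmul b x + s *: (x - cmul p x))) (cmul b x + s *: (x - cmul p x)) =
    cmul (cstar x) x.
  apply/eqP; rewrite -(@eqrXn2 _ 2) ?nrm_ge0//; apply/eqP.
  by rewrite -!nrm_cstar_mul E.
rewrite cstarD cstarZ cstarB !cstarM sb sp sc.
set y := cstar x.
have K : cmul (cmul y p) x + cmul (cmul y p) x =
    cmul (cmul (cmul y b) b) x + cmul (cmul (cmul y p) p) x.
  by rewrite -[LHS]cmulDl -cmulDr pp cmulDr !cmulA cmulDl.
have K2 : cmul (cmul (cmul y p) b) x = cmul (cmul (cmul y b) p) x.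
  by rewrite -(cmulA y) pb cmulA.
rewrite cmulDl !cmulDr !cmulZl !cmulZr !cmulBl !cmulBr !cmulA K2 scalerA mulNr ss opprK scale1r.
move: K; set P := cmul (cmul y p) x; set bb := cmul (cmul (cmul y b) b) x.
set PP := cmul (cmul (cmul y p) p) x; set t := cmul _ x - _ => K.
rewrite scaleNr -addrA addNKr opprB addrACA -opprD K opprD addrACA subrr addr0.
by rewrite addrC subrK.
Qed.

(** For self-adjoint [b] of norm at most 1/2, left multiplication by the image of [b] is the mean of
    two isometries: the image of the equation for [q] makes [b + i (1 - q)] and [b - i (1 - q)]
    formally unitary, and they make sense as multipliers of an algebra that may lack a unit. Hence
    the image has norm at most 1. Scaling brings in the factor 2, and [a^* a] reduces general [a] to
    the self-adjoint case. *)
Lemma automorphism_bound a : nrm (alpha a) <= 2 * nrm a.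
Proof.
pose s : R[i] := 'i%C.
have ss : s * s = -1 by rewrite -expr2; exact: sqr_i.
have sc : s^* = - s by rewrite conjE /s; apply/eqP; rewrite eq_complex/= oppr0 !eqxx.
have sa2 b : cstar b = b -> nrm b <= 2^-1 -> nrm (alpha b) <= 1.
  move=> sb nb; have [q [sq qb qq]] := sqrt_one_minus sb nb.
  have sab : cstar (alpha b) = alpha b by rewrite -alpha_star sb.
  have sp : cstar (alpha q) = alpha q by rewrite -alpha_star sq.
  have pb : cmul (alpha q) (alpha b) = cmul (alpha b) (alpha q) by rewrite -!alphaM qb.
  have pp : alpha q + alpha q = cmul (alpha b) (alpha b) + cmul (alpha q) (alpha q).
    by rewrite -!alphaM -!alphaD qq.
  have h1 x := unitary_combination x sab sp pb pp sc ss.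
  have h2 x : nrm (cmul (alpha b) x + - s *: (x - cmul (alpha q) x)) = nrm x.
    by apply: unitary_combination => //; rewrite ?mulrNN// rmorphN/= sc.
  have contr x : nrm (cmul (alpha b) x) <= nrm x.
    have := nrmD (cmul (alpha b) x + s *: (x - cmul (alpha q) x))
      (cmul (alpha b) x + - s *: (x - cmul (alpha q) x)).
    rewrite h1 h2 addrACA scaleNr subrr addr0 -{1 2}(scale1r (cmul _ x)) -scalerDl nrmZ.
    rewrite -(natrD _ 1 1) -(rmorph_nat (real_complex R)) nrm_real ger0_norm//; lra.
  have := contr (alpha b); rewrite -{1}sab nrm_cstar_mul; have := nrm_ge0 (alpha b); nra.
have sa b : cstar b = b -> nrm (alpha b) <= 2 * nrm b.
  move=> sb; have [b0|b0] := eqVneq (nrm b) 0.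
    rewrite (nrm_eq0 b0) -(scale0r (0 : A)) alphaZ scale0r nrm0 mulr_ge0//.
    exact: nrm_ge0.
  have bp : 0 < nrm b by rewrite lt_def b0 nrm_ge0.
  pose k := (2 * nrm b)^-1; have k0 : 0 < k by rewrite invr_gt0 mulr_gt0.
  have := sa2 ((k%:C)%C *: b).
  rewrite cstarZ sb conjE conjc_real alphaZ !nrmZ !nrm_real gtr0_norm// => /(_ erefl).
  have kb : k * nrm b = 2^-1 by rewrite /k invfM mulrAC mulfK.
  by rewrite kb lexx => /(_ isT); rewrite /k ler_pdivrMl ?mulr_gt0// mulr1.
have := sa (cmul (cstar a) a); rewrite cstarM cstarK => /(_ erefl).
rewrite alphaM alpha_star !nrm_cstar_mul; have := nrm_ge0 a; have := nrm_ge0 (alpha a).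
nra.
Qed.

End AutomorphismBound.

(** * Smeared elements *)

Section Smearing.
Context {R : realType} {T : topologicalType} (G : groupoid T).
Hypothesis HG : lch_etale G.
Context (A : cstarAlgebra R) (iota : (T -> Cplx R) -> A).
Hypothesis HA : is_groupoid_cstar G iota.
Variables (c : T -> R) (sigma : R -> A -> A).
Hypothesis cc : continuous c.
Hypothesis dyn : is_cocycle_dynamics c iota sigma.
Let hT := lch_hausdorff HG.
Implicit Types (f : T -> Cplx R) (F : R -> R[i]) (a b : A).

Lemma continuous_linear_bounded (l : A -> Cplx R) : linear l -> continuous l ->
  exists2 C, 0 <= C & forall a, nrm (l a) <= C * nrm a.
Proof.
move=> lin cl; have /continuous_nrmP/(_ 1 ltr01)/nbhs_ballP[d /= d0 hd] := cl 0.
have dE := Re_geE (ltW d0); set r := complex.Re d in dE.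
have r0 : 0 < r by rewrite -ltcR -dE.
have l0 : l 0 = 0 by have := lin_scale 0 0 lin; rewrite scale0r mul0r.
exists (2 / r) => [|a]; first by rewrite divr_ge0// ltW.
have [a0|a0] := eqVneq (nrm a) 0.
  by rewrite a0 (nrm_eq0 a0) l0 nrm0 mulr0.
have ap : 0 < nrm a by rewrite lt_def a0 nrm_ge0.
pose k := r / (2 * nrm a); have k0 : 0 < k by rewrite divr_gt0// mulr_gt0.
have := hd ((k%:C)%C *: a); rewrite -ball_normE/= sub0r normrN normE dE ltcR.
rewrite nrmZ nrm_real gtr0_norm// l0 sub0r nrmN lin_scale// nrmM nrm_real gtr0_norm//.
have ka : k * nrm a = r / 2 by rewrite /k invfM mulrA mulfVK.
rewrite ka => h; have {}h : k * nrm (l a) <= 1 by apply/ltW/h; lra.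
have -> : 2 / r * nrm a = k^-1 by rewrite /k invf_div mulrAC.
by rewrite -[leRHS]mulr1 ler_pdivlMl.
Qed.

Lemma bounded_linear_continuous (l : A -> Cplx R) (C : R) : linear l ->
  (forall a, nrm (l a) <= C * nrm a) -> continuous l.
Proof.
move=> lin lC a; apply/continuous_nrmP => e e0.
have C1 : 0 < `|C| + 1 by rewrite ltr_wpDl.
have := (@continuous_nrmP R A A id a).1 (@cvg_id _ _) _ (divr_gt0 e0 C1).
apply: filterS => b; rewrite ltr_pdivlMr// => ab; rewrite -lin_sub//.
apply: le_lt_trans (lC _) _; have := ler_norm C; have := nrm_ge0 (a - b); nra.
Qed.

Lemma Cc_comp_mul (u : R -> Cplx R) f : continuous u -> Cc f -> Cc (fun g => u (c g) * f g).
Proof.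
move=> cu Cf; apply: (@Cc_mul _ _ hT (fun g => u (c g))) => // g.
by apply: continuous_comp; [exact: cc|exact: cu].
Qed.

(** The dynamics multiplies [f] by [expi (t * c g)], so under a functional [l] the integrand is
    [inv_fourier F t] times [L] of an exponential, and the interchange takes the integral inside.
    The bound on [L] is the product of the bound on [l], the constant of the compact support and the
    supremum of [f]. *)
Lemma vintegral_iota F f : test_function F -> Cc f ->
  is_vintegral (fun t => inv_fourier F t *: sigma t (iota f))
    (iota (fun g => fourier_inverse F (c g) * f g)).
Proof.
move=> tF Cf l lin cl.
pose L (u : R -> Cplx R) : Cplx R := l (iota (fun g => u (c g) * f g)).
have [Cl Cl0 hl] := continuous_linear_bounded lin cl.
have [C1 C10 hC1] := iota_compact_le HG HA (Cc_compact Cf).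
have [Mf [Mf0 hMf]] := Cc_bounded Cf.
have [M M0 hM] : exists2 M, 0 <= M & forall g, f g != 0 -> `|c g| <= M.
  have : compact (c @` supp f).
    by apply: continuous_compact (Cc_compact Cf); exact: continuous_subspaceT.
  move=> /compact_bounded[M [_ MP]]; exists (`|M| + 1) => [|g fg].
    by rewrite addr_ge0.
  apply: MP; first by rewrite (le_lt_trans (ler_norm M)) // ltrDl.
  by exists g => //; exact: subset_closure.
have Llin (k : R[i]) (u v : R -> Cplx R) : continuous u -> continuous v ->
    L (fun y => k * u y + v y) = k * L u + L v.
  move=> cu cv; rewrite /L -(lin_scale k)// -lin_add// -(iota_lin HA); try exact: Cc_comp_mul.
  by congr (l (iota _)); apply/funext => g; rewrite mulrDl mulrA.
have Lle (u : R -> Cplx R) S : continuous u -> 0 <= S ->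
    (forall y, `|y| <= M -> nrm (u y) <= S) -> nrm (L u) <= Cl * (C1 * Mf) * S.
  move=> cu S0 uS; apply: le_trans (hl _) _; rewrite -!mulrA ler_wpM2l//.
  apply: hC1; [exact: Cc_comp_mul| |by rewrite mulr_ge0// ltW|].
    by apply: closureS => g /=; apply: contra_neq => ->; rewrite mulr0.
  move=> g; have [->|fg] := eqVneq (f g) 0; first by rewrite mulr0 nrm0 mulr_ge0// ltW.
  by rewrite nrmM mulrC ler_pM ?nrm_ge0// uS// hM.
have C0 : 0 <= Cl * (C1 * Mf) by rewrite !mulr_ge0// ltW.
have E t : l (inv_fourier F t *: sigma t (iota f)) =
    inv_fourier F t * L (fun y => expi (t * y)).
  by rewrite lin_scale//; case: dyn => _ ->.
rewrite (_ : (fun t => l _) = fun t => inv_fourier F t * L (fun y => expi (t * y))); last first.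
  exact/funext.
split; first exact: (interchange_integrable tF C0 M0 Llin Lle).
exact: (fourier_interchange tF C0 M0 Llin Lle).
Qed.

Lemma smear_iota F f : test_function F -> Cc f ->
  is_vintegral (fun t => inv_fourier F t *: sigma t (iota f))
    (smear sigma (inv_fourier F) (iota f)).
Proof.
move=> tF Cf; apply: (@xgetPex A 0 [set b | is_vintegral (fun t => inv_fourier F t *: sigma t (iota f)) b]).
by eexists; exact: vintegral_iota.
Qed.

(** For general [a], [vintegral] either has the defining property of the integral or takes its
    default value 0; [reduction_kernel_ground] deals with both cases. *)
Lemma smear_spec F a : is_vintegral (fun t => inv_fourier F t *: sigma t a)
    (smear sigma (inv_fourier F) a) \/ smear sigma (inv_fourier F) a = 0.
Proof.
rewrite /smear /vintegral; case: xgetP => [b _ h|_]; [by left|by right].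
Qed.

End Smearing.

(** * Ground states and functions vanishing on the boundary groupoid *)

Section GroundStates.
Context {R : realType} {T : topologicalType} (G : groupoid T).
Hypothesis HG : lch_etale G.
Context (A : cstarAlgebra R) (iota : (T -> Cplx R) -> A).
Hypothesis HA : is_groupoid_cstar G iota.
Variables (c : T -> R) (sigma : R -> A -> A).
Hypothesis coc : cocycle G c.
Hypothesis cc : continuous c.
Hypothesis dyn : is_cocycle_dynamics c iota sigma.
Let hT := lch_hausdorff HG.
Let lcT := lch_locally_compact HG.
Let Z := boundary_set G c.
Implicit Types (f : T -> Cplx R) (F : R -> R[i]) (a b y : A).
Local Notation conv := (convolution G).
Local Notation star := (involution G).

Lemma star_bisection_src f U u : bisection G U -> (forall x, ~ U x -> f x = 0) ->
  U u -> conv (star f) f (gsrc G u) = ((nrm (f u))^+2)%:C%C.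
Proof.
move=> bU f0 Uu; rewrite (@conv_single _ _ _ _ _ _ (ginv G u)).
- by rewrite involutionE ginvK gmulg1 conj_mul_nrm.
- by rewrite grng_inv grng_src.
move=> k ku kn; rewrite involutionE.
have [Uk|/f0 ->] := pselect (U (ginv G k)); last by rewrite conjc0 mul0r.
case: kn; rewrite -[k](ginvK G); congr ginv; case: bU => _ _; apply => //.
by rewrite gsrc_inv ku grng_src.
Qed.

Lemma cocycle_unit x : gunits G x -> c x = 0.
Proof.
move=> x1; have xx : gmul G x x = x by rewrite -{1}x1 gmul1g.
have := @coc x x; rewrite unit_src// => /(_ (esym x1)).
by rewrite xx => /eqP; rewrite addrC -subr_eq subrr eq_sym => /eqP.
Qed.

Lemma cocycle_inv g : c (ginv G g) = - c g.
Proof.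
have := @coc g (ginv G g); rewrite grng_inv gmulgV => /(_ erefl).
rewrite cocycle_unit; last exact: units_rng.
by move=> /esym/eqP; rewrite addrC addr_eq0 => /eqP.
Qed.

Let vanish F : closure [set t | F t != 0] `<=` [set t | t < 0] -> test_function F ->
  forall t, 0 <= t -> fourier_inverse F t = 0.
Proof.
move=> Fneg tF t t0; apply: fourier_inverse_off_support => // /Fneg/=.
by rewrite ltNge t0.
Qed.

Section StateFacts.
Variable phi : A -> Cplx R.
Hypothesis sp : state phi.

Let lp : linear phi. Proof. by case: sp. Qed.
Let pos a : (0 : R[i]) <= phi (cmul (cstar a) a). Proof. by case: sp. Qed.

Let section_lin y : linear (fun a => phi (cmul (cstar y) a)).
Proof. by move=> k a b; rewrite cmulDr cmulZr lp. Qed.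

Let section_le y a : nrm (phi (cmul (cstar y) a)) <= nrm y * nrm a.
Proof.
by apply: le_trans (state_le _ sp) _; apply: le_trans (nrm_cmul _ _) _; rewrite nrm_cstar.
Qed.

Let section_continuous y : continuous (fun a => phi (cmul (cstar y) a)).
Proof. exact: bounded_linear_continuous (section_lin y) (section_le y). Qed.

Let null_CS a y : phi (cmul (cstar a) a) = 0 ->
  phi (cmul (cstar y) a) = 0 /\ phi (cmul (cstar a) y) = 0.
Proof.
move=> a0; split; apply: nrm_eq0; apply/eqP; rewrite -sqrf_eq0 eq_le sqr_ge0 andbT.
  by have := positive_CS y a lp pos; rewrite a0 mulr0.
by have := positive_CS a y lp pos; rewrite a0 mul0r.
Qed.

Section LeftKernel.
Hypothesis gs : ground_state sigma phi.

(** The ground condition puts the smeared element in the left kernel of [phi]. Under the functional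
    that sends [a] to phi(y^* a) it has the same value as the explicit element, both being integrals
    of the same function. *)
Let ground_spectral F f y : test_function F ->
  closure [set t | F t != 0] `<=` [set t | t < 0] -> Cc f ->
  phi (cmul (cstar y) (iota (fun g => fourier_inverse F (c g) * f g))) = 0.
Proof.
move=> tF Fneg Cf; have [_ /(_ F tF Fneg (iota f))/= /(null_CS y)[b0 _]] := gs.
have [_] := smear_iota HG HA cc dyn tF Cf (section_lin y) (@section_continuous y).
have [_] := vintegral_iota HG HA cc dyn tF Cf (section_lin y) (@section_continuous y).
by move=> -> <-.
Qed.

Let boundaryN x : gunits G x -> ~ Z x -> exists2 g, gsrc G g = x & c g < 0.
Proof.
move=> x1 nZ; apply: contrapT => n; apply: nZ; split=> // g gx.
rewrite leNgt; apply/negP => cg; apply: n; exists (ginv G g).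
  by rewrite gsrc_inv.
by rewrite cocycle_inv oppr_lt0.
Qed.

(** A continuous substitute for [1/z] that is exact where [|z|^2 >= d]. *)
Let normalizer (d : R) (z : Cplx R) : Cplx R :=
  (z^*%C : R[i]) * (((Num.max (nrm z ^+ 2) d)^-1)%:C)%C.

Let normalizerE (d : R) (z : Cplx R) : 0 < d -> d <= nrm z ^+ 2 -> z * normalizer d z = 1.
Proof.
move=> d0 dz; rewrite /normalizer mulrA [z * _]mulrC conj_mul_nrm max_l//.
by rewrite -rmorphM/= mulfV// gt_eqF// (lt_le_trans d0).
Qed.

Let continuous_normalizer (d : R) (u : R -> Cplx R) : 0 < d -> continuous u ->
  continuous (fun t => normalizer d (u t)).
Proof.
move=> d0 cu t; apply: (@continuous_mulc _ _ (fun t => ((u t : R[i])^*%C : Cplx R))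
  (fun t => (((Num.max (nrm (u t) ^+ 2) d)^-1)%:C)%C)).
  by apply: continuous_conj; exact: cu.
apply: (@continuous_real_complex _ _ (fun t => (Num.max (nrm (u t) ^+ 2) d)^-1)).
apply: cvgV; first by rewrite gt_eqF// lt_max d0 orbT.
have cn : {for t, continuous (fun t => nrm (u t) ^+ 2)}.
  rewrite (_ : (fun t => _) = fun t => nrm (u t) * nrm (u t)); last by apply/funext => z; rewrite expr2.
  by apply: cvgM; apply: continuous_nrm; exact: cu.
by apply: (@continuous_max _ _ (fun t => nrm (u t) ^+ 2) (fun=> d)) => //; exact: cvg_cst.
Qed.

(* A function supported near [g1] with [c g1 < 0] is [W \o c] times another
   one, where [W] is nonzero at [c g1]; it is 1 near [g1], so it can be split
   off on the right from any function whose arrows start near [s(g1)]. *)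
Lemma ground_left_kernel f : Cc f -> (forall g, supp f g -> ~ Z (gsrc G g)) ->
  forall y, phi (cmul (cstar y) (iota f)) = 0.
Proof.
move=> Cf fZ; apply: (@Cc_local_ind _ _ hT lcT f
  (fun k => forall y, phi (cmul (cstar y) (iota k)) = 0) Cf).
- by move=> y; rewrite (iota0 HG HA) -(subrr (0 : A)) cmulBr subrr -(subrr y) lin_sub// subrr.
- by move=> f1 f2 C1 C2 h1 h2 y; rewrite (iotaD HA)// cmulDr lin_add// h1 h2 addr0.
move=> g /fZ nZ; have [g1 g1s cg1] := boundaryN (units_src G g) nZ.
have [F [tF Fneg Wg1]] := negative_test_function cg1.
pose W : T -> Cplx R := fun h => fourier_inverse F (c h).
have cW : continuous W.
  by move=> h; apply: continuous_comp; [exact: cc|exact: continuous_fourier_inverse].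
pose w := nrm (W g1); have w0 : 0 < w.
  by rewrite lt_def nrm_ge0 andbT; apply/eqP => /nrm_eq0.
have w2 : 0 < w / 2 by rewrite divr_gt0.
have [U [bU Ug1 UW]] : exists U, [/\ bisection G U, U g1 & U `<=` [set h | w / 2 < nrm (W h)]].
  apply: (bisection_nbhs HG); have /continuous_nrmP/(_ _ w2) := cW g1.
  apply: filterS => h /= hW; have := nrmD (W g1 - W h) (W h); rewrite subrK -/w; lra.
have oU : open U by case: bU.
have [|||e [ce e01 [V [oV gV eV]] eU ceK]] := @bump_exists _ hT lcT R [set g1] U.
- exact: compact_set1.
- exact: oU.
- by move=> _ ->.
pose f1 : T -> Cplx R := fun h => ((e h)%:C)%C.
have C1 : Cc f1 by exact: Cc_real.
have f1U h : ~ U h -> f1 h = 0.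
  move=> nU; rewrite /f1; have [->//|eh] := eqVneq (e h) 0.
  by case: nU; apply: eU; exact: subset_closure.
pose d := (w / 2) ^+ 2; have d0 : 0 < d by rewrite exprn_gt0.
pose f0 : T -> Cplx R := fun h => normalizer d (W h) * f1 h.
have C0 : Cc f0.
  apply: (Cc_comp_mul HG cc (u := fun t => normalizer d (fourier_inverse F t))) => //.
  by apply: continuous_normalizer => //; exact: continuous_fourier_inverse.
have E1 : (fun h => W h * f0 h) = f1.
  apply/funext => h; rewrite /f0 mulrA.
  have [/UW/= Wh|/f1U ->] := pselect (U h); last by rewrite mulr0.
  rewrite normalizerE ?mul1r// /d ler_pXn2r ?nnegrE ?nrm_ge0//; exact/ltW.
have N1 y : phi (cmul (cstar y) (iota f1)) = 0.
  by have := ground_spectral y tF Fneg C0; rewrite -/W E1.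
exists (gsrc G @^-1` (gsrc G @` (V `&` U))); split.
  apply: open_nbhs_nbhs; split.
    apply: open_comp; first by move=> h _; exact: continuous_gsrc.
    by apply: (open_gsrc HG); exact: openI.
  by exists g1 => //; split=> //; exact: gV.
move=> a ca a01 sa y; set k := rscale a f in sa *.
have Ck : Cc k by exact: Cc_rscale.
have Cs1 := Cc_star HG C1.
have Ek : conv (conv k (star f1)) f1 = k.
  have [uf _] := star_bisection bU f1U.
  rewrite -(convA HG Ck Cs1 C1).
  rewrite conv_unitr//; apply/funext => h.
  (* [f1^* f1] is a function on the unit space, equal to 1 at the source of every arrow of [U] where
     [f1] is 1. The sources of [k] are of this kind, so [f1^* f1] acts on [k] as a right unit. *)
  have [/sa[u [Vu Uu] uh]|/suppN ->] := pselect (supp k h); last by rewrite mul0r.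
  by rewrite -uh (star_bisection_src bU)// /f1 eV// nrm_real normr1 expr1n mulr1.
have Ck1 := Cc_conv HG Ck Cs1.
rewrite -Ek (iotaM HA)// cmulA -[X in cmul X _]cstarK cstarM cstarK.
exact: N1.
Qed.

Let ground_src f : Cc f -> (forall g, supp f g -> ~ Z (gsrc G g)) -> phi (iota f) = 0.
Proof.
move=> Cf fZ; have [e [ue _ <-]] := local_unit_l HG Cf; have [_ Ce _] := ue.
rewrite (iotaM HA)// -[iota (fun x => _)]cstarK.
exact: ground_left_kernel.
Qed.

Let ground_rng f : Cc f -> (forall g, supp f g -> ~ Z (grng G g)) -> phi (iota f) = 0.
Proof.
move=> Cf fZ; have Cs := Cc_star HG Cf.
have [e [ue _ E]] := local_unit_r HG Cf; have [_ Ce _] := ue.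
rewrite -E (iotaM HA)// -[iota f]cstarK -(iota_star HA)//.
apply: (null_CS _ _).2; apply: ground_left_kernel => // g sg.
have := fZ (ginv G g); rewrite grng_inv; apply.
move: g sg; apply: supp_closed => [|x nx].
  apply: (@preimage_closed _ _ (ginv G)); last exact: closed_supp.
  by move=> y _; exact: (continuous_ginv HG).
by rewrite involutionE (suppN nx) conjc0.
Qed.

(** A function that vanishes on the reduction may still have points of the reduction in its closed
    support, so it cannot be split directly. The part above the threshold has its support where
    [|f| >= e], away from the reduction, and splits into a piece with sources off [Z] and a piece
    with ranges off [Z]; the rest is at most [2 e] on a fixed compact set. *)
Lemma ground_reduction_kernel f : Cc f ->
  (forall g, reduction_set G Z g -> f g = 0) -> phi (iota f) = 0.
Proof.
move=> Cf fZ; have cZ : closed Z by exact: closed_boundary_set.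
have [C C0 hC] := iota_compact_le HG HA (Cc_compact Cf).
apply: (@nrm_small _ _ _ (2 * C)) => e e0 _.
(* [p] is 0 where [|f| <= e] and 1 where [|f| >= 2 e]. *)
pose p (z : T) := Num.min (Num.max (nrm (f z) / e - 1) 0) 1.
have cf : continuous f by case: Cf.
have cp : continuous p.
  move=> z; apply: (@continuous_min _ _ (fun z => Num.max (nrm (f z) / e - 1) 0) (fun=> 1)).
    apply: (@continuous_max _ _ (fun z => nrm (f z) / e - 1) (fun=> 0)).
      by apply: cvgB; [apply: cvgMl; apply: continuous_nrm; exact: cf|exact: cvg_cst].
    exact: cvg_cst.
  exact: cvg_cst.
have p01 z : 0 <= p z <= 1 by rewrite /p le_min ge_min le_max !lexx !orbT ler01.
have Cp : Cc (rscale p f) by exact: Cc_rscale.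
have Cq : Cc (rscale (fun z => 1 - p z) f).
  by apply: Cc_rscale => // z; apply: cvgB; [exact: cvg_cst|exact: cp].
have oS : open (gsrc G @^-1` (~` Z)).
  apply: open_comp; last exact: closed_openC.
  by move=> z _; exact: (continuous_gsrc HG).
have oR : open (grng G @^-1` (~` Z)).
  apply: open_comp; last exact: closed_openC.
  by move=> z _; exact: (continuous_grng HG).
have pSR : supp (rscale p f) `<=` gsrc G @^-1` (~` Z) `|` grng G @^-1` (~` Z).
  have : supp (rscale p f) `<=` [set z | e <= nrm (f z)].
    apply: supp_closed => [|z /= /negP]; last first.
      rewrite -ltNge => /ltW fe; rewrite /rscale /p max_r ?min_l ?mul0r//.
      by rewrite subr_le0 ler_pdivrMr// mul1r.
    apply: (@preimage_closed _ _ (fun z => nrm (f z)) [set t | e <= t]).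
      by move=> z _; apply: continuous_nrm; exact: cf.
    exact: closed_ge.
  move=> h z /h/= fz; apply: contrapT => /not_orP[/contrapT z1 /contrapT z2].
  by move: fz; rewrite fZ// nrm0 leNgt e0.
have [a [ca a01 sU sW]] := Cc_split hT lcT Cp oS oR pSR.
have Ca : Cc (rscale a (rscale p f)) by exact: Cc_rscale.
have Ca' : Cc (rscale (fun z => 1 - a z) (rscale p f)).
  by apply: Cc_rscale => // z; apply: cvgB; [exact: cvg_cst|exact: ca].
rewrite [f in iota f](rscale_split p) (iotaD HA)// lin_add//.
rewrite [rscale p f](rscale_split a) (iotaD HA)// lin_add//.
rewrite ground_src// ground_rng// !add0r; apply: le_trans (state_le _ sp) _.
rewrite [2 * C]mulrC -mulrA; apply: hC => //.
- by apply: closureS => z /=; apply: contra_neq; rewrite /rscale => ->; rewrite mulr0.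
- by rewrite mulr_ge0// ltW.
move=> z; rewrite /rscale nrmM nrm_real ger0_norm; last by have := p01 z; lra.
have n0 := nrm_ge0 (f z); have [fz|fz] := leP (nrm (f z)) (2 * e).
  by apply: le_trans fz; rewrite ler_piMl//; have := p01 z; lra.
rewrite (_ : p z = 1) ?subrr ?mul0r ?mulr_ge0 ?(ltW e0)//.
have h : 1 <= nrm (f z) / e - 1 by rewrite lerBrDr ler_pdivlMr//; lra.
by rewrite /p max_l ?min_r// (le_trans ler01).
Qed.

End LeftKernel.

(** Let [b] be the smeared element of [a]. Tested on the functional that sends [x] to phi(b^* x),
    the integral gives phi(b^* b) as an integral over the orbit of [a]. With [iota f] in place of
    [a] this integral vanishes, and the automorphism bound controls the replacement uniformly in
    [t]. *)
Lemma reduction_kernel_ground :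
  (forall f, Cc f -> (forall g, reduction_set G Z g -> f g = 0) -> phi (iota f) = 0) ->
  ground_state sigma phi.
Proof.
move=> phiZ; split=> // F tF Fneg a /=; set b := smear _ _ _.
have phi0 y : phi (cmul (cstar y) 0) = 0.
  by rewrite -(subrr (0 : A)) cmulBr subrr -(subrr y) lin_sub// subrr.
have [hb|b0] := smear_spec sigma F a; last by rewrite [b]b0; exact: phi0.
rewrite -/b in hb.
have spectral0 f : Cc f ->
    phi (cmul (cstar b) (iota (fun g => fourier_inverse F (c g) * f g))) = 0.
  move=> Cf; set Wf := fun g => _.
  have CW : Cc Wf.
    by apply: (Cc_comp_mul HG cc) => //; exact: continuous_fourier_inverse.
  have CsW := Cc_star HG CW.
  (* [Wf^* Wf] vanishes on the reduction: in a term at [g] the arrow [k] has its range in [Z], so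
     [c] is nonnegative at [k^-1], where [W] vanishes. *)
  apply: (null_CS _ _).1; rewrite -(iota_star HA)// -(iotaM HA)//.
  apply: phiZ => [|g [[_ rg] _]]; first exact: Cc_conv.
  apply: fsbig1 => k kg; rewrite involutionE /Wf (vanish Fneg tF).
    by rewrite mul0r conjc0 mul0r.
  by rewrite cocycle_inv oppr_ge0; exact: rg.
have [ib ->] := hb _ (section_lin b) (@section_continuous b).
have [K K0 hK] := inv_fourier_dominated tF.
(* The outer 2 stems from [cintegral_le], the inner one from [automorphism_bound]. *)
apply: (@nrm_small _ _ _ (2 * (2 * K * nrm b) * weight_mass)) => e e0 _.
have [f Cf fe] := iota_dense HA a e0.
have [if1 if2] := vintegral_iota HG HA cc dyn tF Cf (section_lin b) (@section_continuous b).
have -> : cintegral (fun t => phi (cmul (cstar b) (inv_fourier F t *: sigma t a))) =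
    cintegral (fun t => -1 * phi (cmul (cstar b) (inv_fourier F t *: sigma t (iota f))) +
      phi (cmul (cstar b) (inv_fourier F t *: sigma t a))).
  rewrite cintegralD//; last exact: cintegrableZ.
  by rewrite cintegralZ// -if2 spectral0// mulr0 add0r.
have id := cintegrableD (cintegrableZ (-1) if1) ib.
have mi (h : R -> R) : (@lebesgue_measure R).-integrable setT (EFin \o h) ->
    measurable_fun setT h.
  by move=> /integrableP[/measurable_EFinP].
rewrite (_ : _ * weight_mass * e = 2 * (2 * K * nrm b * e) * weight_mass); last by ring.
apply: cintegral_le; split; [exact: mi id.1|exact: mi id.2|] => t.
rewrite mulN1r addrC -lin_sub// -cmulBr -scalerBr.
have [st _ _ _] := (dyn.1 : one_parameter_group sigma).
have -> : sigma t a - sigma t (iota f) = sigma t (a - iota f).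
  have [ls _ _ _] := st t; have := ls (-1) (iota f) a.
  by rewrite !scaleN1r (addrC (- iota f)) => ->; rewrite addrC.
apply: le_trans (section_le _ _) _; rewrite nrmZ.
have := automorphism_bound (st t) (a - iota f); have := (hK t).1.
set x := nrm (sigma t _); set z := nrm (inv_fourier F t : Cplx R) => hz hx.
have x2 : x <= 2 * e by apply: le_trans hx _; rewrite ler_pM2l// ltW.
rewrite (_ : _ * weight t = nrm b * ((K * weight t) * (2 * e))); last by ring.
rewrite ler_wpM2l ?nrm_ge0//; apply: ler_pM => //; exact: nrm_ge0.
Qed.

End StateFacts.

End GroundStates.

(** * The correspondence of states *)

Section BoundaryStates.
Context {R : realType} {T : topologicalType} (G : groupoid T).
Hypothesis HG : lch_etale G.
Context (A : cstarAlgebra R) (iota : (T -> Cplx R) -> A).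
Hypothesis HA : is_groupoid_cstar G iota.
Variables (c : T -> R) (sigma : R -> A -> A).
Hypothesis coc : cocycle G c.
Hypothesis cc : continuous c.
Hypothesis dyn : is_cocycle_dynamics c iota sigma.
Let hT := lch_hausdorff HG.
Let Z := boundary_set G c.
Let GZ := reduction G Z.
Hypothesis eGZ : etale GZ.
Context (B : cstarAlgebra R) (kappa : (reduction_set G Z -> Cplx R) -> B).
Hypothesis HB : is_groupoid_cstar GZ kappa.
Implicit Types (phi : A -> Cplx R) (psi : B -> Cplx R) (f : T -> Cplx R)
  (h : reduction_set G Z -> Cplx R).

Let cZ : closed Z. Proof. exact: closed_boundary_set. Qed.
Let HGZ : lch_etale GZ. Proof. exact: reduction_lch_etale. Qed.

Lemma state_linear (D : cstarAlgebra R) (p : D -> Cplx R) : state p -> linear p.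
Proof. by case. Qed.

Lemma boundary_positive psi : state psi ->
  positive_functional G (fun f => psi (kappa (f \o val))).
Proof.
move=> sp; have pp := state_pf HGZ HB sp; split=> [k f1 f2 C1 C2|f Cf|e ue e01].
- rewrite -(lin_scale k _ (state_linear sp)) -(lin_add (state_linear sp)).
  by rewrite -(iota_lin HB)//; exact: (Cc_restrict HG cZ).
- exact: (reduction_positive HG cZ eGZ pp Cf).
by apply: (pf_bound pp (unit_weight_restrict HG cZ ue)) => x; exact: e01.
Qed.

Lemma boundary_state_extension psi : state psi ->
  exists phi, state phi /\ forall f, Cc f -> phi (iota f) = psi (kappa (f \o val)).
Proof.
move=> sp; apply: (state_extension HG HA (boundary_positive sp)) => d d0.
have [e [ue e01 he]] := state_unit_sup HGZ HB sp d0.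
have [e' [ue' e01' E]] := unit_weight_extension HG cZ ue e01.
by exists e'; split=> //; move: he; rewrite -E.
Qed.

Lemma boundary_state_ground phi psi : state phi -> state psi ->
  (forall f, Cc f -> phi (iota f) = psi (kappa (f \o val))) -> ground_state sigma phi.
Proof.
move=> sp sq E; apply: (reduction_kernel_ground HG HA coc cc dyn sp) => f Cf fZ.
rewrite E// (_ : f \o val = fun=> 0).
  rewrite (iota0 HGZ HB); have := lin_scale 0 0 (state_linear sq).
  by rewrite scale0r mul0r.
by apply/funext => g; apply: fZ; exact: redP.
Qed.

(** [psi] is defined on a function on the reduction through any extension to [G]; by
    [ground_reduction_kernel] the choice does not matter. *)
Lemma ground_state_boundary phi : ground_state sigma phi ->
  exists psi, state psi /\ forall f, Cc f -> phi (iota f) = psi (kappa (f \o val)).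
Proof.
move=> gs; have [sp _] := gs; have lp := state_linear sp; have pp := state_pf HG HA sp.
have /choice[ext hext] : forall h, exists f, Cc h -> Cc f /\ f \o val = h.
  move=> h; have [Ch|] := pselect (Cc h); last by exists (fun=> 0).
  by have [f [Cf E _]] := Cc_extension HG cZ Ch openT (@subsetT _ _); exists f.
pose psi0 h := phi (iota (ext h)).
have restrict f h : Cc f -> f \o val = h -> psi0 h = phi (iota f).
  move=> Cf fh; have Ch : Cc h by rewrite -fh; exact: Cc_restrict.
  have [Ce E] := hext _ Ch; apply/eqP; rewrite -subr_eq0 -lin_sub//.
  rewrite -[iota f]scale1r -scaleNr addrC -(iota_lin HA)//; apply/eqP.
  apply: (ground_reduction_kernel HG HA coc cc dyn sp gs) => [|g gZ].
    exact: (Cc_lin hT).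
  have := congr1 (fun u => u (exist _ g (mem_set gZ))) (etrans E (esym fh)).
  by rewrite /= => ->; rewrite mulN1r addNr.
have [|d d0|psi [sq hpsi]] := @state_extension _ _ _ HGZ _ _ HB psi0.
- split=> [k h1 h2 C1 C2|h Ch|e ue e01].
  + have [Ce1 E1] := hext _ C1; have [Ce2 E2] := hext _ C2.
    rewrite (@restrict (fun g => k * ext h1 g + ext h2 g)).
    * by rewrite (iota_lin HA)// lin_add// lin_scale.
    * exact: (Cc_lin hT).
    * by rewrite -[in RHS]E1 -[in RHS]E2.
  (* Independence of the extension permits one supported in [good_set], for which [f^* f] restricts
     to [h^* h]; positivity of [phi] then gives that of [psi0]. *)
  + have [f [Cf fh fg]] := Cc_extension HG cZ Ch (@open_good_set _ G Z)
      (reduction_set_good HG cZ eGZ).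
    rewrite (@restrict (convolution G (involution G f) f)).
    * exact: (pf_pos pp Cf).
    * by apply: (Cc_conv HG) => //; exact: (Cc_star HG).
    rewrite star_conv_restrict ?fh// => k /eqP fk.
    by apply: (good_setP _).2; apply: fg; apply: contrapT => /suppN.
  + have [e' [ue' e01' E]] := unit_weight_extension HG cZ ue e01.
    have [_ Ce' _] := ue'; rewrite (restrict _ _ Ce'); first exact: (pf_bound pp ue').
    by apply/funext => g; rewrite /= -E.
- have [e [ue e01 he]] := state_unit_sup HG HA sp d0; have [_ Ce _] := ue.
  exists (e \o val); split; first exact: (unit_weight_restrict HG cZ).
    by move=> x; exact: e01.
  by rewrite (restrict _ _ Ce).
exists psi; split=> // f Cf; rewrite hpsi; first exact/esym/restrict.
exact: Cc_restrict.
Qed.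

Lemma boundary_state_inj psi1 psi2 : state psi1 -> state psi2 ->
  (forall f, Cc f -> psi1 (kappa (f \o val)) = psi2 (kappa (f \o val))) -> psi1 = psi2.
Proof.
move=> s1 s2 E; apply: (@functional_ext _ _ _ _ _ HB _ _ 1) => [| |a|a|h Ch].
- exact: state_linear.
- exact: state_linear.
- by rewrite mul1r; exact: state_le.
- by rewrite mul1r; exact: state_le.
by have [f [Cf <- _]] := Cc_extension HG cZ Ch openT (@subsetT _ _); exact: E.
Qed.

(** Weaker than being a state, yet enough for uniqueness and preserved by convex combinations.
    Affinity of the map thus follows from uniqueness of extensions alone. *)
Let extends psi phi := [/\ linear phi, forall a, nrm (phi a) <= nrm a &
  forall f, Cc f -> phi (iota f) = psi (kappa (f \o val))].

Let extends_uniq psi phi1 phi2 : extends psi phi1 -> extends psi phi2 -> phi1 = phi2.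
Proof.
move=> [l1 b1 E1] [l2 b2 E2]; apply: (@functional_ext _ _ _ _ _ HA _ _ 1) => // [a|a|f Cf].
- by rewrite mul1r.
- by rewrite mul1r.
by rewrite E1// E2.
Qed.

Let state_extends psi phi : state phi ->
  (forall f, Cc f -> phi (iota f) = psi (kappa (f \o val))) -> extends psi phi.
Proof. by move=> sp E; split=> //; [exact: state_linear|move=> a; exact: state_le]. Qed.

Lemma boundary_state_isomorphism : exists Phi : (B -> Cplx R) -> (A -> Cplx R),
  [/\ set_bij (@state R B) (ground_state sigma) Phi, affine_on (@state R B) Phi &
      forall psi, state psi ->
        (forall f, Cc f -> Phi psi (iota f) = psi (kappa (f \o val))) /\
        (forall phi, state phi ->
          (forall f, Cc f -> phi (iota f) = psi (kappa (f \o val))) -> phi = Phi psi)].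
Proof.
have /choice[Phi hPhi] : forall psi, exists phi,
    (exists phi, extends psi phi) -> extends psi phi.
  move=> psi; have [[phi E]|n] := pselect (exists phi, extends psi phi); first by exists phi.
  by exists (fun=> 0).
have PhiE psi phi : extends psi phi -> Phi psi = phi.
  by move=> e; apply: (extends_uniq (psi := psi)) => //; apply: hPhi; exists phi.
have Phi_state psi : state psi -> state (Phi psi) /\ extends psi (Phi psi).
  move=> sq; have [phi [sp E]] := boundary_state_extension sq.
  by have e := state_extends sp E; rewrite (PhiE _ _ e).
exists Phi; split; first split.
- move=> psi sq; have [sp [_ _ E]] := Phi_state _ sq.
  exact: boundary_state_ground E.
- move=> psi1 psi2 /set_mem s1 /set_mem s2 E; apply: boundary_state_inj => // f Cf.
  have [_ [_ _ <-//]] := Phi_state _ s1; have [_ [_ _ <-//]] := Phi_state _ s2.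
  by rewrite E.
- move=> phi gs; have [psi [sq E]] := ground_state_boundary gs; exists psi => //.
  by apply: PhiE; apply: state_extends E; have [] := gs.
- move=> t psi1 psi2 /andP[t0 t1] s1 s2; apply: PhiE.
  have [_ [l1 b1 E1]] := Phi_state _ s1; have [_ [l2 b2 E2]] := Phi_state _ s2.
  split=> [k a b|a|f Cf].
  + rewrite l1 l2 !scalerDr !scalerA addrACA; congr (_ + _).
    by rewrite mulrC [_ * k]mulrC.
  + apply: le_trans (nrmD _ _) _; rewrite !nrmZ !nrm_real !ger0_norm ?subr_ge0//.
    have := b1 a; have := b2 a; have : 0 <= 1 - t by rewrite subr_ge0.
    nra.
  + by rewrite E1// E2.
move=> psi sq; have [sp e] := Phi_state _ sq; split; first by case: e.
by move=> phi sphi E; rewrite (PhiE _ _ (state_extends sphi E)).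
Qed.

End BoundaryStates.

(** With [Z] empty, [phi] vanishes on all of C_c(G), whereas a state has positive real part at some
    weight. *)
Lemma empty_boundary_ground (R : realType) (T : topologicalType) (G : groupoid T)
    (HG : lch_etale G) (A : cstarAlgebra R) (iota : (T -> Cplx R) -> A)
    (HA : is_groupoid_cstar G iota) (c : T -> R) (sigma : R -> A -> A)
    (coc : cocycle G c) (cc : continuous c) (dyn : is_cocycle_dynamics c iota sigma) :
  boundary_set G c = set0 -> ground_state sigma = set0.
Proof.
move=> Z0; apply/seteqP; split=> // phi gs; have [sp _] := gs.
have [e [[_ Ce _] _]] := state_unit_sup HG HA sp ltr01.
rewrite (ground_reduction_kernel HG HA coc cc dyn sp gs Ce) ?subrr ?ltxx//.
by move=> g [+ _]; rewrite Z0.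
Qed.

Theorem theorem1p4 (R : realType) (T : topologicalType) (G : groupoid T)
    (G_hausdorff : hausdorff_space T)
    (G_second_countable : @second_countable T)
    (G_locally_compact : locally_compact [set: T])
    (G_topological : topological_groupoid G)
    (G_etale : etale G)
    (c : T -> R) (c_cocycle : cocycle G c) (c_continuous : continuous c)
    (A : cstarAlgebra R) (iota : (T -> Cplx R) -> A)
    (A_enveloping : is_groupoid_cstar G iota)
    (sigma : R -> A -> A) (sigma_dynamics : is_cocycle_dynamics c iota sigma) :
  let Z := boundary_set G c in
  let GZ := reduction G Z in
  (Z !=set0 -> etale GZ ->
    forall (B : cstarAlgebra R)
      (kappa : (reduction_set G Z -> Cplx R) -> B),
      is_groupoid_cstar GZ kappa ->
      exists Phi : (B -> Cplx R) -> (A -> Cplx R),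
        [/\ set_bij (@state R B) (ground_state sigma) Phi,
            affine_on (@state R B) Phi &
            forall psi, state psi ->
              (forall f, Cc f -> Phi psi (iota f) = psi (kappa (f \o val))) /\
              (forall phi, state phi ->
                (forall f, Cc f -> phi (iota f) = psi (kappa (f \o val))) ->
                phi = Phi psi)])
  /\ (Z = set0 -> ground_state sigma = set0).
Proof.
have HG := LchEtale G_hausdorff G_locally_compact G_topological G_etale.
split=> [_ eGZ B kappa HB|].
  exact: (boundary_state_isomorphism HG A_enveloping c_cocycle c_continuous sigma_dynamics eGZ HB).
exact: (empty_boundary_ground HG A_enveloping c_cocycle c_continuous sigma_dynamics).
Qed.
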